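(* Let $(M,g)$ be a smooth $n$-dimensional Riemannian manifold ($n\ge2$) of positive constant sectional curvature $c$, and let $A>0$ be a real constant. On the tube $$T^*_{0A}M=\Big\{p\in T^*M:\ 0<\|p\|^2<\frac{4c}{A^2}\Big\}$$ (on which $\frac{2c-A^2t}{At}>0$, where $t=\frac12\|p\|^2$), let $G$ be the Riemannian metric with components $$G_{ij}=At\,g_{ij}+\frac{c-A^2t}{At}p_ip_j,\qquad H^{ij}=\frac{1}{At}g^{ij}-\frac{c-A^2t}{At^2(2c-A^2t)}g^{0i}g^{0j},$$ and let $J$ be the associated almost complex structure, as described in the context. Then $(T^*_{0A}M,G,J)$ is a locally symmetric Kähler Einstein manifold.
   Context: Everything is of class $C^\infty$; indices run over $1,\dots,n$ and repeated indices are summed. $\pi:T^*M\to M$ is the cotangent bundle. A local chart $(U,x^1,\dots,x^n)$ on $M$ induces the chart $(\pi^{-1}(U),q^1,\dots,q^n,p_1,\dots,p_n)$ on $T^*M$, where $q^i=x^i\circ\pi$ and $p=p_i\,dx^i_{\pi(p)}$. Let $g_{ij}$ be the components of $g$, $(g^{ij})$ the inverse matrix, $\Gamma^k_{ij}$ the Christoffel symbols of the Levi-Civita connection of $g$, $g^{0i}=p_hg^{hi}$, $\Gamma^0_{ij}=p_k\Gamma^k_{ij}$, $\|p\|^2=g^{ik}p_ip_k$. Set $$\frac{\delta}{\delta q^i}=\frac{\partial}{\partial q^i}+\Gamma^0_{ih}\frac{\partial}{\partial p_h},\qquad Dp_i=dp_i-\Gamma^0_{ij}dq^j ;$$ the fields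 $\frac{\delta}{\delta q^i},\frac{\partial}{\partial p_i}$ form a local frame, with dual coframe $dq^i,Dp_i$. The matrices $(G_{ij})$ and $(H^{ij})$ are inverse to each other. The metric with components $G_{ij},H^{ij}$ is $G=G_{ij}dq^idq^j+H^{ij}Dp_iDp_j$, i.e. $$G\Big(\frac{\delta}{\delta q^i},\frac{\delta}{\delta q^j}\Big)=G_{ij},\quad G\Big(\frac{\partial}{\partial p_i},\frac{\partial}{\partial p_j}\Big)=H^{ij},\quad G\Big(\frac{\partial}{\partial p_i},\frac{\delta}{\delta q^j}\Big)=0,$$ and $$J\frac{\delta}{\delta q^i}=G_{ik}\frac{\partial}{\partial p_k},\qquad J\frac{\partial}{\partial p_i}=-H^{ik}\frac{\delta}{\delta q^k}.$$ Locally symmetric means that the curvature tensor $K$ of the Levi-Civita connection $\nabla$ of $G$ satisfies $\nabla K=0$; Einstein means that the Ricci tensor of $G$ is a constant multiple of $G$. *)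

(* Defs.v *)
From HB Require Import structures.
From mathcomp Require Import all_boot all_order all_algebra.
From mathcomp Require Import all_classical all_reals all_analysis.

Set Implicit Arguments.
Unset Strict Implicit.
Unset Printing Implicit Defensive.

Import Order.TTheory GRing.Theory Num.Theory.
Import numFieldNormedType.Exports.

Local Open Scope classical_set_scope.
Local Open Scope ring_scope.

(* Calculus on open subsets of R^m; points and tangent vectors are row
   vectors. *)
Section Calculus.
Context {R : realType} {m : nat}.
Implicit Types (f : 'rV[R]_m -> R) (U : set 'rV[R]_m) (x u v w : 'rV[R]_m).

Definition partial (k : 'I_m) f : 'rV[R]_m -> R :=
  fun x => 'D_(delta_mx 0 k) f x.

(* C^oo on an open set: f and all its iterated partial derivatives are
   differentiable at every point of U. *)
Definition smooth_on U f : Prop :=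
  forall (s : seq 'I_m) x, U x -> differentiable (foldr partial f s) x.

Definition bilin (a : 'M[R]_m) u v : R := (u *m a *m v^T) 0 0.

Section LeviCivita.
Variable h : 'rV[R]_m -> 'M[R]_m.

(* christoffel k i j is Gamma^k_{ij}. *)
Definition christoffel (k i j : 'I_m) x : R :=
  2^-1 * \sum_(l < m) invmx (h x) k l *
    (partial i (fun y => h y l j) x + partial j (fun y => h y l i) x
     - partial l (fun y => h y i j) x).

(* curvature l k i j is K^l_{kij}, where K(d_i, d_j) d_k = K^l_{kij} d_l and
   K(X, Y) = [nabla_X, nabla_Y] - nabla_[X, Y]. *)
Definition curvature (l k i j : 'I_m) x : R :=
  partial i (christoffel l j k) x - partial j (christoffel l i k) x
  + \sum_(a < m) (christoffel l i a x * christoffel a j k x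
                  - christoffel l j a x * christoffel a i k x).

(* K(u, v) w *)
Definition curvature_op x u v w : 'rV[R]_m :=
  \row_l \sum_(k < m) \sum_(i < m) \sum_(j < m)
    curvature l k i j x * w 0 k * u 0 i * v 0 j.

(* Sectional curvature of the plane spanned by u and v. *)
Definition sectional_curvature x u v : R :=
  bilin (h x) (curvature_op x u v v) u
  / (bilin (h x) u u * bilin (h x) v v - bilin (h x) u v ^+ 2).

(* Ric(Y, Z) = tr (X |-> K(X, Y) Z) *)
Definition ricci (j k : 'I_m) x : R := \sum_(i < m) curvature i k i j x.

(* (nabla_{d_s} K)^l_{kij} *)
Definition nabla_curvature (s l k i j : 'I_m) x : R :=
  partial s (curvature l k i j) x
  + \sum_(a < m) (christoffel l s a x * curvature a k i j x
                  - christoffel a s k x * curvature l a i j x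
                  - christoffel a s i x * curvature l k a j x
                  - christoffel a s j x * curvature l k i a x).

End LeviCivita.

(* Endomorphisms act on row vectors: J d_a = \sum_b (J x a b) d_b.
   nijenhuis J k i j is the d_k-component of
   N(d_i, d_j) = [J d_i, J d_j] - J [J d_i, d_j] - J [d_i, J d_j]. *)
Definition nijenhuis (J : 'rV[R]_m -> 'M[R]_m) (k i j : 'I_m) x : R :=
  \sum_(a < m) (J x i a * partial a (fun y => J y j k) x
                - J x j a * partial a (fun y => J y i k) x
                - J x a k * (partial i (fun y => J y j a) x
                             - partial j (fun y => J y i a) x)).

(* Omega(X, Y) = G(X, J Y) *)
Definition fundamental_form (G J : 'rV[R]_m -> 'M[R]_m) (i j : 'I_m) x : R :=
  (G x *m (J x)^T) i j.

Definition d_form2 (w : 'I_m -> 'I_m -> 'rV[R]_m -> R) (i j k : 'I_m) x : R :=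
  partial i (w j k) x + partial j (w k i) x + partial k (w i j) x.

End Calculus.

(* A set with a family of R^m-valued charts; the map chart i is meaningful only
   on dom i. *)
Record atlas (R : realType) (m : nat) := Atlas {
  pt : Type;
  idx : Type;
  dom : idx -> set pt;
  chart : idx -> pt -> 'rV[R]_m }.

(* The points with the topology induced by the charts. *)
Definition manifold_space (R : realType) (m : nat) (X : atlas R m) : Type := pt X.

HB.instance Definition _ (R : realType) (m : nat) (X : atlas R m) :=
  gen_eqMixin (manifold_space X).
HB.instance Definition _ (R : realType) (m : nat) (X : atlas R m) :=
  gen_choiceMixin (manifold_space X).
HB.instance Definition _ (R : realType) (m : nat) (X : atlas R m) :=
  isSubBaseTopological.Build (manifold_space X)
    [set V : set (manifold_space X) | exists i (O : set 'rV[R]_m),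
       open O /\ V = dom i `&` chart i @^-1` O] id.

Section Manifold.
Context {R : realType} {m : nat} (X : atlas R m).

Definition chart_image (i : idx X) : set 'rV[R]_m := chart i @` dom i.

(* chart j \o (chart i)^-1 on chart i @` (dom i `&` dom j), and 0 elsewhere *)
Definition transition (i j : idx X) (y : 'rV[R]_m) : 'rV[R]_m :=
  xget 0 [set z | exists x, [/\ dom i x, dom j x, chart i x = y
                              & chart j x = z]].

Definition transition_jacobian (i j : idx X) (x : pt X) : 'M[R]_m :=
  jacobian (transition i j) (chart i x).

Record smooth_manifold : Prop := SmoothManifold {
  sm_cover : forall x : pt X, exists i, dom i x;
  sm_chart_inj : forall (i : idx X) (x y : pt X),
    dom i x -> dom i y -> chart i x = chart i y -> x = y;
  sm_open : forall i j : idx X, open (chart i @` (dom i `&` dom j));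
  sm_smooth : forall (i j : idx X) (k : 'I_m),
    smooth_on (chart i @` (dom i `&` dom j)) (fun y => transition i j y 0 k);
  sm_hausdorff : hausdorff_space (manifold_space X);
  sm_second_countable : @second_countable (manifold_space X) }.

(* Component matrices, in each chart, of a tensor field with two indices; only
   the values on chart_image i are meaningful. *)
Definition field2 := idx X -> 'rV[R]_m -> 'M[R]_m.

Definition smooth_field2 (T : field2) : Prop :=
  forall (i : idx X) (a b : 'I_m),
    smooth_on (chart_image i) (fun y => T i y a b).

Record riemannian_metric (G : field2) : Prop := RiemannianMetric {
  rm_smooth : smooth_field2 G;
  rm_tensor : forall (i j : idx X) (x : pt X), dom i x -> dom j x ->
    G i (chart i x) = transition_jacobian i j x *m G j (chart j x)
                      *m (transition_jacobian i j x)^T;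
  rm_sym : forall (i : idx X) y, chart_image i y -> (G i y)^T = G i y;
  rm_pos : forall (i : idx X) y v, chart_image i y -> v != 0 ->
    0 < bilin (G i y) v v }.

Record almost_complex_structure (J : field2) : Prop := AlmostComplexStructure {
  ac_smooth : smooth_field2 J;
  ac_tensor : forall (i j : idx X) (x : pt X), dom i x -> dom j x ->
    J i (chart i x) *m transition_jacobian i j x
    = transition_jacobian i j x *m J j (chart j x);
  ac_square : forall (i : idx X) y, chart_image i y ->
    J i y *m J i y = - 1%:M }.

Definition constant_sectional_curvature (G : field2) (c : R) : Prop :=
  forall (i : idx X) y (u v : 'rV[R]_m), chart_image i y ->
    row_free (col_mx u v) -> sectional_curvature (G i) y u v = c.

Definition hermitian (G J : field2) : Prop :=
  forall (i : idx X) y u v, chart_image i y ->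
    bilin (G i y) (u *m J i y) (v *m J i y) = bilin (G i y) u v.

Definition integrable (J : field2) : Prop :=
  forall (i : idx X) y, chart_image i y ->
    forall k a b, nijenhuis (J i) k a b y = 0.

Definition kahler (G J : field2) : Prop :=
  [/\ riemannian_metric G, almost_complex_structure J, hermitian G J,
      integrable J
    & forall (i : idx X) y, chart_image i y ->
        forall a b k, d_form2 (fundamental_form (G i) (J i)) a b k y = 0].

Definition locally_symmetric (G : field2) : Prop :=
  forall (i : idx X) y, chart_image i y ->
    forall s l k a b, nabla_curvature (G i) s l k a b y = 0.

Definition einstein (G : field2) : Prop :=
  exists lambda : R, forall (i : idx X) y, chart_image i y ->
    forall a b, ricci (G i) a b y = lambda * G i y a b.

Definition locally_symmetric_kahler_einstein (G J : field2) : Prop :=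
  [/\ smooth_manifold, kahler G J, locally_symmetric G & einstein G].

(* A covector at base is the family of its components in all charts around
   base, obeying the transformation rule of covectors; components in the other
   charts are normalised to 0. *)
Record cotangent := Cotangent {
  base : pt X;
  comp : idx X -> 'rV[R]_m;
  comp_rule : forall i j, dom i base -> dom j base ->
    comp i = comp j *m (transition_jacobian i j base)^T;
  comp_out : forall i, ~ dom i base -> comp i = 0 }.

(* Induced charts (q, p). *)
Definition cotangent_bundle : atlas R (m + m) :=
  @Atlas R (m + m) cotangent (idx X)
    (fun i => [set P | dom i (base P)])
    (fun i P => row_mx (chart i (base P)) (comp P i)).

Definition restrict_atlas (S : set (pt X)) : atlas R m :=
  @Atlas R m {x : pt X | S x} (idx X)
    (fun i => [set x | dom i (sval x)])
    (fun i x => chart i (sval x)).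

End Manifold.

Section CotangentTube.
Context {R : realType} {n : nat} (M : atlas R n).
Variables (g : field2 M) (c A : R).
Implicit Types (i : idx M) (y : 'rV[R]_(n + n)).

(* In the chart i, at the point y = (q, p). *)
Definition momentum y : 'rV[R]_n := rsubmx y.
Definition metric_at i y : 'M[R]_n := g i (lsubmx y).

(* (g^{0i})_i *)
Definition momentum_up i y : 'rV[R]_n := momentum y *m invmx (metric_at i y).

Definition norm_sq i y : R := bilin (invmx (metric_at i y)) (momentum y) (momentum y).
Definition energy i y : R := norm_sq i y / 2.

(* (Gamma^0_{ab})_{a,b} *)
Definition Gamma0 i y : 'M[R]_n :=
  \matrix_(a, b) \sum_(k < n) momentum y 0 k * christoffel (g i) k a b (lsubmx y).

Definition tube_set : set (pt (cotangent_bundle M)) :=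
  [set P | forall i : idx (cotangent_bundle M), dom i P ->
     0 < norm_sq i (chart i P) < 4 * c / A ^+ 2].

Definition tube : atlas R (n + n) := restrict_atlas tube_set.

(* (G_{ij}) *)
Definition G_low i y : 'M[R]_n :=
  let t := energy i y in
  (A * t) *: metric_at i y
  + ((c - A ^+ 2 * t) / (A * t)) *: ((momentum y)^T *m momentum y).

(* (H^{ij}) *)
Definition H_up i y : 'M[R]_n :=
  let t := energy i y in
  (A * t)^-1 *: invmx (metric_at i y)
  - ((c - A ^+ 2 * t) / (A * t ^+ 2 * (2 * c - A ^+ 2 * t)))
    *: ((momentum_up i y)^T *m momentum_up i y).

(* The rows are delta/delta q^1, .., delta/delta q^n, d/dp_1, .., d/dp_n,
   expressed in the frame d/dq^1, .., d/dq^n, d/dp_1, .., d/dp_n. *)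
Definition adapted_frame i y : 'M[R]_(n + n) :=
  block_mx 1%:M (Gamma0 i y) 0 1%:M.

(* With F the matrix above, a bilinear form with matrix B in the adapted frame
   has matrix F^-1 B F^-T in the coordinate frame, and an endomorphism with
   matrix E becomes F^-1 E F. *)
Definition tube_metric : field2 tube := fun i y =>
  let F := adapted_frame i y in
  invmx F *m block_mx (G_low i y) 0 0 (H_up i y) *m (invmx F)^T.

Definition tube_J : field2 tube := fun i y =>
  let F := adapted_frame i y in
  invmx F *m block_mx 0 (G_low i y) (- H_up i y) 0 *m F.

End CotangentTube.

Arguments tube {R n M} g c A.
Arguments tube_metric {R n M} g c A _ _.
Arguments tube_J {R n M} g c A _ _.

(* Main.v *)
(* In the bundle TM + R + R over the tube, the connection of the Gauss formula for
   the sphere of curvature c, completed by a line, is flat because g has constant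
   curvature c, and it preserves the metric diag(g, 1/c, psi) for a suitable
   function psi of t. The plane spanned by p^# and A t X + e, where X and e generate
   the trivial summands, thus maps the tube locally into a Grassmannian of planes
   in a flat space of dimension n + 2, and G is a multiple of the metric induced by
   the trace form on the reflection S in this plane, while J becomes the rotation of
   the plane by a right angle. For such a map, the Levi-Civita connection, the curvature
   K(X, Y)Z = [[X, Y], Z]/4 and J are all expressed by brackets, and are parallel. *)
Require Import Defs.
From HB Require Import structures.
From mathcomp Require Import all_boot all_order all_algebra.
From mathcomp Require Import all_classical all_reals all_analysis.
From mathcomp Require Import ring lra.

Set Implicit Arguments.
Unset Strict Implicit.
Unset Printing Implicit Defensive.

Import Order.TTheory GRing.Theory Num.Theory.
Import numFieldNormedType.Exports.

Local Open Scope classical_set_scope.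
Local Open Scope ring_scope.

(** * Partial derivatives and smooth functions *)

Section PartialCalculus.
Context {R : realType} {m : nat}.
Implicit Types (f g : 'rV[R]_m -> R) (U : set 'rV[R]_m) (x : 'rV[R]_m).

(** The local isometry with a Grassmannian is never constructed, since that would require
    integrating the flat connection. It is replaced by the reflection [S] and its flat covariant
    derivatives [theta a], so that statements about planes become matrix identities at one point.
    The Christoffel symbols of G are not computed either: the flat connection without its
    off-diagonal part is torsion free and preserves the trace form, and uniqueness of the
    Levi-Civita connection identifies it. The planes in dimension n + 2 form a space of dimension
    2n, that of the tube; accordingly the [theta a] span its whole tangent space, and the Ricci
    trace becomes a Casimir sum. The generator X stands for the position vector of the sphere, of
    square length 1/c. Its coefficient A t is dictated by J: for x orthogonal to p, the horizontal x
    moves the second frame vector by A t x, and J x moves p^# by the same vector. Equal length of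
    the two frame vectors then forces psi, and the upper bound defining the tube says that psi is
    positive. *)

Lemma near_eq_differentiable (V W : normedModType R) (f g : V -> W) (x : V) :
  (\near x, f x = g x) -> differentiable f x -> differentiable g x.
Proof.
move=> fg df.
have dfc : continuous ('d f x) by exact: diff_continuous.
have fgx : f x = g x by exact: nbhs_singleton fg.
have gE : g \o shift x = cst (g x) + 'd f x +o_ (0 : V) id.
  apply/eqaddoP => e e0.
  have /eqaddoP/(_ e e0) := diff_locally df.
  have : \forall y \near (0 : V), f (y + x) = g (y + x).
    by have := fg; rewrite (near_shift 0) /= subr0.
  move=> h1 h2; near=> y.
  have := near h2 y; rewrite /= -fgx.
  have -> : (g \o shift x - (cst (f x) + 'd f x)) y
     = (f \o shift x - (cst (f x) + 'd f x)) y.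
    by rewrite /= !fctE /= (near h1 y).
  by apply.
have dgE : 'd g x = 'd f x :> (V -> W) by exact: diff_unique.
by apply/diff_locallyP; rewrite dgE; split.
Unshelve. all: by end_near. Qed.

Lemma open_eq_near U f g x :
  open U -> U x -> {in U, f =1 g} -> \near x, f x = g x.
Proof.
move=> oU Ux fg; apply: filterS (open_nbhs_nbhs (conj oU Ux)) => y Uy.
by apply: fg; rewrite inE.
Qed.

Lemma eq_partial U f g k x :
  open U -> U x -> {in U, f =1 g} -> partial k f x = partial k g x.
Proof.
by move=> oU Ux fg; apply: near_eq_derive; exact: open_eq_near fg.
Qed.

Lemma eq_foldr_partial U f g s :
  open U -> {in U, f =1 g} -> {in U, foldr partial f s =1 foldr partial g s}.
Proof.
move=> oU fg; elim: s => //= k s IH x; rewrite inE => Ux.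
exact: eq_partial IH.
Qed.

Lemma eq_smooth_on U f g :
  open U -> {in U, f =1 g} -> smooth_on U f -> smooth_on U g.
Proof.
move=> oU fg sf s x Ux; apply: near_eq_differentiable (sf s x Ux).
by apply: open_eq_near Ux _ => //; exact: eq_foldr_partial.
Qed.

Lemma partial_cst k (a : R) x : partial k (fun=> a) x = 0.
Proof. exact: derive_cst. Qed.

Lemma partialD k f g x : differentiable f x -> differentiable g x ->
  partial k (fun y => f y + g y) x = partial k f x + partial k g x.
Proof. by move=> df dg; apply: deriveD; apply: diff_derivable. Qed.

Lemma partialB k f g x : differentiable f x -> differentiable g x ->
  partial k (fun y => f y - g y) x = partial k f x - partial k g x.
Proof. by move=> df dg; apply: deriveB; apply: diff_derivable. Qed.

Lemma partialM k f g x : differentiable f x -> differentiable g x ->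
  partial k (fun y => f y * g y) x = partial k f x * g x + f x * partial k g x.
Proof.
move=> df dg; rewrite addrC [partial k f x * _]mulrC.
by apply: deriveM; apply: diff_derivable.
Qed.

Lemma partialZ k (a : R) f x : differentiable f x ->
  partial k (fun y => a * f y) x = a * partial k f x.
Proof. by move=> df; apply: deriveZ; apply: diff_derivable. Qed.

Lemma partialV k f x : f x != 0 -> differentiable f x ->
  partial k (fun y => (f y)^-1) x = - (f x) ^- 2 * partial k f x.
Proof. by move=> f0 df; apply: deriveV => //; apply: diff_derivable. Qed.

Lemma differentiable_fsum (I : finType) (F : I -> 'rV[R]_m -> R) x :
  (forall i, differentiable (F i) x) ->
  differentiable (fun y => \sum_i F i y) x.
Proof.
move=> dF; rewrite -[fun y => _]/(fun y => \big[+%R/0]_(i <- index_enum I) F i y).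
elim: (index_enum I) => [|i r IH].
  by under eq_fun do rewrite big_nil; exact: differentiable_cst.
under eq_fun do rewrite big_cons.
exact: differentiableD.
Qed.

Lemma partial_sum (I : finType) k (F : I -> 'rV[R]_m -> R) x :
  (forall i, differentiable (F i) x) ->
  partial k (fun y => \sum_i F i y) x = \sum_i partial k (F i) x.
Proof.
move=> dF.
suff: forall r : seq I, differentiable (fun y => \sum_(i <- r) F i y) x /\
   partial k (fun y => \sum_(i <- r) F i y) x = \sum_(i <- r) partial k (F i) x.
  by move=> /(_ (index_enum I))[].
elim=> [|i r [IH1 IH2]].
  under eq_fun do rewrite big_nil; rewrite big_nil partial_cst.
  by split => //; exact: differentiable_cst.
under eq_fun do rewrite big_cons.
by rewrite big_cons partialD // IH2; split => //; exact: differentiableD.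
Qed.

Lemma partial_coord k l x : partial k (fun y => y 0 l) x = (k == l)%:R.
Proof.
rewrite /partial deriveE; last exact: differentiable_coord.
have @f : {linear 'rV[R]_m -> R}.
  by exists (fun N : 'rV[R]_m => N 0 l); do 2![eexists]; do ?[constructor];
     rewrite ?mxE// => ? *; rewrite ?mxE//; move=> ?; rewrite !mxE.
rewrite (_ : (fun y : 'rV[R]_m => y 0 l) = f) // diff_lin; last exact: coord_continuous.
by rewrite /f /= mxE eqxx eq_sym.
Qed.

End PartialCalculus.

Section ChainRule.
Context {R : realType} {m p : nat}.

Lemma differentiable_rV (phi : 'rV[R]_m -> 'rV[R]_p) x :
  (forall l, differentiable (fun y => phi y 0 l : R) x) -> differentiable phi x.
Proof.
move=> dphi.
rewrite (_ : phi = \sum_(l < p) fun y => phi y 0 l *: delta_mx 0 l); last first.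
  by apply/funext => y; rewrite fct_sumE -row_sum_delta.
by apply: differentiable_sum => l; exact: differentiableZl.
Qed.

Lemma derive_rV (phi : 'rV[R]_m -> 'rV[R]_p) x v l :
  differentiable phi x -> 'D_v phi x 0 l = 'D_v (fun y => phi y 0 l) x.
Proof.
by move=> dphi; rewrite derive_mx ?mxE //; exact: diff_derivable.
Qed.

Lemma diffE_partial (h : 'rV[R]_p -> R) y w : differentiable h y ->
  'd h y w = \sum_(l < p) w 0 l * partial l h y.
Proof.
move=> dh; rewrite [X in 'd _ _ X]row_sum_delta linear_sum /=; apply: eq_bigr => l _.
by rewrite linearZ /= /partial [in RHS](deriveE _ dh).
Qed.

Lemma partial_comp (phi : 'rV[R]_m -> 'rV[R]_p) (h : 'rV[R]_p -> R) k x :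
  (forall l, differentiable (fun y => phi y 0 l : R) x) ->
  differentiable h (phi x) ->
  partial k (fun y => h (phi y)) x
  = \sum_(l < p) partial k (fun y => phi y 0 l) x * partial l h (phi x).
Proof.
move=> dphi dh; have dphi' := differentiable_rV dphi.
rewrite {1}/partial deriveE; last exact: differentiable_comp.
rewrite diff_comp //= diffE_partial //; apply: eq_bigr => l _.
by rewrite -deriveE // derive_rV.
Qed.

Lemma jacobianE (phi : 'rV[R]_m -> 'rV[R]_p) x k l :
  differentiable phi x -> jacobian phi x k l = partial k (fun y => phi y 0 l) x.
Proof.
by move=> dphi; rewrite /partial -derive_rV // (deriveEjacobian _ dphi) -rowE [RHS]mxE.
Qed.

End ChainRule.

(** * Symmetry of second derivatives *)

Section Schwarz.
Context {R : realType} {m : nat}.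

Lemma is_derive_line (f : 'rV[R]_m -> R) (a u : 'rV[R]_m) (s : R) :
  differentiable f (a + s *: u) ->
  is_derive s 1 (fun t : R => f (a + t *: u)) ('D_u f (a + s *: u)).
Proof.
move=> df.
have dl : is_diff s (fun t : R => a + t *: u) (fun t => t *: u).
  by apply: is_diff_eq; rewrite add0r.
have dc : differentiable (f \o (fun t : R => a + t *: u)) s.
  by apply: differentiable_comp => //; exact: ex_diff.
apply: DeriveDef; first exact: diff_derivable.
rewrite (deriveE _ dc) diff_comp //.
by rewrite diff_val /= scale1r deriveE.
Qed.

(* The second difference of f over the square spanned by h u and h v is
   h^2 D_v D_u f + o(h^2): mean value theorem in the direction u, then
   differentiability of D_u f. *)
Lemma second_difference (U : set 'rV[R]_m) (f : 'rV[R]_m -> R) x (u v : 'rV[R]_m) (e : R) :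
  open U -> U x -> (forall y, U y -> differentiable f y) ->
  differentiable ('D_u f) x -> 0 < e ->
  \forall h \near (0 : R)^'+,
    `| f (x + h *: u + h *: v) - f (x + h *: u) - (f (x + h *: v) - f x)
       - h ^+ 2 * 'D_v ('D_u f) x | <= e * h ^+ 2.
Proof.
(* The two remainders at the mean value point add up to at most [e / C] times [h * C]; the summand 1
   keeps [C] positive when [u] and [v] vanish. *)
move=> oU Ux df du e0; set C := `|u| + `|u| + `|v| + 1.
have C0 : 0 < C by rewrite ltr_wpDl ?ltr01// ?addr_ge0.
set L := 'd ('D_u f) x.
have n1 : \forall w \near (0 : 'rV[R]_m), U (x + w).
  have := open_nbhs_nbhs (conj oU Ux); rewrite -[nbhs x _]/(\forall y \near x, U y).
  by rewrite (near_shift 0) subr0 /=; apply: filterS => w /=; rewrite addrC.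
have n2 : \forall w \near (0 : 'rV[R]_m),
    `|'D_u f (x + w) - 'D_u f x - L w| <= e / C * `|w|.
  have eC0 : 0 < e / C by rewrite divr_gt0.
  have /eqaddoP/(_ _ eC0) := diff_locally du.
  by apply: filterS => w /=; rewrite !fctE /= opprD addrA [w + x]addrC.
have : \forall w \near (0 : 'rV[R]_m), U (x + w) /\
    `|'D_u f (x + w) - 'D_u f x - L w| <= e / C * `|w|.
  by apply: filterS2 n1 n2 => w; split.
move=> /nbhs_normP[r /= r0 rP].
have {}rP w : `|w| < r -> U (x + w) /\
    `|'D_u f (x + w) - 'D_u f x - L w| <= e / C * `|w|.
  by move=> wr; apply: rP; rewrite /= sub0r normrN.
near=> h.
have h0 : 0 < h by near: h; exact: nbhs_right_gt.
have hr : h * C < r.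
  by rewrite -ltr_pdivlMr //; near: h; apply: nbhs_right_lt; rewrite divr_gt0.
have nu s : s \in `[0, h] -> `|s *: u| <= h * `|u|.
  move=> /itvP sh; rewrite normrZ ler_wpM2r // ger0_norm ?sh //.
have nuv s : s \in `[0, h] -> `|s *: u + h *: v| <= h * (`|u| + `|v|).
  move=> sh; rewrite (le_trans (ler_normD _ _)) // mulrDr lerD ?nu //.
  by rewrite normrZ gtr0_norm.
have hC : h * (`|u| + `|v|) <= h * C.
  rewrite ler_wpM2l ?(ltW h0) // /C; have := normr_ge0 u; lra.
have hC' : h * `|u| <= h * C.
  rewrite ler_wpM2l ?(ltW h0) // /C; have := normr_ge0 u; have := normr_ge0 v; lra.
have P1 s : s \in `[0, h] -> `|s *: u| < r.
  by move=> sh; rewrite (le_lt_trans (nu _ sh)) // (le_lt_trans hC').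
have P2 s : s \in `[0, h] -> `|s *: u + h *: v| < r.
  by move=> sh; rewrite (le_lt_trans (nuv _ sh)) // (le_lt_trans hC).
pose phi s := f (x + h *: v + s *: u) - f (x + s *: u).
have dphi s : s \in `[0, h] -> is_derive s 1 phi
    ('D_u f (x + h *: v + s *: u) - 'D_u f (x + s *: u)).
  move=> sh; apply: is_deriveB; apply: is_derive_line; apply: df.
    by rewrite -addrA [_ + s *: u]addrC; case: (rP _ (P2 _ sh)).
  by case: (rP _ (P1 _ sh)).
have dphi' s : s \in `]0, h[ -> is_derive s 1 phi
    ('D_u f (x + h *: v + s *: u) - 'D_u f (x + s *: u)).
  move=> sh; have sh' : s \in `[0, h].
    by move: sh; rewrite !in_itv /= => /andP[/ltW -> /ltW ->].
  exact: dphi sh'.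
have cphi : {within `[0, h], continuous phi}.
  apply: derivable_within_continuous => s sh.
  by have [] := dphi _ sh.
have [c ch] := MVT h0 dphi' cphi.
have {}ch : c \in `[0, h] by move: ch; rewrite !in_itv /= => /andP[/ltW -> /ltW ->].
rewrite subr0 /phi !scale0r !addr0.
rewrite [x + h *: v + h *: u]addrAC => ->.
rewrite [X in `|X|](_ : _ = h * (('D_u f (x + (c *: u + h *: v)) - 'D_u f x - L (c *: u + h *: v))
   - ('D_u f (x + c *: u) - 'D_u f x - L (c *: u)))); last first.
  have -> : L (c *: u + h *: v) = L (c *: u) + h * L v
    by rewrite linearD; congr (_ + _); exact: linearZ.
  have -> : x + (c *: u + h *: v) = x + h *: v + c *: u by rewrite addrA addrAC.
  by rewrite (deriveE _ du) -/L; ring.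
rewrite normrM (gtr0_norm h0) expr2 mulrA mulrC [e * h]mulrC -mulrA.
rewrite [X in _ <= X]mulrC.
rewrite ler_wpM2r ?(ltW h0) //.
rewrite (le_trans (ler_normB _ _)) //.
have [_ b1] := rP _ (P2 _ ch); have [_ b2] := rP _ (P1 _ ch).
apply: (le_trans (lerD b1 b2)).
rewrite -mulrDr -mulrA ler_wpM2l ?(ltW e0) // ler_pdivrMl // mulrC.
apply: (le_trans (lerD (nuv _ ch) (nu _ ch))).
rewrite -mulrDr ler_wpM2l ?(ltW h0) // /C; lra.
Unshelve. all: by end_near. Qed.

Lemma slope_gap (a b X Y s e : R) : a = b -> 0 < s ->
  `|a - s * X| <= e / 2 * s -> `|b - s * Y| <= e / 2 * s -> `|X - Y| <= e.
Proof.
move=> -> s0 A1 A2; rewrite -(ler_pM2r s0) -[X in _ * X <= _](gtr0_norm s0) -normrM.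
rewrite (_ : _ * s = (b - s * Y) - (b - s * X)); last by ring.
by rewrite (le_trans (ler_normB _ _)) // (le_trans (lerD A2 A1)) // -mulrDl -splitr.
Qed.

(** The second difference is unchanged when [u] and [v] are exchanged, so both mixed derivatives lie
    within [e / 2] of the same quotient, for every [e]. *)
Lemma derive_symmetric (U : set 'rV[R]_m) (f : 'rV[R]_m -> R) x (u v : 'rV[R]_m) :
  open U -> U x -> (forall y, U y -> differentiable f y) ->
  differentiable ('D_u f) x -> differentiable ('D_v f) x ->
  'D_v ('D_u f) x = 'D_u ('D_v f) x.
Proof.
move=> oU Ux df du dv; apply/eqP; rewrite -subr_eq0 -normr_le0.
apply/ler_addgt0Pr => e e0; rewrite add0r.
have e20 : 0 < e / 2 by rewrite divr_gt0.
have F1 := second_difference v oU Ux df du e20.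
have F2 := second_difference u oU Ux df dv e20.
have [h [h0]] := filter_ex (filterI (nbhs_right_gt (0 : R)) (filterI F1 F2)).
move=> [A1 A2]; apply: slope_gap A1 A2; last by rewrite exprn_gt0.
by rewrite [x + h *: v + h *: u]addrAC; ring.
Qed.
End Schwarz.

(** * Closure properties of smooth functions *)

Section Smoothness.
Context {R : realType} {m : nat}.
Implicit Types (U : set 'rV[R]_m) (f g : 'rV[R]_m -> R).

Lemma smooth_on_diff U f x : smooth_on U f -> U x -> differentiable f x.
Proof. by move=> sf; exact: (sf [::]). Qed.

Lemma smooth_on_partial U f k : smooth_on U f -> smooth_on U (partial k f).
Proof. by move=> sf s x Ux; rewrite -foldr_rcons; exact: sf. Qed.

Lemma smooth_on_subset (U V : set 'rV[R]_m) f : V `<=` U -> smooth_on U f -> smooth_on V f.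
Proof. by move=> VU sf s x /VU; exact: sf. Qed.

Lemma partialC U f i j x : open U -> smooth_on U f -> U x ->
  partial i (partial j f) x = partial j (partial i f) x.
Proof.
move=> oU sf Ux; apply: (derive_symmetric oU Ux).
- by move=> y; exact: smooth_on_diff.
- exact: smooth_on_diff (smooth_on_partial j sf) Ux.
- exact: smooth_on_diff (smooth_on_partial i sf) Ux.
Qed.

(** Smoothness as a greatest fixed point: a class of differentiable functions stable under partial
    derivatives, up to equality on [U], consists of smooth functions. The word of derivatives is
    peeled at its right end, where the derivative acts on [f] itself. *)
Lemma smooth_on_coind U (Q : ('rV[R]_m -> R) -> Prop) : open U ->
  (forall f x, Q f -> U x -> differentiable f x) ->
  (forall f k, Q f -> exists2 g, Q g & {in U, partial k f =1 g}) ->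
  forall f, Q f -> smooth_on U f.
Proof.
move=> oU Qd Qp f Qf s; elim/last_ind: s f Qf => [f Qf x|s k IH f Qf x Ux].
  exact: Qd.
have [g Qg fg] := Qp f k Qf; rewrite foldr_rcons.
apply: near_eq_differentiable (IH g Qg x Ux).
apply: open_eq_near Ux _ => // y Uy; apply/esym.
exact: (eq_foldr_partial s oU fg).
Qed.

(** A product or a composite is not stable under differentiation by itself, since its derivative is
    a sum of such terms. This closure is stable, and so serves as the class in [smooth_on_coind];
    composites stay inside because the outer function may be replaced by its partial derivatives. *)
Inductive smooth_expr U : ('rV[R]_m -> R) -> Prop :=
| SmoothBase f of smooth_on U f : smooth_expr U f
| SmoothCst a : smooth_expr U (fun=> a)
| SmoothCoord l : smooth_expr U (fun y => y 0 l)
| SmoothAdd f g of smooth_expr U f & smooth_expr U g :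
    smooth_expr U (fun y => f y + g y)
| SmoothMul f g of smooth_expr U f & smooth_expr U g :
    smooth_expr U (fun y => f y * g y)
| SmoothInv f of smooth_expr U f & (forall y, U y -> f y != 0) :
    smooth_expr U (fun y => (f y)^-1)
| SmoothComp p (V : set 'rV[R]_p) (h : 'rV[R]_p -> R) (phi : 'rV[R]_m -> 'rV[R]_p)
    of smooth_on V h & (forall y, U y -> V (phi y))
     & (forall l, smooth_on U (fun y => phi y 0 l)) :
    smooth_expr U (fun y => h (phi y)).

Lemma smooth_expr_diff U f x :
  smooth_expr U f -> U x -> differentiable f x.
Proof.
move=> sf Ux; elim: sf => {f}.
- by move=> f sf; exact: smooth_on_diff sf Ux.
- by move=> a; exact: differentiable_cst.
- by move=> l; exact: differentiable_coord.
- by move=> f g _ df _ dg; exact: differentiableD.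
- by move=> f g _ df _ dg; exact: differentiableM.
- by move=> f _ df f0; apply: differentiableV => //; exact: f0.
- move=> p V h phi sh UV sphi; apply: (@differentiable_comp _ _ _ _ phi h).
    by apply: differentiable_rV => l; exact: smooth_on_diff (sphi l) Ux.
  exact: (sh [::] _ (UV _ Ux)).
Qed.

Lemma smooth_expr_sum U (I : finType) (F : I -> 'rV[R]_m -> R) :
  (forall i, smooth_expr U (F i)) -> smooth_expr U (fun y => \sum_i F i y).
Proof.
move=> sF; elim: (index_enum I) => [|i r IH].
  by under eq_fun do rewrite big_nil; exact: SmoothCst.
by under eq_fun do rewrite big_cons; exact: SmoothAdd.
Qed.

Lemma smooth_expr_partial U f k : smooth_expr U f ->
  exists2 g, smooth_expr U g & {in U, partial k f =1 g}.
Proof.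
move=> sf; elim: sf => {f}.
- by move=> f sf; exists (partial k f) => //; apply: SmoothBase; exact: smooth_on_partial.
- move=> a; exists (fun=> 0); first exact: SmoothCst.
  by move=> x _; rewrite partial_cst.
- move=> l; exists (fun=> (k == l)%:R); first exact: SmoothCst.
  by move=> x _; rewrite partial_coord.
- move=> f g sf [f' sf' ff'] sg [g' sg' gg'].
  exists (fun y => f' y + g' y); first exact: SmoothAdd.
  move=> x /[dup] Ux; rewrite inE => Ux'.
  rewrite partialD; first by rewrite ff' ?gg'.
    exact: smooth_expr_diff Ux'.
  exact: smooth_expr_diff Ux'.
- move=> f g sf [f' sf' ff'] sg [g' sg' gg'].
  exists (fun y => f' y * g y + f y * g' y).
    by apply: SmoothAdd; apply: SmoothMul.
  move=> x /[dup] Ux; rewrite inE => Ux'.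
  rewrite partialM; first by rewrite ff' ?gg'.
    exact: smooth_expr_diff Ux'.
  exact: smooth_expr_diff Ux'.
- move=> f sf [f' sf' ff'] f0.
  exists (fun y => (-1) * ((f y)^-1 * (f y)^-1) * f' y).
    do !apply: SmoothMul => //; first exact: SmoothCst; exact: SmoothInv.
  move=> x /[dup] Ux; rewrite inE => Ux'.
  rewrite partialV ?ff' ?f0 //; last exact: smooth_expr_diff Ux'.
  by rewrite mulN1r -expr2 exprVn.
- move=> p V h phi sh UV sphi.
  exists (fun y => \sum_(l < p) partial k (fun y => phi y 0 l) y * partial l h (phi y)).
    apply: smooth_expr_sum => l; apply: SmoothMul.
      exact/SmoothBase/smooth_on_partial.
    by apply: (@SmoothComp _ _ V) => // s y Vy; rewrite -foldr_rcons; exact: sh.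
  move=> x; rewrite inE => Ux; rewrite partial_comp //.
    by move=> l; exact: smooth_on_diff (sphi l) Ux.
  exact: (sh [::] _ (UV _ Ux)).
Qed.

Lemma smooth_exprP U f : open U -> smooth_expr U f -> smooth_on U f.
Proof.
move=> oU; apply: smooth_on_coind => //.
- by move=> g x; exact: smooth_expr_diff.
- by move=> g k; exact: smooth_expr_partial.
Qed.

Section Closure.
Variable U : set 'rV[R]_m.
Hypothesis oU : open U.

Lemma smooth_on_cst a : smooth_on U (fun=> a).
Proof. exact/smooth_exprP/SmoothCst. Qed.

Lemma smooth_on_coord l : smooth_on U (fun y => y 0 l).
Proof. exact/smooth_exprP/SmoothCoord. Qed.

Lemma smooth_onD f g : smooth_on U f -> smooth_on U g ->
  smooth_on U (fun y => f y + g y).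
Proof. by move=> sf sg; apply: smooth_exprP => //; apply: SmoothAdd; exact: SmoothBase. Qed.

Lemma smooth_onM f g : smooth_on U f -> smooth_on U g ->
  smooth_on U (fun y => f y * g y).
Proof. by move=> sf sg; apply: smooth_exprP => //; apply: SmoothMul; exact: SmoothBase. Qed.

Lemma smooth_onN f : smooth_on U f -> smooth_on U (fun y => - f y).
Proof.
move=> sf; under eq_fun do rewrite -mulN1r.
by apply: smooth_onM => //; exact: smooth_on_cst.
Qed.

Lemma smooth_onB f g : smooth_on U f -> smooth_on U g ->
  smooth_on U (fun y => f y - g y).
Proof. by move=> sf sg; apply: smooth_onD => //; exact: smooth_onN. Qed.

Lemma smooth_onV f : smooth_on U f -> (forall y, U y -> f y != 0) ->
  smooth_on U (fun y => (f y)^-1).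
Proof. by move=> sf f0; apply: smooth_exprP => //; apply: SmoothInv => //; exact: SmoothBase. Qed.

Lemma smooth_on_sum (I : finType) (F : I -> 'rV[R]_m -> R) :
  (forall i, smooth_on U (F i)) -> smooth_on U (fun y => \sum_i F i y).
Proof. by move=> sF; apply: smooth_exprP => //; apply: smooth_expr_sum => i; exact: SmoothBase. Qed.

Lemma smooth_on_prod (I : finType) (F : I -> 'rV[R]_m -> R) :
  (forall i, smooth_on U (F i)) -> smooth_on U (fun y => \prod_i F i y).
Proof.
move=> sF; elim: (index_enum I) => [|i r IH].
  by under eq_fun do rewrite big_nil; exact: smooth_on_cst.
by under eq_fun do rewrite big_cons; exact: smooth_onM.
Qed.

Lemma smooth_on_comp p (V : set 'rV[R]_p) (h : 'rV[R]_p -> R)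
    (phi : 'rV[R]_m -> 'rV[R]_p) :
  smooth_on V h -> (forall y, U y -> V (phi y)) ->
  (forall l, smooth_on U (fun y => phi y 0 l)) ->
  smooth_on U (fun y => h (phi y)).
Proof. by move=> sh UV sphi; apply: smooth_exprP => //; exact: SmoothComp sh UV sphi. Qed.

End Closure.

End Smoothness.

(** * Calculus of matrix-valued functions *)

Section MatrixCalculus.
Context {R : realType} {m : nat}.
Implicit Types (U : set 'rV[R]_m) (x : 'rV[R]_m) (k : 'I_m).

Definition differentiable_mx p q (M : 'rV[R]_m -> 'M[R]_(p, q)) x :=
  forall i j, differentiable (fun y => M y i j : R) x.

Definition smooth_mx U p q (M : 'rV[R]_m -> 'M[R]_(p, q)) :=
  forall i j, smooth_on U (fun y => M y i j).

Definition dmx k p q (M : 'rV[R]_m -> 'M[R]_(p, q)) x : 'M[R]_(p, q) :=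
  \matrix_(i, j) partial k (fun y => M y i j) x.

Lemma dmxE k p q (M : 'rV[R]_m -> 'M[R]_(p, q)) x i j :
  dmx k M x i j = partial k (fun y => M y i j) x.
Proof. by rewrite mxE. Qed.

Lemma smooth_mx_diff U p q (M : 'rV[R]_m -> 'M[R]_(p, q)) x :
  smooth_mx U M -> U x -> differentiable_mx M x.
Proof. by move=> sM Ux i j; exact: smooth_on_diff (sM i j) Ux. Qed.

Lemma smooth_dmx U k p q (M : 'rV[R]_m -> 'M[R]_(p, q)) :
  smooth_mx U M -> smooth_mx U (dmx k M).
Proof.
move=> sM i j; under eq_fun do rewrite dmxE.
exact: smooth_on_partial.
Qed.

Lemma eq_dmx U k p q (M N : 'rV[R]_m -> 'M[R]_(p, q)) x :
  open U -> U x -> {in U, M =1 N} -> dmx k M x = dmx k N x.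
Proof.
move=> oU Ux MN; apply/matrixP => i j; rewrite !mxE.
by apply: (eq_partial _ oU Ux) => y /MN ->.
Qed.

Lemma eq_smooth_mx U p q (M N : 'rV[R]_m -> 'M[R]_(p, q)) :
  open U -> {in U, M =1 N} -> smooth_mx U M -> smooth_mx U N.
Proof. by move=> oU MN sM i j; apply: eq_smooth_on (sM i j) => // y /MN ->. Qed.

Lemma dmxC U i j p q (M : 'rV[R]_m -> 'M[R]_(p, q)) x :
  open U -> smooth_mx U M -> U x -> dmx i (dmx j M) x = dmx j (dmx i M) x.
Proof.
move=> oU sM Ux; apply/matrixP => a b; rewrite [LHS]dmxE [RHS]dmxE.
have E l : (fun y => dmx l M y a b) = partial l (fun y => M y a b).
  by apply/funext => y; rewrite dmxE.
by rewrite (E j) (E i); exact: (partialC i j oU (sM a b) Ux).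
Qed.

Lemma dmx_cst k p q (M : 'M[R]_(p, q)) x : dmx k (fun=> M) x = 0.
Proof. by apply/matrixP => i j; rewrite !mxE partial_cst. Qed.

Section Pointwise.
Variable x : 'rV[R]_m.

Lemma dmxD k p q (M N : 'rV[R]_m -> 'M[R]_(p, q)) :
  differentiable_mx M x -> differentiable_mx N x ->
  dmx k (fun y => M y + N y) x = dmx k M x + dmx k N x.
Proof.
move=> dM dN; apply/matrixP => i j; rewrite !mxE -partialD //.
by congr (partial k _ x); apply/funext => y; rewrite mxE.
Qed.

Lemma dmxB k p q (M N : 'rV[R]_m -> 'M[R]_(p, q)) :
  differentiable_mx M x -> differentiable_mx N x ->
  dmx k (fun y => M y - N y) x = dmx k M x - dmx k N x.
Proof.
move=> dM dN; apply/matrixP => i j; rewrite !mxE -partialB //.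
by congr (partial k _ x); apply/funext => y; rewrite !mxE.
Qed.

Lemma dmxZ k p q (f : 'rV[R]_m -> R) (M : 'rV[R]_m -> 'M[R]_(p, q)) :
  differentiable f x -> differentiable_mx M x ->
  dmx k (fun y => f y *: M y) x = partial k f x *: M x + f x *: dmx k M x.
Proof.
move=> df dM; apply/matrixP => i j; rewrite !mxE -partialM //.
by congr (partial k _ x); apply/funext => y; rewrite mxE.
Qed.

Lemma differentiable_mxM p q r (M : 'rV[R]_m -> 'M[R]_(p, q)) (N : 'rV[R]_m -> 'M[R]_(q, r)) :
  differentiable_mx M x -> differentiable_mx N x ->
  differentiable_mx (fun y => M y *m N y) x.
Proof.
move=> dM dN i j; under eq_fun do rewrite mxE.
by apply: differentiable_fsum => k; exact: differentiableM.
Qed.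

Lemma dmxM k p q r (M : 'rV[R]_m -> 'M[R]_(p, q)) (N : 'rV[R]_m -> 'M[R]_(q, r)) :
  differentiable_mx M x -> differentiable_mx N x ->
  dmx k (fun y => M y *m N y) x = dmx k M x *m N x + M x *m dmx k N x.
Proof.
move=> dM dN; apply/matrixP => i j; rewrite !mxE.
under eq_fun do rewrite mxE.
rewrite partial_sum; last by move=> l; exact: differentiableM.
by rewrite -big_split; apply: eq_bigr => l _; rewrite partialM // !mxE.
Qed.

Lemma dmx_tr k p q (M : 'rV[R]_m -> 'M[R]_(p, q)) :
  dmx k (fun y => (M y)^T) x = (dmx k M x)^T.
Proof.
apply/matrixP => i j; rewrite !mxE.
by congr (partial k _ x); apply/funext => y; rewrite mxE.
Qed.

Lemma partial_mxtrace k p (M : 'rV[R]_m -> 'M[R]_p) :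
  differentiable_mx M x -> partial k (fun y => \tr (M y)) x = \tr (dmx k M x).
Proof.
move=> dM; rewrite partial_sum; last by move=> i; exact: dM.
by apply: eq_bigr => i _; rewrite mxE.
Qed.

Lemma dmx_row k p q r (M : 'rV[R]_m -> 'M[R]_(p, q)) (N : 'rV[R]_m -> 'M[R]_(p, r)) :
  dmx k (fun y => row_mx (M y) (N y)) x = row_mx (dmx k M x) (dmx k N x).
Proof.
apply/matrixP => i j; rewrite !mxE; case: splitP => l jl; rewrite mxE;
  congr (partial k _ x); apply/funext => y.
  by rewrite (_ : j = lshift _ l) ?row_mxEl //; exact: val_inj.
by rewrite (_ : j = rshift _ l) ?row_mxEr //; exact: val_inj.
Qed.

Lemma dmx_col k p q r (M : 'rV[R]_m -> 'M[R]_(p, q)) (N : 'rV[R]_m -> 'M[R]_(r, q)) :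
  dmx k (fun y => col_mx (M y) (N y)) x = col_mx (dmx k M x) (dmx k N x).
Proof.
apply: trmx_inj; rewrite tr_col_mx -!dmx_tr -dmx_row.
by apply/matrixP => i j; rewrite !mxE; congr (partial k _ x); apply/funext => y;
  rewrite -tr_col_mx mxE.
Qed.

Lemma dmx_block k p q r s (M : 'rV[R]_m -> 'M[R]_(p, q)) (N : 'rV[R]_m -> 'M[R]_(p, r))
    (P : 'rV[R]_m -> 'M[R]_(s, q)) (Q : 'rV[R]_m -> 'M[R]_(s, r)) :
  dmx k (fun y => block_mx (M y) (N y) (P y) (Q y)) x
  = block_mx (dmx k M x) (dmx k N x) (dmx k P x) (dmx k Q x).
Proof. by rewrite dmx_col !dmx_row. Qed.

End Pointwise.

Section Closure.
Variable U : set 'rV[R]_m.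
Hypothesis oU : open U.

Lemma smooth_mx_cst p q (M : 'M[R]_(p, q)) : smooth_mx U (fun=> M).
Proof. by move=> i j; exact: smooth_on_cst. Qed.

Lemma smooth_mxD p q (M N : 'rV[R]_m -> 'M[R]_(p, q)) :
  smooth_mx U M -> smooth_mx U N -> smooth_mx U (fun y => M y + N y).
Proof. by move=> sM sN i j; under eq_fun do rewrite mxE; exact: smooth_onD. Qed.

Lemma smooth_mxN p q (M : 'rV[R]_m -> 'M[R]_(p, q)) :
  smooth_mx U M -> smooth_mx U (fun y => - M y).
Proof. by move=> sM i j; under eq_fun do rewrite mxE; exact: smooth_onN. Qed.

Lemma smooth_mxB p q (M N : 'rV[R]_m -> 'M[R]_(p, q)) :
  smooth_mx U M -> smooth_mx U N -> smooth_mx U (fun y => M y - N y).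
Proof. by move=> sM sN; apply: smooth_mxD => //; exact: smooth_mxN. Qed.

Lemma smooth_mxZ p q f (M : 'rV[R]_m -> 'M[R]_(p, q)) :
  smooth_on U f -> smooth_mx U M -> smooth_mx U (fun y => f y *: M y).
Proof. by move=> sf sM i j; under eq_fun do rewrite mxE; exact: smooth_onM. Qed.

Lemma smooth_mxM p q r (M : 'rV[R]_m -> 'M[R]_(p, q)) (N : 'rV[R]_m -> 'M[R]_(q, r)) :
  smooth_mx U M -> smooth_mx U N -> smooth_mx U (fun y => M y *m N y).
Proof.
move=> sM sN i j; under eq_fun do rewrite mxE.
by apply: smooth_on_sum => // k; exact: smooth_onM.
Qed.

Lemma smooth_mx_tr p q (M : 'rV[R]_m -> 'M[R]_(p, q)) :
  smooth_mx U M -> smooth_mx U (fun y => (M y)^T).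
Proof. by move=> sM i j; under eq_fun do rewrite mxE; exact: sM. Qed.

Lemma smooth_mx_row p q r (M : 'rV[R]_m -> 'M[R]_(p, q)) (N : 'rV[R]_m -> 'M[R]_(p, r)) :
  smooth_mx U M -> smooth_mx U N -> smooth_mx U (fun y => row_mx (M y) (N y)).
Proof.
move=> sM sN i j; rewrite -(splitK j); case: (fintype.split j) => l /=.
  by under eq_fun do rewrite row_mxEl; exact: sM.
by under eq_fun do rewrite row_mxEr; exact: sN.
Qed.

Lemma smooth_mx_col p q r (M : 'rV[R]_m -> 'M[R]_(p, q)) (N : 'rV[R]_m -> 'M[R]_(r, q)) :
  smooth_mx U M -> smooth_mx U N -> smooth_mx U (fun y => col_mx (M y) (N y)).
Proof.
move=> sM sN i j; rewrite -(splitK i); case: (fintype.split i) => l /=.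
  by under eq_fun do rewrite col_mxEu; exact: sM.
by under eq_fun do rewrite col_mxEd; exact: sN.
Qed.

Lemma smooth_mx_block p q r s (M : 'rV[R]_m -> 'M[R]_(p, q))
    (N : 'rV[R]_m -> 'M[R]_(p, r)) (P : 'rV[R]_m -> 'M[R]_(s, q))
    (Q : 'rV[R]_m -> 'M[R]_(s, r)) :
  smooth_mx U M -> smooth_mx U N -> smooth_mx U P -> smooth_mx U Q ->
  smooth_mx U (fun y => block_mx (M y) (N y) (P y) (Q y)).
Proof. by move=> sM sN sP sQ; apply: smooth_mx_col; exact: smooth_mx_row. Qed.

Lemma smooth_on_det p (M : 'rV[R]_m -> 'M[R]_p) :
  smooth_mx U M -> smooth_on U (fun y => \det (M y)).
Proof.
move=> sM; rewrite /determinant; apply: smooth_on_sum => // s.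
apply: smooth_onM => //; first exact: smooth_on_cst.
by apply: smooth_on_prod => // i; exact: sM.
Qed.

Lemma smooth_mx_inv p (M : 'rV[R]_m -> 'M[R]_p) :
  smooth_mx U M -> (forall y, U y -> M y \in unitmx) ->
  smooth_mx U (fun y => invmx (M y)).
Proof.
move=> sM uM.
have s1 : smooth_mx U (fun y => (\det (M y))^-1 *: \adj (M y)).
  apply: smooth_mxZ.
    apply: smooth_onV => //; first exact: smooth_on_det.
    by move=> y /uM; rewrite unitmxE unitfE.
  move=> i j; under eq_fun do rewrite mxE /cofactor.
  apply: smooth_onM => //; first exact: smooth_on_cst.
  by apply: smooth_on_det => a b; under eq_fun do rewrite !mxE; exact: sM.
apply: eq_smooth_mx s1 => // y; rewrite inE => Uy.
by rewrite /invmx uM.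
Qed.

End Closure.

Lemma dmx_inv U k p (M : 'rV[R]_m -> 'M[R]_p) x : open U -> U x ->
  smooth_mx U M -> (forall y, U y -> M y \in unitmx) ->
  dmx k (fun y => invmx (M y)) x = - (invmx (M x) *m dmx k M x *m invmx (M x)).
Proof.
move=> oU Ux sM uM.
have sI := smooth_mx_inv oU sM uM.
have dM := smooth_mx_diff sM Ux.
have dI := smooth_mx_diff sI Ux.
have E : dmx k M x *m invmx (M x) + M x *m dmx k (fun y => invmx (M y)) x = 0.
  rewrite -dmxM // -(dmx_cst k 1%:M x); apply: (eq_dmx _ oU Ux) => y.
  by rewrite inE => Uy; rewrite mulmxV ?uM.
apply/eqP; rewrite -addr_eq0 -mulmxA; apply/eqP.
by have := congr1 (mulmx (invmx (M x))) E;
  rewrite mulmxDr mulmx0 mulKmx ?uM // addrC => ->.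
Qed.

End MatrixCalculus.

Opaque dmx partial.

(** * The Levi-Civita connection *)

Lemma trmxD (R : nmodType) p q (A B : 'M[R]_(p, q)) : (A + B)^T = A^T + B^T.
Proof. by apply/matrixP => i j; rewrite !mxE. Qed.

Lemma trmxN (R : zmodType) p q (A : 'M[R]_(p, q)) : (- A)^T = - A^T.
Proof. by apply/matrixP => i j; rewrite !mxE. Qed.

Lemma trmxZ (R : pzSemiRingType) p q (a : R) (A : 'M[R]_(p, q)) : (a *: A)^T = a *: A^T.
Proof. by apply/matrixP => i j; rewrite !mxE. Qed.

Section MetricConnection.
Context {R : realType} {m N : nat}.
Variables (W : set 'rV[R]_m) (omega : 'I_m -> 'rV[R]_m -> 'M[R]_N).
Hypotheses (oW : open W) (smooth_omega : forall a, smooth_mx W (omega a)).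

(** Connections act on row vectors by s |-> d_a s + s omega_a, whence the reversed order of the two
    products. *)
Definition connection_curvature (i j : 'I_m) x : 'M[R]_N :=
  dmx i (omega j) x - dmx j (omega i) x
  + omega j x *m omega i x - omega i x *m omega j x.

(** The second derivatives of a parallel form commute; expanding both orders with the first-order
    equation leaves exactly the curvature terms. *)
Lemma connection_curvature_skew (B : 'rV[R]_m -> 'M[R]_N) x i j :
  smooth_mx W B ->
  (forall a y, W y -> dmx a B y = omega a y *m B y + B y *m (omega a y)^T) ->
  W x ->
  connection_curvature i j x *m B x + B x *m (connection_curvature i j x)^T = 0.
Proof.
move=> sB dB Wx.
have dd a b : dmx a (dmx b B) x =
    dmx a (omega b) x *m B x
    + omega b x *m (omega a x *m B x + B x *m (omega a x)^T)
    + ((omega a x *m B x + B x *m (omega a x)^T) *m (omega b x)^T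
       + B x *m (dmx a (omega b) x)^T).
  rewrite (eq_dmx a oW Wx (N := fun y => omega b y *m B y + B y *m (omega b y)^T));
    last by move=> y; rewrite inE; exact: dB.
  have dom c := smooth_mx_diff (smooth_omega c) Wx.
  have dBx := smooth_mx_diff sB Wx.
  have domT c : differentiable_mx (fun y => (omega c y)^T) x.
    exact: smooth_mx_diff (smooth_mx_tr (smooth_omega c)) Wx.
  rewrite dmxD ?dmxM ?dmx_tr ?dB //; exact: differentiable_mxM.
have := dmxC i j oW sB Wx; rewrite !dd => /eqP; rewrite -subr_eq0 => /eqP <-.
rewrite /connection_curvature !(trmxD, trmxN, trmx_mul).
rewrite !(mulmxDl, mulmxDr, mulNmx, mulmxN) !mulmxA.
do ![match goal with |- context [?A *m ?B] => move: (A *m B) => ? end].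
by apply/matrixP => a b; rewrite !mxE; ring.
Qed.

End MetricConnection.

Section LeviCivitaTheory.
Context {R : realType} {m : nat}.
Variables (W : set 'rV[R]_m) (h : 'rV[R]_m -> 'M[R]_m).
Hypotheses (oW : open W) (smooth_h : smooth_mx W h).
Hypothesis sym_h : forall y, W y -> (h y)^T = h y.
Hypothesis unit_h : forall y, W y -> h y \in unitmx.

(** Row [k] holds the components of nabla_{d_i} d_k, so this is the connection matrix for row
    vectors. *)
Definition christoffel_mx (i : 'I_m) x : 'M[R]_m :=
  \matrix_(k, l) christoffel h l i k x.

Definition curvature_mx (i j : 'I_m) x : 'M[R]_m :=
  \matrix_(k, l) curvature h l k i j x.

Lemma partial_metricC i j k x : W x ->
  partial k (fun y => h y i j) x = partial k (fun y => h y j i) x.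
Proof.
move=> Wx; apply: (eq_partial k oW Wx) => y; rewrite inE => Wy.
by rewrite -{1}(sym_h Wy) mxE.
Qed.

Lemma christoffelC k i j x : W x -> christoffel h k i j x = christoffel h k j i x.
Proof.
move=> Wx; congr (_ * _); apply: eq_bigr => l _; congr (_ * _).
by rewrite (partial_metricC i j) // [partial i _ x + _]addrC.
Qed.

(** Uniqueness of the Levi-Civita connection. The lowered coefficients [T] are symmetric in their
    first two indices and add up in pairs to the derivatives of [h]; the Koszul combination of three
    such derivatives isolates twice one of them. This identifies a connection without computing any
    Christoffel symbol. *)
Lemma christoffel_koszul (C : 'I_m -> 'M[R]_m) x : W x ->
  (forall i k l, C i k l = C k i l) ->
  (forall i, dmx i h x = C i *m h x + h x *m (C i)^T) ->
  forall i k l, C i k l = christoffel h l i k x.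
Proof.
move=> Wx symC dh i k l; set T := fun i => C i *m h x.
have TC a b c : T a b c = T b a c.
  by rewrite !mxE; apply: eq_bigr => d _; rewrite symC.
have dhE a b c : partial a (fun y => h y b c) x = T a b c + T a c b.
  rewrite -dmxE dh mxE; congr (_ + _).
  by rewrite -[X in X *m _](sym_h Wx) -trmx_mul mxE.
have -> : C i = T i *m invmx (h x) by rewrite mulmxK ?unit_h.
rewrite /christoffel mulr_sumr mxE; apply: eq_bigr => b _.
have -> : invmx (h x) b l = invmx (h x) l b.
  by rewrite -{1}(sym_h Wx) -trmx_inv mxE.
rewrite !dhE (TC k b i) (TC k i b) (TC b i k) (TC b k i) (TC i b k) (TC k b i).
by field.
Qed.

Lemma christoffel_metric i x : W x ->
  dmx i h x = christoffel_mx i x *m h x + h x *m (christoffel_mx i x)^T.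
Proof.
move=> Wx; pose c i k b := 2^-1 * (partial i (fun y => h y b k) x
   + partial k (fun y => h y b i) x - partial b (fun y => h y i k) x).
have TE a k j : (christoffel_mx a x *m h x) k j = c a k j.
  have -> : christoffel_mx a x = (\matrix_(k, b) c a k b) *m (invmx (h x))^T.
    apply/matrixP => k' l; rewrite !mxE /christoffel mulr_sumr.
    by apply: eq_bigr => b _; rewrite !mxE mulrCA mulrC.
  by rewrite trmx_inv (sym_h Wx) mulmxKV ?unit_h // mxE.
apply/matrixP => k j; rewrite dmxE [RHS]mxE TE.
have -> : (h x *m (christoffel_mx i x)^T) k j = (christoffel_mx i x *m h x) j k.
  by rewrite -[X in X *m _](sym_h Wx) -trmx_mul mxE.
rewrite TE /c (partial_metricC k j) // (partial_metricC k i) // (partial_metricC j i) //.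
by field.
Qed.

Lemma smooth_christoffel k i j : smooth_on W (christoffel h k i j).
Proof.
apply: smooth_onM => //; first exact: smooth_on_cst.
apply: smooth_on_sum => // l; apply: smooth_onM => //.
  exact: (smooth_mx_inv oW smooth_h unit_h).
by apply: smooth_onB => //; [apply: smooth_onD => //|]; apply: smooth_on_partial.
Qed.

Lemma smooth_christoffel_mx i : smooth_mx W (christoffel_mx i).
Proof. by move=> k l; under eq_fun do rewrite mxE; exact: smooth_christoffel. Qed.

Lemma smooth_curvature l k i j : smooth_on W (curvature h l k i j).
Proof.
apply: smooth_onD => //.
  by apply: smooth_onB => //; apply: smooth_on_partial; exact: smooth_christoffel.
by apply: smooth_on_sum => // a; apply: smooth_onB => //; apply: smooth_onM => //;
  exact: smooth_christoffel.
Qed.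

Lemma curvature_mxE i j x :
  curvature_mx i j x = connection_curvature christoffel_mx i j x.
Proof.
have dE a b k l : dmx a (christoffel_mx b) x k l = partial a (christoffel h l b k) x.
  by rewrite dmxE; congr (partial a _ x); apply/funext => y; rewrite mxE.
have mE a b k l : (christoffel_mx a x *m christoffel_mx b x) k l
    = \sum_(d < m) christoffel h l b d x * christoffel h d a k x.
  by rewrite mxE; apply: eq_bigr => d _; rewrite !mxE mulrC.
have entry (M1 M2 M3 M4 : 'M[R]_m) k l :
    (M1 - M2 + M3 - M4) k l = M1 k l - M2 k l + M3 k l - M4 k l.
  by rewrite !mxE.
apply/matrixP => k l.
rewrite [LHS]mxE.
rewrite /curvature sumrB addrA.
rewrite -(dE i j k l) -(dE j i k l) -(mE j i k l) -(mE i j k l).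
exact/esym/entry.
Qed.

Lemma curvature_skew i j x : W x ->
  curvature_mx i j x *m h x + h x *m (curvature_mx i j x)^T = 0.
Proof.
move=> Wx; rewrite curvature_mxE.
apply: (connection_curvature_skew oW smooth_christoffel_mx i j smooth_h) => //.
by move=> a y; exact: christoffel_metric.
Qed.

(** Both the derivative terms and the quadratic terms inherit the symmetry of the Christoffel
    symbols in the last two indices, and cancel in pairs in the cyclic sum. *)
Lemma curvature_bianchi l i j k x : W x ->
  curvature h l k i j x + curvature h l i j k x + curvature h l j k i x = 0.
Proof.
move=> Wx.
pose P a b c := partial a (christoffel h l b c) x.
pose Q a b c := \sum_(d < m) christoffel h l a d x * christoffel h d b c x.
have PC a b c : P a b c = P a c b.
  by apply: (eq_partial a oW Wx) => y; rewrite inE => Wy; exact: christoffelC.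
have QC a b c : Q a b c = Q a c b.
  by apply: eq_bigr => d _; rewrite (christoffelC d b c Wx).
have E a b c : curvature h l c a b x = P a b c - P b a c + (Q a b c - Q b a c).
  by rewrite /curvature sumrB.
rewrite !E; move: P Q PC QC {E} => P Q PC QC.
rewrite (PC i k j) (PC j i k) (PC k j i) (QC i k j) (QC j k i) (QC k j i); ring.
Qed.

Lemma curvature_antisym l k i j x : curvature h l k i j x = - curvature h l k j i x.
Proof.
rewrite /curvature opprD opprB; congr (_ + _).
by rewrite -sumrN; apply: eq_bigr => a _; rewrite opprB.
Qed.

End LeviCivitaTheory.

(** * Curvature-like tensors with vanishing sectional curvature *)

Section AlgebraicCurvature.
Context {R : realFieldType} {V : zmodType}.
Variable T : V -> V -> V -> V -> R.
Hypothesis T1 : forall u u' v w z, T (u + u') v w z = T u v w z + T u' v w z.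
Hypothesis T2 : forall u v v' w z, T u (v + v') w z = T u v w z + T u v' w z.
Hypothesis T3 : forall u v w w' z, T u v (w + w') z = T u v w z + T u v w' z.
Hypothesis T4 : forall u v w z z', T u v w (z + z') = T u v w z + T u v w z'.
Hypothesis T12 : forall u v w z, T u v w z = - T v u w z.
Hypothesis T34 : forall u v w z, T u v w z = - T u v z w.
Hypothesis bianchi : forall u v w z, T u v w z + T v w u z + T w u v z = 0.
Hypothesis T0 : forall u v, T u v v u = 0.

(** The octahedron argument: four cyclic instances of the Bianchi identity, in which all terms but
    the two desired ones cancel by skew symmetry. *)
Lemma algebraic_curvature_pair u v w z : T u v w z = T w z u v.
Proof.
have e1 := bianchi u v w z; have e2 := bianchi v w z u.
have e3 := bianchi w z u v; have e4 := bianchi z u v w.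
move: e2 e3 e4; rewrite (T34 v w z) (T34 w z v) (T12 z v) (T12 z u w) (T34 u z w).
rewrite (T12 u w z) (T34 w u z) (T12 z u v) (T34 u v z) (T34 v z u) => *; lra.
Qed.

(* Polarising T(u, v, v, u) = 0 makes T invariant under cyclic permutation of
   its first three arguments, so that the Bianchi identity reads 3 T = 0. *)
Lemma algebraic_curvature_eq0 u v w z : T u v w z = 0.
Proof.
have P1 a b d : T a b d a = 0.
  have := T0 a (b + d); rewrite !T2 !T3 !T0 add0r addr0.
  have := algebraic_curvature_pair a d b a; rewrite (T12 b a) (T34 a b a d) opprK => E1.
  by rewrite E1; move=> H; lra.
have P2 a b d e : T a b d e = - T e b d a.
  have := P1 (a + e) b d; rewrite !T1 !T4 !P1 add0r addr0 => H; lra.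
have cyc a b d e : T a b d e = T d a b e.
  by rewrite P2 algebraic_curvature_pair (T34 d a) opprK.
have := bianchi u v w z; rewrite (cyc v w u) (cyc w u v) (cyc v w u) => H; lra.
Qed.

End AlgebraicCurvature.

Lemma delta_bilin (R : pzSemiRingType) m (M : 'M[R]_m) a b :
  ((delta_mx 0 a : 'rV[R]_m) *m M *m (delta_mx 0 b : 'rV[R]_m)^T) 0 0 = M a b.
Proof. by rewrite -rowE trmx_delta -colE !mxE. Qed.

(** * Curvature of a metric of constant sectional curvature *)

Section ConstantCurvature.
Context {R : realType} {m : nat}.
Variables (W : set 'rV[R]_m) (h : 'rV[R]_m -> 'M[R]_m) (c : R).
Hypotheses (oW : open W) (smooth_h : smooth_mx W h).
Hypothesis sym_h : forall y, W y -> (h y)^T = h y.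
Hypothesis unit_h : forall y, W y -> h y \in unitmx.
Hypothesis c_gt0 : 0 < c.
Hypothesis sec_h : forall y u v, W y -> row_free (col_mx u v) ->
  sectional_curvature h y u v = c.

Section Point.
Variable x : 'rV[R]_m.
Hypothesis Wx : W x.

Let K (u v : 'rV[R]_m) : 'M[R]_m :=
  \sum_(i < m) \sum_(j < m) (u 0 i * v 0 j) *: curvature_mx h i j x.

Let curvature_opE u v w : curvature_op h x u v w = w *m K u v.
Proof.
apply/rowP => l; rewrite !mxE; apply: eq_bigr => k _.
rewrite /K summxE mulr_sumr; apply: eq_bigr => i _.
rewrite summxE mulr_sumr; apply: eq_bigr => j _.
by rewrite !mxE; ring.
Qed.

Let KDl u u' v : K (u + u') v = K u v + K u' v.
Proof.
rewrite -big_split; apply: eq_bigr => i _; rewrite -big_split; apply: eq_bigr => j _.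
by rewrite mxE mulrDl scalerDl.
Qed.

Let KZl a u v : K (a *: u) v = a *: K u v.
Proof.
rewrite scaler_sumr; apply: eq_bigr => i _; rewrite scaler_sumr; apply: eq_bigr => j _.
by rewrite mxE scalerA mulrA.
Qed.

Let KC u v : K u v = - K v u.
Proof.
rewrite /K exchange_big /= -sumrN; apply: eq_bigr => j _.
rewrite -sumrN; apply: eq_bigr => i _; rewrite mulrC -scalerN; congr (_ *: _).
by apply/matrixP => k l; rewrite !mxE curvature_antisym.
Qed.

Let K_skew u v : K u v *m h x + h x *m (K u v)^T = 0.
Proof.
rewrite /K mulmx_suml linear_sum /= mulmx_sumr -big_split big1 // => i _.
rewrite mulmx_suml linear_sum /= mulmx_sumr -big_split big1 // => j _.
by rewrite /= trmxZ -scalemxAl -scalemxAr -scalerDr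
  (curvature_skew oW smooth_h sym_h unit_h i j Wx) scaler0.
Qed.

Let K_bianchi u v w : w *m K u v + u *m K v w + v *m K w u = 0.
Proof.
have E (a b d : 'rV[R]_m) l : (d *m K a b) 0 l =
    \sum_k \sum_i \sum_j d 0 k * a 0 i * b 0 j * curvature h l k i j x.
  rewrite mxE; apply: eq_bigr => k _; rewrite /K summxE mulr_sumr.
  apply: eq_bigr => i _; rewrite summxE mulr_sumr; apply: eq_bigr => j _.
  by rewrite !mxE; ring.
apply/rowP => l; rewrite mxE [(w *m _ + _) 0 l]mxE [RHS]mxE !E.
have -> : \sum_k \sum_i \sum_j u 0 k * v 0 i * w 0 j * curvature h l k i j x
  = \sum_k \sum_i \sum_j w 0 k * u 0 i * v 0 j * curvature h l i j k x.
  under eq_bigr do rewrite exchange_big /=; rewrite exchange_big /=.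
  apply: eq_bigr => k _; apply: eq_bigr => i _; apply: eq_bigr => j _.
  by congr (_ * _); ring.
have -> : \sum_k \sum_i \sum_j v 0 k * w 0 i * u 0 j * curvature h l k i j x
  = \sum_k \sum_i \sum_j w 0 k * u 0 i * v 0 j * curvature h l j k i x.
  rewrite exchange_big /=; under eq_bigr do rewrite exchange_big /=.
  apply: eq_bigr => k _; apply: eq_bigr => i _; apply: eq_bigr => j _.
  by congr (_ * _); ring.
rewrite -big_split -big_split big1 // => k _ /=.
rewrite -big_split -big_split big1 // => i _ /=.
rewrite -big_split -big_split big1 // => j _ /=.
by rewrite -!mulrDr (curvature_bianchi oW sym_h) // mulr0.
Qed.

Let bl (u v : 'rV[R]_m) := bilin (h x) u v.
Let blDl u u' v : bl (u + u') v = bl u v + bl u' v.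
Proof. by rewrite /bl /bilin !mulmxDl mxE. Qed.
Let blDr u v v' : bl u (v + v') = bl u v + bl u v'.
Proof. by rewrite /bl /bilin trmxD mulmxDr mxE. Qed.
Let blC u v : bl u v = bl v u.
Proof.
rewrite /bl /bilin -[LHS]/((u *m h x *m v^T) 0 0).
by rewrite -[RHS]trace_mx11 -mxtrace_tr !trmx_mul trmxK sym_h // mulmxA trace_mx11.
Qed.
Let blZl a u v : bl (a *: u) v = a * bl u v.
Proof. by rewrite /bl /bilin -!scalemxAl mxE. Qed.

(** The curvature minus its model of constant curvature [c]. The difference has all the symmetries
    of a curvature tensor and vanishing sectional curvature, hence is zero. *)
Let T u v w z := bl (w *m K u v) z - c * (bl v w * bl u z - bl u w * bl v z).

Let TC34 u v w z : T u v w z = - T u v z w.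
Proof.
have E : bl (w *m K u v) z = - bl (z *m K u v) w.
  rewrite [bl (z *m _) w]blC /bl /bilin trmx_mul !mulmxA.
  rewrite -[w *m K u v *m h x]mulmxA.
  have /eqP := K_skew u v; rewrite addr_eq0 => /eqP ->.
  by rewrite mulmxN mulNmx mulmxA mxE.
rewrite /T E (blC u z) (blC v z) (blC u w) (blC v w); ring.
Qed.

Let TC12 u v w z : T u v w z = - T v u w z.
Proof.
have E : bl (w *m K u v) z = - bl (w *m K v u) z by rewrite /bl /bilin KC mulmxN !mulNmx mxE.
rewrite /T E; ring.
Qed.

Let T0 u v : T u v v u = 0.
Proof.
have [fr|] := boolP (row_free (col_mx u v)).
  rewrite /T (blC v u); have := sec_h Wx fr; rewrite /sectional_curvature curvature_opE.
  rewrite -![bilin _ _ _]/(bl _ _) => E.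
  (* With a vanishing Gram determinant the quotient would take the default value 0, whereas it
     equals [c], which is positive. *)
  have d0 : bl u u * bl v v - bl u v ^+ 2 != 0.
    by apply: contraTneq c_gt0 => d0; rewrite -E d0 invr0 mulr0 ltxx.
  by rewrite -E; field.
have Kuu a : K a a = 0.
  move: (K a a) (KC a a) => M E; apply/matrixP => i j.
  by have := congr1 (fun X : 'M[R]_m => X i j) E; rewrite !mxE => H; lra.
(* For dependent vectors the hypothesis says nothing, but [p] is then a multiple of [q]: the
   curvature term vanishes by skew symmetry and the model term because its Gram determinant is
   zero. *)
have dep a b (p q : 'rV[R]_m) : a *: p + b *: q = 0 -> a != 0 -> T p q q p = 0.
  move=> /eqP; rewrite addr_eq0 -scaleNr => /eqP E a0.
  have pE : p = (a^-1 * - b) *: q by rewrite -scalerA -E scalerA mulVf // scale1r.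
  rewrite /T (blC q p) pE KZl Kuu scaler0 mulmx0.
  have -> : bl 0 (a^-1 * - b *: q) = 0 by rewrite /bl /bilin !mul0mx mxE.
  rewrite !(blZl, blC q (_ *: _)); ring.
have TC : T v u u v = T u v v u by rewrite TC12 TC34 opprK.
rewrite -kermx_eq0 => /rowV0Pn[w /sub_kermxP].
rewrite -(hsubmxK w) mul_row_col [lsubmx w]mx11_scalar [rsubmx w]mx11_scalar.
rewrite !mul_scalar_mx; set a := lsubmx w 0 0; set b := rsubmx w 0 0 => E w0.
have [a0|a0] := eqVneq a 0; last exact: dep E a0.
have b0 : b != 0.
  by apply: contraNneq w0 => b0; rewrite a0 b0 !raddf0 row_mx0.
by rewrite -TC; apply: (dep b a) b0; rewrite addrC.
Qed.

(** Polarisation, through [algebraic_curvature_eq0], followed by cancellation of the invertible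
    matrix [h x]. The outcome is the form needed for the Gauss equation, where [c] times g has to
    cancel the curvature block. *)
Lemma constant_curvature_mx i j :
  curvature_mx h i j x = \matrix_(k, l) (c * ((i == l)%:R * h x j k - (j == l)%:R * h x i k)).
Proof.
have TE k z : T (delta_mx 0 i) (delta_mx 0 j) (delta_mx 0 k) (delta_mx 0 z) = 0.
  apply: algebraic_curvature_eq0 => {k z}; rewrite /T.
  - by move=> u u' v w z; rewrite KDl mulmxDr !blDl; ring.
  - move=> u v v' w z.
    by rewrite KC KDl opprD -!KC mulmxDr !blDl; ring.
  - by move=> u v w w' z; rewrite mulmxDl !blDl !blDr; ring.
  - by move=> u v w z z'; rewrite !blDr; ring.
  - exact: TC12.
  - exact: TC34.
  - move=> u v w z.
    have := congr1 (fun t => bl t z) (K_bianchi u v w); rewrite !blDl.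
    have -> : bl 0 z = 0 by rewrite /bl /bilin !mul0mx mxE.
    rewrite (blC w v) (blC w u) (blC v u) => E; rewrite -[RHS]E; ring.
  - exact: T0.
have E : curvature_mx h i j x *m h x
   = \matrix_(k, z) (c * (h x j k * h x i z - h x i k * h x j z)).
  apply/matrixP => k z; rewrite mxE; have /eqP := TE k z; rewrite subr_eq0.
  have KE : K (delta_mx 0 i) (delta_mx 0 j) = curvature_mx h i j x.
    rewrite /K (bigD1 i) //= [X in _ + X]big1 ?addr0; last first.
      move=> i' ne; rewrite big1 // => j' _.
      by rewrite mxE eqxx (negbTE ne) mul0r scale0r.
    rewrite (bigD1 j) //= [X in _ + X]big1 ?addr0; last first.
      by move=> j' ne; rewrite !mxE !eqxx (negbTE ne) mulr0 scale0r.
    by rewrite !mxE !eqxx mulr1 scale1r.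
  rewrite KE /bl /bilin -[delta_mx 0 k *m _ *m _]mulmxA !delta_bilin => /eqP ->.
  by [].
apply: (can_inj (mulmxK (unit_h Wx))); rewrite E.
apply/matrixP => k z; rewrite !mxE.
under eq_bigr do rewrite mxE.
have S (a : 'I_m) (t : R) : \sum_l (a == l)%:R * t * h x l z = t * h x a z.
  rewrite (bigD1 a) //= eqxx mul1r big1 ?addr0 // => l.
  by rewrite eq_sym => /negbTE ->; rewrite !mul0r.
transitivity (\sum_l ((i == l)%:R * (c * h x j k) * h x l z
   - (j == l)%:R * (c * h x i k) * h x l z)).
  by rewrite sumrB !S; ring.
by apply: eq_bigr => l _; ring.
Qed.

End Point.
End ConstantCurvature.

(** * Symmetric metrics from parallel frames of matrices *)

Ltac mx_expand :=
  rewrite ?(mulmxDl, mulmxDr, mulNmx, mulmxN, mulmxBl, mulmxBr, opprD, opprK);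
  rewrite -?(scalemxAl, scalemxAr) ?scalerA ?mulmxA.

(** Once products are distributed, what remains is linear in noncommutative monomials; with these as
    atoms, commutative algebra in each entry decides it. *)
Ltac mx_abstract :=
  repeat match goal with |- context [?A *m ?B] =>
    let z := fresh "z" in move: (A *m B) => z end.

Ltac mx_ring := mx_abstract; apply/matrixP => ? ?; rewrite !mxE; ring.

Definition bracket (R : pzRingType) N (X Y : 'M[R]_N) := X *m Y - Y *m X.

Section Bracket.
Context {R : comPzRingType} {N : nat}.
Implicit Types X Y Z : 'M[R]_N.

Lemma bracketDl X Y Z : bracket (X + Y) Z = bracket X Z + bracket Y Z.
Proof. by rewrite /bracket mulmxDl mulmxDr opprD addrACA. Qed.

Lemma bracketZl (a : R) X Y : bracket (a *: X) Y = a *: bracket X Y.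
Proof. by rewrite /bracket -scalemxAl -scalemxAr scalerBr. Qed.

Lemma bracketZr (a : R) X Y : bracket X (a *: Y) = a *: bracket X Y.
Proof. by rewrite /bracket -scalemxAl -scalemxAr scalerBr. Qed.

Lemma bracket0l X : bracket 0 X = 0.
Proof. by rewrite /bracket mul0mx mulmx0 subr0. Qed.

Lemma bracket_suml (I : finType) (F : I -> 'M[R]_N) X :
  bracket (\sum_i F i) X = \sum_i bracket (F i) X.
Proof. by rewrite /bracket mulmx_suml mulmx_sumr sumrB. Qed.

Lemma bracket_sumr (I : finType) (F : I -> 'M[R]_N) X :
  bracket X (\sum_i F i) = \sum_i bracket X (F i).
Proof. by rewrite /bracket mulmx_suml mulmx_sumr sumrB. Qed.

End Bracket.

Section CovariantDerivative.
Context {R : realType} {m N : nat}.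
Variables (W : set 'rV[R]_m) (omega : 'I_m -> 'rV[R]_m -> 'M[R]_N).
Hypotheses (oW : open W) (smooth_omega : forall a, smooth_mx W (omega a)).
Implicit Types (Y Z : 'rV[R]_m -> 'M[R]_N).

(* The connection acts on row vectors by s |-> d_a s + s omega_a, hence on
   endomorphisms by Y |-> d_a Y + [Y, omega_a]. *)
Definition cov a Y x := dmx a Y x + bracket (Y x) (omega a x).

Lemma smooth_cov a Y : smooth_mx W Y -> smooth_mx W (cov a Y).
Proof.
move=> sY; apply: smooth_mxD => //; first exact: smooth_dmx.
by apply: smooth_mxB => //; apply: smooth_mxM.
Qed.

Lemma eq_cov a Y Z x : W x -> {in W, Y =1 Z} -> cov a Y x = cov a Z x.
Proof.
move=> Wx YZ; rewrite /cov (eq_dmx a oW Wx YZ); congr (_ + bracket _ _).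
by apply: YZ; rewrite inE.
Qed.

Lemma covM a Y Z x : smooth_mx W Y -> smooth_mx W Z -> W x ->
  cov a (fun y => Y y *m Z y) x = cov a Y x *m Z x + Y x *m cov a Z x.
Proof.
move=> sY sZ Wx; rewrite /cov /bracket.
rewrite (dmxM a (smooth_mx_diff sY Wx) (smooth_mx_diff sZ Wx)).
mx_expand; mx_ring.
Qed.

Lemma covD a Y Z x : smooth_mx W Y -> smooth_mx W Z -> W x ->
  cov a (fun y => Y y + Z y) x = cov a Y x + cov a Z x.
Proof.
move=> sY sZ Wx.
have dY := smooth_mx_diff sY Wx; have dZ := smooth_mx_diff sZ Wx.
by rewrite /cov bracketDl (dmxD a dY dZ); exact: addrACA.
Qed.

Lemma covB a Y Z x : smooth_mx W Y -> smooth_mx W Z -> W x ->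
  cov a (fun y => Y y - Z y) x = cov a Y x - cov a Z x.
Proof.
move=> sY sZ Wx.
have dY := smooth_mx_diff sY Wx; have dZ := smooth_mx_diff sZ Wx.
rewrite /cov (dmxB a dY dZ) /bracket; mx_expand; mx_ring.
Qed.

Lemma covZ a (f : 'rV[R]_m -> R) Y x : smooth_on W f -> smooth_mx W Y -> W x ->
  cov a (fun y => f y *: Y y) x = partial a f x *: Y x + f x *: cov a Y x.
Proof.
move=> sf sY Wx.
have df := smooth_on_diff sf Wx; have dY := smooth_mx_diff sY Wx.
by rewrite /cov bracketZl (dmxZ a df dY) [f x *: (_ + bracket _ _)]scalerDr; exact: (esym (addrA _ _ _)).
Qed.

Lemma cov_cst0 a x : cov a (fun=> 0) x = 0.
Proof. by rewrite /cov dmx_cst bracket0l addr0. Qed.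

Lemma cov_sum a (I : finType) (F : I -> 'rV[R]_m -> 'M[R]_N) x :
  (forall i, smooth_mx W (F i)) -> W x ->
  cov a (fun y => \sum_i F i y) x = \sum_i cov a (F i) x.
Proof.
move=> sF Wx.
suff: forall r : seq I, smooth_mx W (fun y => \sum_(i <- r) F i y) /\
   cov a (fun y => \sum_(i <- r) F i y) x = \sum_(i <- r) cov a (F i) x.
  by move=> /(_ (index_enum I))[].
elim=> [|i r [IH1 IH2]].
  under eq_fun do rewrite big_nil; rewrite big_nil cov_cst0.
  by split => //; exact: smooth_mx_cst.
under eq_fun do rewrite big_cons.
by rewrite big_cons covD // IH2; split => //; exact: smooth_mxD.
Qed.

Lemma cov_bracket a Y Z x : smooth_mx W Y -> smooth_mx W Z -> W x ->
  cov a (fun y => bracket (Y y) (Z y)) x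
  = bracket (cov a Y x) (Z x) + bracket (Y x) (cov a Z x).
Proof.
move=> sY sZ Wx; rewrite covB ?covM //; try exact: smooth_mxM.
rewrite /bracket; mx_ring.
Qed.

Lemma partial_trace_cov a Y x : smooth_mx W Y -> W x ->
  partial a (fun y => \tr (Y y)) x = \tr (cov a Y x).
Proof.
move=> sY Wx; rewrite partial_mxtrace; last exact: smooth_mx_diff sY Wx.
by rewrite /cov mxtraceD /bracket mxtraceD raddfN /= mxtrace_mulC subrr addr0.
Qed.

Lemma cov_commutator i j Y x : smooth_mx W Y -> W x ->
  cov i (cov j Y) x - cov j (cov i Y) x
  = bracket (Y x) (connection_curvature omega i j x).
Proof.
move=> sY Wx.
have dY := smooth_mx_diff sY Wx.
have dom b := smooth_mx_diff (smooth_omega b) Wx.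
have ddY a := smooth_mx_diff (smooth_dmx a sY) Wx.
have E a b : cov a (cov b Y) x = dmx a (dmx b Y) x
    + (bracket (dmx a Y x) (omega b x) + bracket (Y x) (dmx a (omega b) x))
    + bracket (dmx b Y x + bracket (Y x) (omega b x)) (omega a x).
  rewrite {1}/cov; congr (_ + _); rewrite /cov dmxD //; last first.
    apply: smooth_mx_diff Wx.
    by apply: smooth_mxB => //; apply: smooth_mxM.
  congr (_ + _); rewrite dmxB ?dmxM //; try exact: differentiable_mxM.
  rewrite /bracket; mx_ring.
rewrite !E (dmxC i j oW sY Wx) /bracket /connection_curvature; mx_expand; mx_ring.
Qed.

End CovariantDerivative.

(** This is the Nijenhuis tensor after the derivatives of J have been expressed by nabla J = 0.
    Symmetry of the coefficients makes [Q] and [S] symmetric in [i], [j] and turns [T i j] into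
    [P j i], so that the antisymmetrised sum cancels. *)
Lemma nijenhuis_of_symmetric_coefficients (R : comPzRingType) m (J : 'M[R]_m)
    (G : 'I_m -> 'I_m -> 'I_m -> R) k i j :
  (forall d a b, G d a b = G d b a) ->
  \sum_a (J i a * \sum_d (G d a j * J d k - J j d * G k a d)
    - J j a * \sum_d (G d a i * J d k - J i d * G k a d)
    - J a k * (\sum_d (G d i j * J d a - J j d * G a i d)
               - \sum_d (G d j i * J d a - J i d * G a j d))) = 0.
Proof.
move=> GC.
pose P i j := \sum_a \sum_d J i a * (G d a j * J d k).
pose Q i j := \sum_a \sum_d J i a * (J j d * G k a d).
pose S i j := \sum_a \sum_d J a k * (G d i j * J d a).
pose T i j := \sum_a \sum_d J a k * (J j d * G a i d).
have QC : Q i j = Q j i.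
  rewrite /Q exchange_big; apply: eq_bigr => a _; apply: eq_bigr => d _.
  by rewrite (GC k d a); ring.
have SC : S i j = S j i.
  by apply: eq_bigr => a _; apply: eq_bigr => d _; rewrite (GC d i j).
have TP i' j' : T i' j' = P j' i'.
  rewrite /T exchange_big; apply: eq_bigr => a _; apply: eq_bigr => d _.
  by rewrite (GC d i' a); ring.
transitivity ((P i j - Q i j) - (P j i - Q j i) - ((S i j - T i j) - (S j i - T j i))).
  rewrite /P /Q /S /T -!sumrB; apply: eq_bigr => a _.
  by rewrite -!sumrB !mulr_sumr -!sumrB; apply: eq_bigr => d _; ring.
by rewrite !TP QC SC; ring.
Qed.

Lemma sum_coord_metric (R : comPzRingType) m N (theta : 'I_m -> 'M[R]_N) (h : 'M[R]_m) kappa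
    (v : 'I_m -> R) b :
  (forall a c, h a c = kappa * \tr (theta a *m theta c)) ->
  \sum_a v a * h a b = kappa * \tr ((\sum_a v a *: theta a) *m theta b).
Proof.
move=> hE; rewrite mulmx_suml raddf_sum /= mulr_sumr; apply: eq_bigr => a _.
by rewrite -scalemxAl mxtraceZ hE mulrCA.
Qed.

(** * Metrics given by a matrix-valued soldering form *)

Section SymmetricFrame.
Context {R : realType} {m N : nat}.
Variables (W : set 'rV[R]_m) (h : 'rV[R]_m -> 'M[R]_m).
Variables (omega theta : 'I_m -> 'rV[R]_m -> 'M[R]_N) (kappa : R).
Hypotheses (oW : open W) (smooth_h : smooth_mx W h).
Hypothesis unit_h : forall y, W y -> h y \in unitmx.
Hypotheses (smooth_omega : forall a, smooth_mx W (omega a)).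
Hypotheses (smooth_theta : forall a, smooth_mx W (theta a)).
Hypothesis h_theta : forall y a b, W y -> h y a b = kappa * \tr (theta a y *m theta b y).
Hypothesis torsion_free : forall y a b, W y ->
  cov omega a (theta b) y = cov omega b (theta a) y.
Hypothesis theta_span : forall y a b, W y ->
  exists C : 'I_m -> R, cov omega a (theta b) y = \sum_c C c *: theta c y.
Hypothesis curvature_theta : forall y i j, W y ->
  connection_curvature omega i j y = - 4^-1 *: bracket (theta i y) (theta j y).

Let covZ' := @covZ R m N W omega.
Let cov_sum' := cov_sum omega oW.
Let cov_bracket' := cov_bracket omega oW.

Lemma frame_metric_sym y : W y -> (h y)^T = h y.
Proof. by move=> Wy; apply/matrixP => a b; rewrite mxE !h_theta // mxtrace_mulC. Qed.

Lemma frame_coord y (v : 'I_m -> R) b : W y ->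
  \sum_a v a * h y a b = kappa * \tr ((\sum_a v a *: theta a y) *m theta b y).
Proof. by move=> Wy; apply: sum_coord_metric => a c; exact: h_theta. Qed.

Lemma frame_free y (v : 'I_m -> R) : W y ->
  \sum_a v a *: theta a y = 0 -> forall a, v a = 0.
Proof.
move=> Wy v0 a.
have : (\row_b v b) *m h y = 0.
  apply/rowP => b; rewrite !mxE; under eq_bigr do rewrite mxE.
  by rewrite frame_coord // v0 mul0mx mxtrace0 mulr0.
move=> /(congr1 (mulmx^~ (invmx (h y)))); rewrite mulmxK ?unit_h // mul0mx.
by move=> /rowP/(_ a); rewrite !mxE.
Qed.

Lemma frame_inj y (v w : 'I_m -> R) : W y ->
  \sum_a v a *: theta a y = \sum_a w a *: theta a y -> forall a, v a = w a.
Proof.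
move=> Wy /eqP; rewrite -subr_eq0 -sumrB => /eqP E a; apply/eqP.
rewrite -subr_eq0; apply/eqP; apply: (@frame_free y (fun a => v a - w a)) => //.
by rewrite -[RHS]E; apply: eq_bigr => b _; rewrite scalerBl.
Qed.

(** The map sending d_a to [theta a] carries the Levi-Civita connection to [cov omega]: coefficients
    exist by [theta_span], they are symmetric by [torsion_free], and they are compatible with [h]
    because the trace form is parallel; [christoffel_koszul] concludes. Tensor identities can
    henceforth be checked on matrices. *)
Lemma cov_theta y a b : W y ->
  cov omega a (theta b) y = \sum_c christoffel h c a b y *: theta c y.
Proof.
move=> Wy.
have [C CE] : exists C : 'I_m -> 'I_m -> 'I_m -> R, forall a b,
    cov omega a (theta b) y = \sum_c C a b c *: theta c y.
  have C0 (p : 'I_m * 'I_m) := theta_span p.1 p.2 Wy.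
  by have [C CE] := choice C0; exists (fun a b => C (a, b)) => a' b'; exact: CE (a', b').
pose Cm i : 'M[R]_m := \matrix_(k, l) C i k l.
have K := @christoffel_koszul _ _ W h frame_metric_sym unit_h Cm y Wy.
rewrite CE; apply: eq_bigr => c _; congr (_ *: _).
rewrite -K ?mxE // => {a b c} [i k l|i].
  rewrite !mxE; apply: (frame_inj Wy (v := C i k) (w := C k i)).
  by rewrite -!CE torsion_free.
apply/matrixP => b c; rewrite dmxE.
rewrite (eq_partial i oW Wy (g := fun z => kappa * \tr (theta b z *m theta c z))); last first.
  by move=> z; rewrite inE; exact: h_theta.
have sbc : smooth_mx W (fun z => theta b z *m theta c z) by exact: smooth_mxM.
rewrite partialZ; last first.
  apply: smooth_on_diff Wy.
  by apply: smooth_on_sum => // k; exact: sbc.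
rewrite (partial_trace_cov omega i sbc Wy) (covM omega i (smooth_theta b) (smooth_theta c) Wy) mxtraceD mulrDr !CE.
rewrite [RHS]mxE; congr (_ + _).
  by rewrite -(frame_coord (C i b) c Wy) mxE; apply: eq_bigr => d _; rewrite !mxE.
rewrite mxtrace_mulC -(frame_coord (C i c) b Wy) mxE.
by apply: eq_bigr => d _; rewrite !mxE !h_theta // mxtrace_mulC mulrC.
Qed.

Lemma cov_frame_sum y s (f : 'I_m -> 'rV[R]_m -> R) : (forall l, smooth_on W (f l)) -> W y ->
  cov omega s (fun z => \sum_l f l z *: theta l z) y
  = \sum_l (partial s (f l) y + \sum_a christoffel h l s a y * f a y) *: theta l y.
Proof.
move=> sf Wy; rewrite cov_sum' //; last by move=> c; exact: smooth_mxZ.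
under eq_bigr do rewrite covZ' // cov_theta // scaler_sumr.
rewrite big_split /= exchange_big -big_split; apply: eq_bigr => l _.
rewrite scalerDl scaler_suml; congr (_ + _); apply: eq_bigr => c _.
by rewrite scalerA mulrC.
Qed.

(** The commutator of two covariant derivatives of [theta k], computed twice: through [cov_theta] it
    gives the coordinate curvature, and through the curvature of [omega] a double bracket. *)
Lemma curvature_frame y i j k : W y ->
  \sum_l curvature h l k i j y *: theta l y
  = 4^-1 *: bracket (bracket (theta i y) (theta j y)) (theta k y).
Proof.
move=> Wy.
have sG := smooth_christoffel oW smooth_h unit_h.
have E a b : cov omega a (cov omega b (theta k)) y =
  \sum_l (partial a (christoffel h l b k) y
     + \sum_c christoffel h l a c y * christoffel h c b k y) *: theta l y.
  rewrite (eq_cov omega oW a (x := y)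
      (Z := fun z => \sum_c christoffel h c b k z *: theta c z) Wy); last first.
    by move=> z; rewrite inE => Wz; exact: cov_theta.
  exact: cov_frame_sum.
have := cov_commutator oW smooth_omega i j (smooth_theta k) Wy.
rewrite !E -sumrB curvature_theta // bracketZr => H.
rewrite (_ : 4^-1 *: _ = - 4^-1 *: bracket (theta k y) (bracket (theta i y) (theta j y))).
  rewrite -H; apply: eq_bigr => l _; rewrite -scalerBl; congr (_ *: _).
  rewrite /curvature sumrB.
  move: (partial i _ y) (partial j _ y) (\sum_(a < m) christoffel h l i a y * _)
    (\sum_(a < m) christoffel h l j a y * _) => p q r s; ring.
by rewrite scaleNr -scalerN /bracket opprB.
Qed.

(** By [curvature_frame] the curvature is a bracket expression with constant coefficients in the
    [theta a]. Its derivative by the Leibniz rule consists only of Christoffel terms, and these are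
    the ones that the covariant derivative of the curvature subtracts. *)
Lemma frame_locally_symmetric y s l k i j : W y -> nabla_curvature h s l k i j y = 0.
Proof.
move=> Wy.
have sG := smooth_christoffel oW smooth_h unit_h.
have sK := smooth_curvature oW smooth_h unit_h.
have sbr a b : smooth_mx W (fun z => bracket (theta a z) (theta b z)).
  by apply: smooth_mxB => //; exact: smooth_mxM.
have E1 := cov_frame_sum s (fun l => sK l k i j) Wy.
have E2 : cov omega s (fun z => 4^-1 *: bracket (bracket (theta i z) (theta j z)) (theta k z)) y
  = 4^-1 *: (bracket (bracket (cov omega s (theta i) y) (theta j y)) (theta k y)
     + bracket (bracket (theta i y) (cov omega s (theta j) y)) (theta k y)
     + bracket (bracket (theta i y) (theta j y)) (cov omega s (theta k) y)).
  rewrite covZ' //; last 2 first.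
  - exact: smooth_on_cst.
  - by apply: smooth_mxB => //; exact: smooth_mxM.
  by rewrite partial_cst scale0r add0r cov_bracket' // cov_bracket' // bracketDl.
have E3 : \sum_l (\sum_a (christoffel h a s i y * curvature h l k a j y
     + christoffel h a s j y * curvature h l k i a y
     + christoffel h a s k y * curvature h l a i j y)) *: theta l y
  = cov omega s (fun z => 4^-1 *: bracket (bracket (theta i z) (theta j z)) (theta k z)) y.
  have lin (K : 'I_m -> 'I_m -> R) (F : 'I_m -> 'M[R]_N) (v : 'I_m -> R) :
      (forall a, F a = \sum_l K l a *: theta l y) ->
      \sum_l (\sum_a v a * K l a) *: theta l y = \sum_a v a *: F a.
    move=> FE; under [RHS]eq_bigr do rewrite FE scaler_sumr.
    rewrite exchange_big; apply: eq_bigr => l' _; rewrite scaler_suml.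
    by apply: eq_bigr => a _; rewrite scalerA.
  have D (X Y Z : 'M[R]_N) : 4^-1 *: (X + Y + Z) = 4^-1 *: X + 4^-1 *: Y + 4^-1 *: Z.
    by rewrite !scalerDr.
  have e1 : 4^-1 *: bracket (bracket (\sum_c christoffel h c s i y *: theta c y) (theta j y)) (theta k y)
     = \sum_l (\sum_a christoffel h a s i y * curvature h l k a j y) *: theta l y.
    rewrite (lin _ _ _ (fun a => esym (curvature_frame a j k Wy))).
    rewrite !bracket_suml scaler_sumr; apply: eq_bigr => a _.
    by rewrite !bracketZl !scalerA mulrC.
  have e2 : 4^-1 *: bracket (bracket (theta i y) (\sum_c christoffel h c s j y *: theta c y)) (theta k y)
     = \sum_l (\sum_a christoffel h a s j y * curvature h l k i a y) *: theta l y.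
    rewrite (lin _ _ _ (fun a => esym (curvature_frame i a k Wy))).
    rewrite bracket_sumr bracket_suml scaler_sumr; apply: eq_bigr => a _.
    by rewrite bracketZr bracketZl !scalerA mulrC.
  have e3 : 4^-1 *: bracket (bracket (theta i y) (theta j y)) (\sum_c christoffel h c s k y *: theta c y)
     = \sum_l (\sum_a christoffel h a s k y * curvature h l a i j y) *: theta l y.
    rewrite (lin _ _ _ (fun a => esym (curvature_frame i j a Wy))).
    rewrite bracket_sumr scaler_sumr; apply: eq_bigr => a _.
    by rewrite bracketZr !scalerA mulrC.
  rewrite E2 !cov_theta // D e1 e2 e3 -!big_split; apply: eq_bigr => l' _.
  by rewrite /= -!scalerDl -!big_split.
have := E1; rewrite (eq_cov omega oW s (x := y)
  (Z := fun z => 4^-1 *: bracket (bracket (theta i z) (theta j z)) (theta k z)) Wy); last first.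
  by move=> z; rewrite inE => Wz; exact: curvature_frame.
rewrite -E3 => /(frame_inj Wy)/(_ l) E4.
rewrite /nabla_curvature.
have sub4 (p q r t : R) : p - q - r - t = p - (r + t + q) by ring.
under eq_bigr do rewrite sub4.
by rewrite sumrB addrA -E4 subrr.
Qed.

Section ParallelEndomorphism.
Variables (J : 'rV[R]_m -> 'M[R]_m) (jj : 'rV[R]_m -> 'M[R]_N).
Hypotheses (smooth_J : smooth_mx W J) (smooth_jj : smooth_mx W jj).
Hypothesis J_theta : forall y a, W y ->
  \sum_b J y a b *: theta b y = bracket (jj y) (theta a y).
Hypothesis cov_jj : forall y a, W y -> cov omega a jj y = 0.

(** [J] is transported to the bracket with [jj], so that a parallel [jj] makes [J] parallel; the
    formula is nabla J = 0 in row-vector form. *)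
Lemma frame_parallel y c : W y ->
  dmx c J y = christoffel_mx h c y *m J y - J y *m christoffel_mx h c y.
Proof.
move=> Wy; apply/matrixP => a b.
have E : cov omega c (fun z => \sum_b J z a b *: theta b z) y
   = bracket (jj y) (cov omega c (theta a) y).
  rewrite (eq_cov omega oW c (x := y) (Z := fun z => bracket (jj z) (theta a z)) Wy); last first.
    by move=> z; rewrite inE; exact: J_theta.
  by rewrite cov_bracket' // cov_jj // bracket0l add0r.
move: E; rewrite cov_theta // bracket_sumr (cov_frame_sum c (fun l => smooth_J a l) Wy).
under [RHS]eq_bigr do rewrite bracketZr -J_theta // scaler_sumr.
rewrite [RHS]exchange_big /= => E.
have entry (X Y : 'M[R]_m) : (X - Y) a b = X a b - Y a b by rewrite !mxE.
rewrite entry -(frame_inj Wy (v := fun l => dmx c J y a l + (J y *m christoffel_mx h c y) a l)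
   (w := fun l => (christoffel_mx h c y *m J y) a l)) ?addrK //.
transitivity (\sum_l (partial c (fun z => J z a l) y
    + \sum_d christoffel h l c d y * J y a d) *: theta l y).
  apply: eq_bigr => l _; rewrite dmxE mxE; congr ((_ + _) *: _).
  by apply: eq_bigr => d _; rewrite mxE mulrC.
rewrite E; apply: eq_bigr => l _; rewrite mxE scaler_suml.
by apply: eq_bigr => d _; rewrite scalerA mxE.
Qed.

Let G := christoffel h.
Let dJ y a j k : W y -> partial a (fun z => J z j k) y
  = \sum_d (G d a j y * J y d k - J y j d * G k a d y).
Proof.
have entry (X Y : 'M[R]_m) : (X - Y) j k = X j k - Y j k by rewrite !mxE.
move=> Wy; rewrite -dmxE frame_parallel // entry !mxE -sumrB.
by apply: eq_bigr => d _; rewrite !mxE.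
Qed.

Lemma frame_integrable y k i j : W y -> nijenhuis J k i j y = 0.
Proof.
move=> Wy; rewrite /nijenhuis.
under eq_bigr do rewrite !dJ //.
apply: (@nijenhuis_of_symmetric_coefficients _ _ (J y) (fun d a b => G d a b y)).
by move=> d a b; exact: christoffelC oW frame_metric_sym d a b y Wy.
Qed.

Hypothesis J_skew : forall y, W y -> h y *m (J y)^T = - (h y *m (J y)^T)^T.

(** A parallel 2-form is closed for a torsion-free connection: in the cyclic sum, symmetry of the
    Christoffel symbols and skewness of the form pair off all terms. *)
Lemma frame_fundamental_form_closed y a b k : W y ->
  d_form2 (fundamental_form h J) a b k y = 0.
Proof.
move=> Wy.
have [w wE] : {w | w = fun z => h z *m (J z)^T} by exists (fun z => h z *m (J z)^T).
have sJ : smooth_mx W (fun z => (J z)^T) by exact: smooth_mx_tr.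
have dw c : dmx c w y = christoffel_mx h c y *m w y + w y *m (christoffel_mx h c y)^T.
  rewrite wE (dmxM c (smooth_mx_diff smooth_h Wy) (smooth_mx_diff sJ Wy)).
  rewrite dmx_tr frame_parallel // (christoffel_metric oW frame_metric_sym unit_h) //.
  rewrite trmxD trmxN !trmx_mul; mx_expand; mx_ring.
have GC p q d : G d p q y = G d q p y.
  exact: christoffelC oW frame_metric_sym d p q y Wy.
have wC p q : w y p q = - w y q p by rewrite wE {1}J_skew // mxE [X in - X = _]mxE.
pose F p q r := \sum_d G d p q y * w y d r.
have FC p q r : F p q r = F q p r by apply: eq_bigr => d _; rewrite GC.
have E p q r : partial p (fundamental_form h J q r) y = F p q r - F p r q.
  have -> : partial p (fundamental_form h J q r) y = dmx p w y q r by rewrite dmxE wE.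
  rewrite dw mxE -sumrN !mxE; congr (_ + _).
    by apply: eq_bigr => d _; rewrite !mxE.
  by apply: eq_bigr => d _; rewrite !mxE wC; rewrite mulNr mulrC.
rewrite /d_form2 !E (FC b a) (FC k b) (FC k a); ring.
Qed.

End ParallelEndomorphism.

End SymmetricFrame.

(** * Tangent spaces to reflections, and the Ricci trace *)

Section TangentAlgebra.
Context {R : realFieldType} {m N : nat}.
Variables (theta : 'I_m -> 'M[R]_N) (h : 'M[R]_m) (kappa : R) (S B : 'M[R]_N).
Hypothesis unit_h : h \in unitmx.
Hypothesis h_theta : forall a b, h a b = kappa * \tr (theta a *m theta b).
Hypothesis SS : S *m S = 1%:M.
Hypothesis unit_B : B \in unitmx.
Hypothesis sym_B : B^T = B.
Hypothesis sym_SB : (S *m B)^T = S *m B.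

(** The tangent space at [S] to the involutions that are self-adjoint for [B], obtained by
    linearising S S = 1 and (S B)^T = S B. *)
Definition is_tangent (Y : 'M[R]_N) := S *m Y = - (Y *m S) /\ (Y *m B)^T = Y *m B.

Hypothesis theta_tangent : forall a, is_tangent (theta a).
Hypothesis theta_nondegenerate : forall Y, is_tangent Y ->
  (forall c, \tr (Y *m theta c) = 0) -> Y = 0.

Lemma is_tangent_sub Y Z : is_tangent Y -> is_tangent Z -> is_tangent (Y - Z).
Proof.
move=> [Y1 Y2] [Z1 Z2]; split.
  by rewrite mulmxBr mulmxBl Y1 Z1 opprB opprK addrC.
by rewrite mulmxBl trmxD trmxN Y2 Z2.
Qed.

Lemma is_tangentZ a Y : is_tangent Y -> is_tangent (a *: Y).
Proof.
move=> [Y1 Y2]; split; first by rewrite -scalemxAr Y1 -scalemxAl scalerN.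
by rewrite -scalemxAl trmxZ Y2.
Qed.

Lemma is_tangent_sum (v : 'I_m -> R) : is_tangent (\sum_a v a *: theta a).
Proof.
split.
  rewrite mulmx_sumr mulmx_suml -sumrN; apply: eq_bigr => a _.
  by have [-> _] := is_tangentZ (v a) (theta_tangent a).
rewrite mulmx_suml raddf_sum /=; apply: eq_bigr => a _.
by have [_ ->] := is_tangentZ (v a) (theta_tangent a).
Qed.

(** The coefficients are the pairings with the [theta c], raised by the inverse metric. The
    difference of the two sides is tangent and pairs to zero with every [theta c], so nondegeneracy
    kills it. *)
Lemma tangent_expand Y : is_tangent Y -> kappa != 0 ->
  Y = \sum_l (\sum_c kappa * \tr (Y *m theta c) * invmx h c l) *: theta l.
Proof.
move=> tY k0; pose v l := \sum_c kappa * \tr (Y *m theta c) * invmx h c l.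
apply/eqP; rewrite -subr_eq0 -[X in _ - X]/(\sum_l v l *: theta l); apply/eqP.
apply: theta_nondegenerate => [|c].
  by apply: is_tangent_sub => //; exact: is_tangent_sum.
rewrite mulmxBl mxtraceD raddfN /=; apply: (mulfI k0); rewrite mulrBr mulr0.
rewrite -(sum_coord_metric v c h_theta).
have -> : \sum_a v a * h a c = ((\row_d (kappa * \tr (Y *m theta d))) *m invmx h *m h) 0 c.
  rewrite !mxE; apply: eq_bigr => a _; congr (_ * _).
  by rewrite mxE; apply: eq_bigr => d _; rewrite mxE.
by rewrite mulmxKV // mxE subrr.
Qed.

Hypothesis kappa_neq0 : kappa != 0.

Let BS : B *m S^T = S *m B.
Proof. by rewrite -{1}sym_B -trmx_mul sym_SB. Qed.

Let SI : S^T *m invmx B = invmx B *m S.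
Proof.
apply: (can_inj (mulKmx unit_B)); rewrite !mulmxA BS mulmxV // mul1mx.
by rewrite mulmxK.
Qed.

(** The adjoint for the form [B] under the row-vector convention; the symmetry condition of a
    tangent vector is [adj Y = Y]. *)
Let adj (Z : 'M[R]_N) := B *m Z^T *m invmx B.

Let adjS (Z : 'M[R]_N) : adj (S *m Z *m S) = S *m adj Z *m S.
Proof. by rewrite /adj !trmx_mul !mulmxA BS -[_ *m S^T *m _]mulmxA SI !mulmxA. Qed.

Let adjK (Z : 'M[R]_N) : adj (adj Z) = Z.
Proof. by rewrite /adj !trmx_mul trmxK trmx_inv sym_B !mulmxA mulmxV // mul1mx mulmxK. Qed.

Let adjD Y Z : adj (Y + Z) = adj Y + adj Z.
Proof. by rewrite /adj trmxD mulmxDr mulmxDl. Qed.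

Let adjN Y : adj (- Y) = - adj Y.
Proof. by rewrite /adj trmxN mulmxN mulNmx. Qed.

Let trace_SZS Z : \tr (S *m Z *m S) = \tr Z.
Proof. by rewrite mxtrace_mulC mulmxA SS mul1mx. Qed.

Let adj_theta c : adj (theta c) = theta c.
Proof.
have [_ t2] := theta_tangent c.
by rewrite /adj -{1}sym_B -trmx_mul t2 mulmxK.
Qed.

(* The orthogonal projection onto the tangent space for the trace form. *)
Let proj (Z : 'M[R]_N) := 4^-1 *: (Z - S *m Z *m S + (adj Z - S *m adj Z *m S)).

Let proj_tangent Z : is_tangent (proj Z).
Proof.
apply: is_tangentZ; split.
  have E X : S *m (X - S *m X *m S) = - ((X - S *m X *m S) *m S).
    by rewrite mulmxBr mulmxBl !mulmxA SS mul1mx -!mulmxA SS mulmx1 opprB.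
  by rewrite mulmxDr mulmxDl !E opprD.
set X := _ + _; have H : adj X = X.
  rewrite /X !(adjD, adjN) !adjS adjK; move: (adj Z) => T; mx_ring.
by rewrite trmx_mul sym_B -[in RHS]H /adj mulmxKV.
Qed.

Let trace_proj Z c : \tr (proj Z *m theta c) = \tr (Z *m theta c).
Proof.
have [t1 t2] := theta_tangent c.
have E1 X : \tr (S *m X *m S *m theta c) = - \tr (X *m theta c).
  by rewrite -!mulmxA t1 !mulmxN raddfN /= mxtrace_mulC -!mulmxA SS mulmx1.
have E2 : \tr (adj Z *m theta c) = \tr (Z *m theta c).
  rewrite -mxtrace_tr /adj !trmx_mul trmxK trmx_inv sym_B.
  have E : theta c *m B = B *m (theta c)^T by rewrite -t2 trmx_mul sym_B.
  by rewrite !mulmxA mxtrace_mulC !mulmxA -E mulmxK // mxtrace_mulC.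
rewrite /proj -scalemxAl mxtraceZ mulmxDl !mulmxBl !mxtraceD !raddfN /= !E1 E2.
by field.
Qed.

Let mul_delta (P Q : 'M[R]_N) a b x y : (P *m delta_mx a b *m Q) x y = P x a * Q b y.
Proof.
rewrite mxE (bigD1 b) //= mxE (bigD1 a) //= mxE !eqxx mulr1 big1 ?addr0; last first.
  by move=> i ne; rewrite mxE (negbTE ne) mulr0.
rewrite big1 ?addr0 // => i ne; rewrite mxE big1 ?mul0r // => k _.
by rewrite mxE (negbTE ne) andbF mulr0.
Qed.

Let trace_delta (T : 'M[R]_N) a x : \tr (delta_mx a x *m T) = T x a.
Proof.
rewrite /mxtrace (bigD1 a) //= big1 ?addr0; last first.
  move=> i ne; rewrite -[delta_mx a x]mul1mx mul_delta mxE (negbTE ne) mul0r //.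
by rewrite -[delta_mx a x]mul1mx mul_delta mxE eqxx mul1r.
Qed.

Let proj_delta a x b y : proj (delta_mx a x) b y =
  4^-1 * ((b == a)%:R * (x == y)%:R - S b a * S x y
    + (B b x * invmx B a y - (S *m B) b x * (invmx B *m S) a y)).
Proof.
have E (X Y Z T : 'M[R]_N) : (4^-1 *: (X - Y + (Z - T))) b y
    = 4^-1 * (X b y - Y b y + (Z b y - T b y)) by rewrite !mxE.
rewrite E /adj trmx_delta !mulmxA -[S *m B *m _ *m _ *m _]mulmxA !mul_delta.
by congr (_ * (_ - _ + _)); rewrite mxE [y == x]eq_sym -natrM mulnb.
Qed.

(** The sum of [theta i] tensor [theta c] against the inverse metric is the kernel of the projection
    [proj]: [tangent_expand] applied to [proj (delta_mx a x)] reads it off on elementary matrices.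
    The four terms on the right are the four terms of [proj]. *)
Lemma casimir (M : 'M[R]_N) :
  \sum_i \sum_c (kappa * invmx h i c) *: (theta i *m M *m theta c)
  = 4^-1 *: ((\tr M)%:M - \tr (M *m S) *: S + (adj M - S *m adj M *m S)).
Proof.
have E x a b y : proj (delta_mx a x) b y
    = \sum_i \sum_c kappa * invmx h i c * (theta i x a * theta c b y).
  rewrite (tangent_expand (proj_tangent (delta_mx a x)) kappa_neq0).
  rewrite summxE exchange_big; apply: eq_bigr => c _ /=.
  rewrite mxE mulr_suml; apply: eq_bigr => i _.
  by rewrite trace_proj trace_delta; ring.
apply/matrixP => x y; rewrite summxE.
transitivity (\sum_a \sum_b M a b * proj (delta_mx a x) b y).
  transitivity (\sum_i \sum_c \sum_a \sum_b
      M a b * (kappa * invmx h i c * (theta i x a * theta c b y))).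
    apply: eq_bigr => i _; rewrite summxE; apply: eq_bigr => c _.
    rewrite !mxE mulr_sumr exchange_big; apply: eq_bigr => b _.
    rewrite mxE mulr_suml mulr_sumr; apply: eq_bigr => a _; ring.
  under eq_bigr do rewrite exchange_big /=; rewrite exchange_big.
  apply: eq_bigr => a _ /=.
  under eq_bigr do rewrite exchange_big /=; rewrite exchange_big.
  apply: eq_bigr => b _ /=; rewrite E mulr_sumr; apply: eq_bigr => i _.
  by rewrite mulr_sumr.
have e1 : \sum_a \sum_b M a b * ((b == a)%:R * (x == y)%:R) = (\tr M)%:M x y.
  rewrite mxE -[RHS]mulr_natr /mxtrace mulr_suml; apply: eq_bigr => a _.
  rewrite (bigD1 a) //= eqxx mul1r big1 ?addr0 // => b /negbTE ->.
  by rewrite mul0r mulr0.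
have e2 : \sum_a \sum_b M a b * (S b a * S x y) = (\tr (M *m S) *: S) x y.
  rewrite mxE /mxtrace mulr_suml; apply: eq_bigr => a _.
  by rewrite mxE mulr_suml; apply: eq_bigr => b _; ring.
have e3 (P Q : 'M[R]_N) : P^T = P -> \sum_a \sum_b M a b * (P b x * Q a y)
   = (P *m M^T *m Q) x y.
  move=> PT; rewrite mxE; apply: eq_bigr => a _; rewrite mxE mulr_suml.
  by apply: eq_bigr => b _; rewrite mxE -[in RHS]PT mxE; ring.
have entry (X Y Z T : 'M[R]_N) : (4^-1 *: (X - Y + (Z - T))) x y
    = 4^-1 * (X x y - Y x y + (Z x y - T x y)) by rewrite !mxE.
rewrite entry -e1 -e2 /adj -(e3 _ _ sym_B).
have -> : S *m (B *m M^T *m invmx B) *m S = S *m B *m M^T *m (invmx B *m S) by rewrite !mulmxA.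
rewrite -(e3 _ _ sym_SB) -!sumrB -big_split mulr_sumr; apply: eq_bigr => a _ /=.
rewrite -!sumrB -big_split mulr_sumr; apply: eq_bigr => b _ /=.
by rewrite proj_delta; ring.
Qed.

Lemma casimir_trace (X M : 'M[R]_N) :
  \sum_i \sum_c kappa * invmx h i c * \tr (X *m (theta i *m M *m theta c))
  = 4^-1 * (\tr M * \tr X - \tr (M *m S) * \tr (X *m S)
       + (\tr (X *m adj M) - \tr (X *m (S *m adj M *m S)))).
Proof.
transitivity (\tr (X *m \sum_i \sum_c (kappa * invmx h i c) *: (theta i *m M *m theta c))).
  rewrite mulmx_sumr raddf_sum; apply: eq_bigr => i _ /=.
  rewrite mulmx_sumr raddf_sum; apply: eq_bigr => c _ /=.
  by rewrite -scalemxAr mxtraceZ.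
rewrite casimir -scalemxAr mxtraceZ mulmxDr !mulmxBr !mxtraceD !raddfN /=.
by rewrite -scalemxAr mxtraceZ mul_mx_scalar mxtraceZ.
Qed.

(** Anticommutation with the involution [S] makes both traces equal to their opposites. *)
Lemma trace_theta c : \tr (theta c) = 0 /\ \tr (theta c *m S) = 0.
Proof.
have [t1 _] := theta_tangent c.
have E1 : \tr (theta c) = - \tr (theta c).
  by rewrite -{1}(trace_SZS (theta c)) t1 mulNmx -mulmxA SS mulmx1 raddfN.
have E2 : \tr (theta c *m S) = - \tr (theta c *m S).
  by rewrite {1}mxtrace_mulC t1 raddfN.
by split; lra.
Qed.

Variable K : 'I_m -> 'I_m -> 'I_m -> 'I_m -> R.
Hypothesis K_theta : forall i j k, \sum_l K l k i j *: theta l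
  = 4^-1 *: bracket (bracket (theta i) (theta j)) (theta k).

Let h_sym a b : h a b = h b a.
Proof. by rewrite !h_theta mxtrace_mulC. Qed.

(** The double bracket paired with [theta c] has four products. In two of them [theta i] and
    [theta c] are cyclically adjacent, and each contributes N/4 times the trace of
    [theta j *m theta k], up to terms in the trace of [S] that cancel because
    [theta j *m theta k *m S] changes sign in trace under exchange of [j] and [k]. The other two
    contribute -1/2 each. The prefactor 1/4 and the normalisation [kappa] give the constant. *)
Lemma trace_curvature j k : \sum_i K i k i j = (N%:R / 2 - 1) / (4 * kappa) * h j k.
Proof.
have hI a b : invmx h a b = invmx h b a.
  have hT : h^T = h by apply/matrixP => p q; rewrite mxE h_sym.
  by rewrite -{1}hT -trmx_inv mxE.
have KE l i : K l k i j = \sum_c kappa *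
   \tr (4^-1 *: bracket (bracket (theta i) (theta j)) (theta k) *m theta c) * invmx h c l.
  have <- : ((\row_a K a k i j) *m h *m invmx h) 0 l = K l k i j by rewrite mulmxK // mxE.
  rewrite mxE; apply: eq_bigr => c _; congr (_ * _).
  rewrite -K_theta -(sum_coord_metric _ _ h_theta) mxE.
  by apply: eq_bigr => a _; rewrite mxE.
have [tj tjS] := trace_theta j; have [tk tkS] := trace_theta k.
have [sj _] := theta_tangent j; have [sk _] := theta_tangent k.
have SkS : S *m theta k *m S = - theta k by rewrite sk mulNmx -mulmxA SS mulmx1.
have SjS : S *m theta j *m S = - theta j by rewrite sj mulNmx -mulmxA SS mulmx1.
transitivity (\sum_i \sum_c 4^-1 * (
    kappa * invmx h i c * \tr (1%:M *m (theta i *m (theta j *m theta k) *m theta c))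
  - kappa * invmx h i c * \tr (theta j *m (theta i *m theta k *m theta c))
  - kappa * invmx h i c * \tr (theta k *m (theta i *m theta j *m theta c))
  + kappa * invmx h i c * \tr (theta k *m theta j *m (theta i *m 1%:M *m theta c)))).
  apply: eq_bigr => i _; rewrite KE; apply: eq_bigr => c _.
  rewrite hI /bracket -scalemxAl mxtraceZ !(mulmxBl, mulmxBr) !mulmxA mul1mx mulmx1.
  rewrite !(mxtraceD, raddfB, raddfN) /=; ring.
have D (F1 F2 F3 F4 : 'I_m -> 'I_m -> R) :
  \sum_i \sum_c 4^-1 * (F1 i c - F2 i c - F3 i c + F4 i c)
  = 4^-1 * (\sum_i \sum_c F1 i c - \sum_i \sum_c F2 i c - \sum_i \sum_c F3 i c
     + \sum_i \sum_c F4 i c).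
  rewrite -!sumrB -big_split mulr_sumr; apply: eq_bigr => i _ /=.
  by rewrite -!sumrB -big_split mulr_sumr.
rewrite D !casimir_trace !adj_theta SkS SjS tj tk tjS tkS.
have a1 : adj 1%:M = 1%:M by rewrite /adj trmx1 mulmx1 mulmxV.
rewrite a1 !mul1mx !mulmx1 SS !mulmx1 trace_SZS mxtrace1.
rewrite !mulmxN !raddfN /= [\tr (theta k *m theta j)]mxtrace_mulC.
have -> : \tr (theta k *m theta j *m S) = - \tr (theta j *m theta k *m S).
  rewrite -[theta k *m theta j *m S]mulmxA [\tr (theta k *m _)]mxtrace_mulC.
  by rewrite -[theta j *m S *m _]mulmxA sk mulmxN raddfN /= mulmxA.
rewrite h_theta.
move: (\tr (theta j *m theta k)) (\tr (theta j *m theta k *m S)) (\tr S)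
  (\tr (adj _)) => p q r u.
by field.
Qed.

End TangentAlgebra.

Ltac mx_field := mx_abstract; apply/matrixP => ? ?; rewrite !mxE; by field.

(** * Planes in a flat bundle *)

Section FlatBundle.
Context {R : realType} {m N : nat}.
Variables (W : set 'rV[R]_m) (Om : 'I_m -> 'rV[R]_m -> 'M[R]_N).
Variables (B S : 'rV[R]_m -> 'M[R]_N).
Hypotheses (oW : open W) (smooth_Om : forall a, smooth_mx W (Om a)).
Hypothesis flat_Om : forall y i j, W y -> connection_curvature Om i j y = 0.
Hypotheses (smooth_B : smooth_mx W B) (smooth_S : smooth_mx W S).
Hypothesis parallel_B : forall y a, W y ->
  dmx a B y = Om a y *m B y + B y *m (Om a y)^T.
Hypothesis unit_B : forall y, W y -> B y \in unitmx.
Hypothesis sym_B : forall y, W y -> (B y)^T = B y.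
Hypothesis SS : forall y, W y -> S y *m S y = 1%:M.
Hypothesis sym_SB : forall y, W y -> (S y *m B y)^T = S y *m B y.

Local Notation theta a := (cov Om a S).

(* The connection preserving the eigenbundles of S that is obtained from the
   flat one by dropping its off-diagonal part. *)
Definition split_connection a y := Om a y - 2^-1 *: (S y *m cov Om a S y).
Local Notation omega := split_connection.

Lemma smooth_flat_theta a : smooth_mx W (theta a).
Proof. exact: smooth_cov. Qed.
Hint Resolve smooth_flat_theta : core.

Lemma smooth_split_connection a : smooth_mx W (omega a).
Proof.
apply: smooth_mxB => //; apply: smooth_mxZ => //; first exact: smooth_on_cst.
exact: smooth_mxM.
Qed.

Lemma cov_split a Y y :
  cov omega a Y y = cov Om a Y y + 2^-1 *: bracket (S y *m theta a y) (Y y).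
Proof.
rewrite /cov -addrA; congr (_ + _); rewrite /split_connection /bracket -/(cov Om a S y).
move: (cov Om a S y) => T; mx_expand; mx_ring.
Qed.

Lemma theta_anticommute a y : W y -> S y *m theta a y = - (theta a y *m S y).
Proof.
move=> Wy; apply/eqP; rewrite -addr_eq0 addrC; apply/eqP.
rewrite -(covM Om a smooth_S smooth_S Wy) (eq_cov Om oW a (Z := fun=> 1%:M) Wy).
  by rewrite /cov dmx_cst add0r /bracket mul1mx mulmx1 subrr.
by move=> z; rewrite inE; exact: SS.
Qed.

(** This fixes the factor 1/2 in [split_connection]: the bracket of [S *m theta a] with [S] is -2
    times [theta a]. *)
Lemma cov_split_S a y : W y -> cov omega a S y = 0.
Proof.
move=> Wy; have tS := theta_anticommute a Wy.
rewrite cov_split /bracket [S y *m (S y *m _)]mulmxA SS // mul1mx.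
rewrite tS mulNmx -mulmxA SS // mulmx1.
move: (theta a y) => T; mx_field.
Qed.

Lemma theta_swap a b y : W y -> cov Om a (theta b) y = cov Om b (theta a) y.
Proof.
move=> Wy; apply: subr0_eq.
by rewrite (cov_commutator oW smooth_Om a b smooth_S Wy) (flat_Om a b Wy) /bracket mulmx0 mul0mx subrr.
Qed.

(** Flatness makes the second covariant derivatives of [S] commute, and the correction, the bracket
    of [S *m theta a] with [theta b], is symmetric in [a], [b] because the [theta] anticommute with
    [S]. *)
Lemma split_torsion_free y a b : W y ->
  cov omega a (theta b) y = cov omega b (theta a) y.
Proof.
move=> Wy; rewrite !cov_split (theta_swap a b Wy); congr (_ + _ *: _); rewrite /bracket.
have ta := theta_anticommute a Wy; have tb := theta_anticommute b Wy.
rewrite [theta b y *m _]mulmxA [theta a y *m _]mulmxA.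
rewrite -[theta b y *m S y]opprK -tb -[theta a y *m S y]opprK -ta.
by rewrite !mulNmx !opprK addrC.
Qed.

(** The Gauss equation of the splitting. The flat curvature drops out and the second derivatives of
    [S] cancel by symmetry; the terms linear in the correction contribute -1/2 of the bracket and
    the quadratic ones +1/4. *)
Lemma split_curvature y i j : W y ->
  connection_curvature omega i j y = - 4^-1 *: bracket (theta i y) (theta j y).
Proof.
move=> Wy.
have dO a := smooth_mx_diff (smooth_Om a) Wy.
have sX a : smooth_mx W (fun z => S z *m theta a z) by exact: smooth_mxM.
have dom a b : dmx a (omega b) y = dmx a (Om b) y - 2^-1 *: dmx a (fun z => S z *m theta b z) y.
  rewrite /split_connection dmxB //; last first.
    apply: smooth_mx_diff Wy; apply: smooth_mxZ => //; exact: smooth_on_cst.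
  rewrite dmxZ; last 2 first.
  - exact: differentiable_cst.
  - exact: smooth_mx_diff (sX b) Wy.
  by rewrite partial_cst scale0r add0r.
have dX a b : dmx a (fun z => S z *m theta b z) y =
   theta a y *m theta b y + S y *m cov Om a (theta b) y
    - bracket (S y *m theta b y) (Om a y).
  by rewrite -(covM Om a smooth_S (smooth_flat_theta b) Wy) /cov addrK.
have E := theta_swap i j Wy.
have := flat_Om i j Wy; rewrite /connection_curvature => F0.
rewrite !dom !dX E /omega.
have ti := theta_anticommute i Wy; have tj := theta_anticommute j Wy.
have Sij : S y *m theta i y *m (S y *m theta j y) = - (theta i y *m theta j y).
  by rewrite ti mulNmx -!mulmxA [S y *m (S y *m _)]mulmxA SS // mul1mx.
have Sji : S y *m theta j y *m (S y *m theta i y) = - (theta j y *m theta i y).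
  by rewrite tj mulNmx -!mulmxA [S y *m (S y *m _)]mulmxA SS // mul1mx.
rewrite -[RHS]add0r -F0 /bracket.
move: (S y *m theta i y) (S y *m theta j y) Sij Sji.
move: (theta i y) (theta j y) (Om i y) (Om j y) (dmx i (Om j) y) (dmx j (Om i) y)
  (S y *m cov Om j (theta i) y) => Ti Tj Oi Oj Dij Dji Z Xi Xj Sij Sji.
mx_expand; rewrite Sij Sji; mx_field.
Qed.

Lemma cov_symmetric (O : 'I_m -> 'rV[R]_m -> 'M[R]_N) (Y : 'rV[R]_m -> 'M[R]_N) a y :
  (dmx a B y = O a y *m B y + B y *m (O a y)^T) -> smooth_mx W Y ->
  (forall z, W z -> (Y z *m B z)^T = Y z *m B z) -> W y ->
  (cov O a Y y *m B y)^T = cov O a Y y *m B y.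
Proof.
move=> dB sY YB Wy.
have dYB : (dmx a (fun z => Y z *m B z) y)^T = dmx a (fun z => Y z *m B z) y.
  by rewrite -dmx_tr; apply: (eq_dmx a oW Wy) => z; rewrite inE; exact: YB.
have E : cov O a Y y *m B y = dmx a (fun z => Y z *m B z) y
    - (Y y *m B y *m (O a y)^T + O a y *m (Y y *m B y)).
  rewrite (dmxM a (smooth_mx_diff sY Wy) (smooth_mx_diff smooth_B Wy)).
  rewrite dB /cov /bracket; mx_expand; mx_ring.
rewrite E trmxD trmxN dYB trmxD trmx_mul trmxK [(O a y *m _)^T]trmx_mul YB //.
by rewrite [X in _ - X]addrC.
Qed.

Lemma theta_is_tangent a y : W y -> is_tangent (S y) (B y) (theta a y).
Proof.
move=> Wy; split; first exact: theta_anticommute.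
by apply: cov_symmetric => //; exact: parallel_B.
Qed.

Lemma parallel_split a y : W y ->
  dmx a B y = omega a y *m B y + B y *m (omega a y)^T.
Proof.
move=> Wy; rewrite parallel_B // /split_connection.
have [t1 t2] := theta_is_tangent a Wy.
have E : B y *m (S y *m theta a y)^T = - (S y *m theta a y *m B y).
  have BS : B y *m (S y)^T = S y *m B y by rewrite -{1}(sym_B Wy) -trmx_mul sym_SB.
  have BT : B y *m (theta a y)^T = theta a y *m B y by rewrite -{1}(sym_B Wy) -trmx_mul t2.
  by rewrite trmx_mul mulmxA BT -mulmxA BS mulmxA t1 mulNmx opprK.
move: (S y *m theta a y) E => X E.
have -> : (Om a y - 2^-1 *: X)^T = (Om a y)^T - 2^-1 *: X^T by rewrite trmxD trmxN trmxZ.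
rewrite mulmxBr mulmxBl -scalemxAr -scalemxAl E; mx_ring.
Qed.

Lemma cov_theta_is_tangent a b y : W y ->
  is_tangent (S y) (B y) (cov omega a (theta b) y).
Proof.
move=> Wy; split.
  have sTS : smooth_mx W (fun z => theta b z *m S z) by exact: smooth_mxM.
  apply/eqP; rewrite -addr_eq0; apply/eqP.
  transitivity (cov omega a (fun z => S z *m theta b z + theta b z *m S z) y).
    rewrite (covD omega a (smooth_mxM oW smooth_S (smooth_flat_theta b)) sTS Wy).
    rewrite (covM omega a smooth_S (smooth_flat_theta b) Wy).
    rewrite (covM omega a (smooth_flat_theta b) smooth_S Wy).
    by rewrite cov_split_S // mul0mx mulmx0 add0r addr0.
  rewrite (eq_cov omega oW a (Z := fun=> 0) Wy) ?cov_cst0 // => z; rewrite inE => Wz.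
  by rewrite theta_anticommute // addNr.
apply: cov_symmetric => //; first exact: parallel_split.
by move=> z Wz; case: (theta_is_tangent b Wz).
Qed.

Variables (h : 'rV[R]_m -> 'M[R]_m) (kappa : R).
Hypotheses (kappa_neq0 : kappa != 0) (smooth_h : smooth_mx W h).
Hypothesis unit_h : forall y, W y -> h y \in unitmx.
Hypothesis h_theta : forall y a b, W y -> h y a b = kappa * \tr (theta a y *m theta b y).
Hypothesis theta_nondegenerate : forall y Y, W y -> is_tangent (S y) (B y) Y ->
  (forall c, \tr (Y *m theta c y) = 0) -> Y = 0.

(** The split connection preserves both [S] and [B], hence the tangent condition, and every tangent
    matrix is a combination of the [theta c]. *)
Lemma split_span y a b : W y ->
  exists C : 'I_m -> R, cov omega a (theta b) y = \sum_c C c *: theta c y.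
Proof.
move=> Wy; have := @tangent_expand _ _ _ (fun a => theta a y) (h y) kappa (S y) (B y)
  (unit_h Wy) (fun a b => h_theta a b Wy) (fun a => theta_is_tangent a Wy)
  (fun Y => theta_nondegenerate Wy (Y := Y)) _ (cov_theta_is_tangent a b Wy) kappa_neq0.
by move=> E; eexists; exact: E.
Qed.

Lemma flat_locally_symmetric y s l k i j : W y -> nabla_curvature h s l k i j y = 0.
Proof.
exact: (frame_locally_symmetric oW smooth_h unit_h smooth_split_connection
  smooth_flat_theta h_theta split_torsion_free split_span split_curvature s l k i j).
Qed.

Lemma flat_einstein y j k : W y -> ricci h j k y = (N%:R / 2 - 1) / (4 * kappa) * h y j k.
Proof.
move=> Wy.
have K_theta i' j' k' := curvature_frame oW smooth_h unit_h smooth_split_connection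
  smooth_flat_theta h_theta split_torsion_free split_span split_curvature i' j' k' Wy.
exact: (@trace_curvature _ _ _ (fun a => theta a y) (h y) kappa (S y) (B y)
  (unit_h Wy) (fun a b => h_theta a b Wy) (SS Wy) (unit_B Wy) (sym_B Wy) (sym_SB Wy)
  (fun a => theta_is_tangent a Wy) (fun Y => theta_nondegenerate Wy (Y := Y)) kappa_neq0
  (fun l k i j => curvature h l k i j y) K_theta j k).
Qed.

Section ComplexStructure.
Variables (J : 'rV[R]_m -> 'M[R]_m) (jj : 'rV[R]_m -> 'M[R]_N).
Hypotheses (smooth_J : smooth_mx W J) (smooth_jj : smooth_mx W jj).
Hypothesis J_theta : forall y a, W y ->
  \sum_b J y a b *: theta b y = bracket (jj y) (theta a y).
Hypothesis cov_jj : forall y a, W y ->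
  cov Om a jj y = - 2^-1 *: bracket (S y *m theta a y) (jj y).

(** The hypothesis [cov_jj] is parallelism for the split connection, stated with the flat one
    because this is the form that can be computed from a frame of the plane. *)
Let cov_split_jj y a : W y -> cov omega a jj y = 0.
Proof. by move=> Wy; rewrite cov_split cov_jj // -scalerDl addNr scale0r. Qed.

Lemma flat_integrable y k i j : W y -> nijenhuis J k i j y = 0.
Proof.
exact: (fun Wy => frame_integrable oW unit_h smooth_flat_theta h_theta split_torsion_free split_span smooth_J smooth_jj J_theta cov_split_jj k i j Wy).
Qed.

Lemma flat_fundamental_form_closed y a b k :
  (forall y, W y -> h y *m (J y)^T = - (h y *m (J y)^T)^T) -> W y ->
  d_form2 (fundamental_form h J) a b k y = 0.
Proof.
move=> J_skew.
exact: (frame_fundamental_form_closed oW smooth_h unit_h smooth_flat_theta h_theta split_torsion_free split_span smooth_J smooth_jj J_theta cov_split_jj J_skew a b k).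
Qed.

End ComplexStructure.

End FlatBundle.

(** * Reflections in planes with a conformal frame *)

Section PlaneBundle.
Context {R : realType} {m N : nat}.
Variables (W : set 'rV[R]_m) (Om : 'I_m -> 'rV[R]_m -> 'M[R]_N).
Variables (B : 'rV[R]_m -> 'M[R]_N) (U : 'rV[R]_m -> 'M[R]_(1 + 1, N)) (t : 'rV[R]_m -> R).
Variables (V : 'I_m -> 'rV[R]_m -> 'M[R]_(1 + 1, N)) (rho : 'I_m -> 'rV[R]_m -> R).
Hypotheses (oW : open W) (smooth_Om : forall a, smooth_mx W (Om a)).
Hypothesis flat_Om : forall y i j, W y -> connection_curvature Om i j y = 0.
Hypotheses (smooth_B : smooth_mx W B) (smooth_U : smooth_mx W U) (smooth_t : smooth_on W t).
Hypothesis parallel_B : forall y a, W y ->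
  dmx a B y = Om a y *m B y + B y *m (Om a y)^T.
Hypothesis unit_B : forall y, W y -> B y \in unitmx.
Hypothesis sym_B : forall y, W y -> (B y)^T = B y.
Hypothesis t_neq0 : forall y, W y -> t y != 0.
Hypothesis gram_U : forall y, W y -> U y *m B y *m (U y)^T = (2 * t y)%:M.

Definition rot : 'M[R]_(1 + 1) := block_mx 0 1%:M (- 1%:M) 0.

Lemma tr_rot : rot^T = - rot.
Proof. by rewrite tr_block_mx opp_block_mx !trmx0 trmxN trmx1 !oppr0 opprK. Qed.

Lemma rot_rot : rot *m rot = - 1%:M.
Proof.
rewrite mulmx_block !(mul0mx, mulmx0, mul1mx, mulmx1, addr0, add0r).
by rewrite scalar_mx_block opp_block_mx oppr0.
Qed.

Hypothesis dU : forall y a, W y -> dmx a U y + U y *m Om a y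
  = V a y + (partial a t y / (2 * t y)) *: U y + rho a y *: (rot *m U y).
Hypothesis V_orth : forall y a, W y -> V a y *m B y *m (U y)^T = 0.

(** Since the Gram matrix of [U] is 2t times the identity, [(2 * t y)^-1 *: (B U^T U)] is the
    orthogonal projection onto the plane. [S] is twice this projection minus the identity, and [jj]
    is the quarter turn of the plane, extended by zero to the orthogonal complement. *)
Let S y := (t y)^-1 *: (B y *m (U y)^T *m U y) - 1%:M.
Let jj y := (2 * t y)^-1 *: (B y *m (U y)^T *m (rot *m U y)).
Local Notation theta a := (cov Om a S).

Let BT y p q (X : 'M[R]_(p, N)) (Z : 'M[R]_(q, N)) : W y ->
  (X *m B y *m Z^T)^T = Z *m B y *m X^T.
Proof. by move=> Wy; rewrite !trmx_mul trmxK sym_B // mulmxA. Qed.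

Let V_orth' y a : W y -> U y *m B y *m (V a y)^T = 0.
Proof. by move=> Wy; rewrite -BT // V_orth // trmx0. Qed.

Let smooth_BUU : smooth_mx W (fun y => B y *m (U y)^T *m U y).
Proof. by apply: smooth_mxM => //; apply: smooth_mxM => //; exact: smooth_mx_tr. Qed.

Let smooth_tI : smooth_on W (fun y => (t y)^-1).
Proof. exact: smooth_onV. Qed.

Let smooth_S : smooth_mx W S.
Proof. by apply: smooth_mxB => //; [apply: smooth_mxZ | exact: smooth_mx_cst]. Qed.

Let smooth_2tI : smooth_on W (fun y => (2 * t y)^-1).
Proof.
apply: smooth_onV => // [|y Wy].
  by apply: smooth_onM => //; exact: smooth_on_cst.
by rewrite mulf_neq0 ?t_neq0 // pnatr_eq0.
Qed.

Let smooth_rotU : smooth_mx W (fun y => rot *m U y).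
Proof. by apply: smooth_mxM => //; exact: smooth_mx_cst. Qed.

Let smooth_BUrU : smooth_mx W (fun y => B y *m (U y)^T *m (rot *m U y)).
Proof. by apply: smooth_mxM => //; apply: smooth_mxM => //; exact: smooth_mx_tr. Qed.

Let smooth_jj : smooth_mx W jj.
Proof. exact: smooth_mxZ. Qed.

Let cov_outer (P Q : 'rV[R]_m -> 'M[R]_(1 + 1, N)) a y :
  smooth_mx W P -> smooth_mx W Q -> W y ->
  cov Om a (fun z => B z *m (P z)^T *m Q z) y
  = B y *m (dmx a P y + P y *m Om a y)^T *m Q y
    + B y *m (P y)^T *m (dmx a Q y + Q y *m Om a y).
Proof.
move=> sP sQ Wy.
have dB := smooth_mx_diff smooth_B Wy.
have dP := smooth_mx_diff (smooth_mx_tr sP) Wy.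
have dQ := smooth_mx_diff sQ Wy.
rewrite /cov (dmxM a (differentiable_mxM dB dP) dQ) (dmxM a dB dP) dmx_tr parallel_B //.
rewrite /bracket trmxD trmx_mul; mx_expand; mx_ring.
Qed.

Let gramK y p (X : 'M[R]_(p, 1 + 1)) : W y ->
  X *m U y *m B y *m (U y)^T = (2 * t y) *: X.
Proof. by move=> Wy; rewrite -!mulmxA [U y *m _]mulmxA gram_U // mul_mx_scalar. Qed.

Let VUK y a p (X : 'M[R]_(p, 1 + 1)) : W y -> X *m V a y *m B y *m (U y)^T = 0.
Proof. by move=> Wy; rewrite -!mulmxA [V a y *m _]mulmxA V_orth // mulmx0. Qed.

Let UVK y a p (X : 'M[R]_(p, 1 + 1)) : W y -> X *m U y *m B y *m (V a y)^T = 0.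
Proof. by move=> Wy; rewrite -!mulmxA [U y *m _]mulmxA V_orth' // mulmx0. Qed.

Let rotK p (X : 'M[R]_(p, 1 + 1)) : X *m rot *m rot = - X.
Proof. by rewrite -mulmxA rot_rot mulmxN mulmx1. Qed.

Let SS y : W y -> S y *m S y = 1%:M.
Proof.
move=> Wy; have E : B y *m (U y)^T *m U y *m (B y *m (U y)^T *m U y)
    = (2 * t y) *: (B y *m (U y)^T *m U y).
  by rewrite !mulmxA gramK // -scalemxAl.
rewrite /S mulmxBl !mulmxBr -!scalemxAl -!scalemxAr E !mul1mx !mulmx1 !scalerA.
have t0 := t_neq0 Wy; move: (B y *m (U y)^T *m U y) => X; mx_field.
Qed.

Let sym_SB y : W y -> (S y *m B y)^T = S y *m B y.
Proof.
move=> Wy; rewrite /S mulmxBl mul1mx -scalemxAl trmxD trmxN trmxZ sym_B //.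
by rewrite !trmx_mul trmxK sym_B // !mulmxA.
Qed.

(** Only the normal part [V] of the derivative of the frame survives: the conformal part is absorbed
    by the derivative of 1/t, and the [rho] part cancels because [rot] is skew. *)
Let thetaE a y : W y ->
  theta a y = (t y)^-1 *: (B y *m (V a y)^T *m U y + B y *m (U y)^T *m V a y).
Proof.
move=> Wy.
have -> : theta a y = cov Om a (fun z => (t z)^-1 *: (B z *m (U z)^T *m U z)) y.
  rewrite /S (covB Om a _ (smooth_mx_cst oW 1%:M) Wy); last exact: smooth_mxZ.
  by rewrite {2}/cov dmx_cst /bracket mul1mx mulmx1 subrr addr0 subr0.
rewrite (covZ Om a smooth_tI smooth_BUU Wy) cov_outer // dU //.
rewrite partialV ?t_neq0 //; last exact: smooth_on_diff smooth_t Wy.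
have t0 := t_neq0 Wy.
rewrite !trmxD !trmxZ trmx_mul tr_rot; mx_expand.
rewrite !(mulmxN, mulNmx) ?mulmxA; mx_abstract; apply/matrixP => i j; rewrite !mxE.
by field.
Qed.

(** A change of conformal frame leaves [jj] fixed, as [rot] commutes with itself and the scale is
    divided out. The remaining normal terms are the off-diagonal rotation generated by
    [S *m theta a]. *)
Let jj_cov a y : W y -> cov Om a jj y = - 2^-1 *: bracket (S y *m theta a y) (jj y).
Proof.
move=> Wy; have t0 := t_neq0 Wy.
rewrite (covZ Om a smooth_2tI smooth_BUrU Wy) cov_outer //.
have -> : dmx a (fun z => rot *m U z) y + rot *m U y *m Om a y
   = rot *m (dmx a U y + U y *m Om a y).
  rewrite (dmxM a _ (smooth_mx_diff smooth_U Wy)); last first.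
    exact: smooth_mx_diff (smooth_mx_cst oW rot) Wy.
  by rewrite dmx_cst mul0mx add0r mulmxDr mulmxA.
rewrite dU // partialV ?mulf_neq0 ?pnatr_eq0 //; last first.
  apply: smooth_on_diff Wy; apply: smooth_onM => //; exact: smooth_on_cst.
rewrite partialZ; last exact: smooth_on_diff smooth_t Wy.
have SE : S y *m theta a y = (t y)^-1 *: (B y *m (U y)^T *m V a y - B y *m (V a y)^T *m U y).
  rewrite thetaE // /S mulmxBl mul1mx -scalemxAl -scalemxAr mulmxDr !mulmxA gramK // UVK //.
  rewrite mul0mx add0r -!scalemxAl !scalerA; mx_field.
have E2 : S y *m theta a y *m jj y = - (t y)^-1 *: (B y *m (V a y)^T *m rot *m U y).
  rewrite SE /jj -scalemxAl -scalemxAr mulmxBl !mulmxA VUK // gramK // !mul0mx sub0r.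
  rewrite -!scalemxAl !scalerN !scalerA scaleNr; congr (- (_ *: _)).
  by field.
have E3 : jj y *m (S y *m theta a y) = (t y)^-1 *: (B y *m (U y)^T *m rot *m V a y).
  rewrite SE /jj -scalemxAl -scalemxAr mulmxBr !mulmxA gramK // UVK // !mul0mx subr0.
  rewrite -!scalemxAl !scalerA; congr (_ *: _).
  by field.
rewrite /bracket E2 E3 !trmxD !trmxZ trmx_mul tr_rot; mx_expand.
rewrite !(mulmxN, mulNmx) ?mulmxA !rotK ?(mulmxN, mulNmx); mx_abstract; apply/matrixP => i j; rewrite !mxE.
by field.
Qed.

Variables (h : 'rV[R]_m -> 'M[R]_m) (A : R).
Hypotheses (A_neq0 : A != 0) (smooth_h : smooth_mx W h).
Hypothesis unit_h : forall y, W y -> h y \in unitmx.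
Hypothesis h_V : forall y a b, W y ->
  h y a b = (A * t y)^-1 * \tr (V a y *m B y *m (V b y)^T).
Hypothesis V_nondegenerate : forall y (Z : 'M[R]_(1 + 1, N)), W y ->
  Z *m B y *m (U y)^T = 0 -> (forall c, \tr (Z *m B y *m (V c y)^T) = 0) -> Z = 0.

Let k0 : (4 * A)^-1 != 0.
Proof. by rewrite invr_eq0 mulf_neq0 ?pnatr_eq0. Qed.

(** The origin of kappa = 1/(4A): two cross terms, each with a Gram factor 2t and the prefactor
    t^-2, give 4/t times the trace of V B V^T, and [h] is that trace divided by A t. *)
Let h_theta y a b : W y -> h y a b = (4 * A)^-1 * \tr (theta a y *m theta b y).
Proof.
move=> Wy; have t0 := t_neq0 Wy; rewrite h_V // !thetaE //.
rewrite -scalemxAl -scalemxAr !mxtraceZ mulmxDl !mulmxDr !mxtraceD !mulmxA.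
rewrite !UVK // VUK // gramK // !mul0mx mxtrace0 add0r addr0 -scalemxAl mxtraceZ.
have -> : \tr (B y *m (V a y)^T *m V b y) = \tr (V a y *m B y *m (V b y)^T).
  by rewrite mxtrace_mulC mulmxA -mxtrace_tr BT.
have -> : \tr (B y *m (U y)^T *m V a y *m B y *m (V b y)^T *m U y)
    = (2 * t y) * \tr (V a y *m B y *m (V b y)^T).
  rewrite mxtrace_mulC !mulmxA gram_U // -!mulmxA mul_scalar_mx mxtraceZ !mulmxA.
  by [].
by field; rewrite t0 A_neq0.
Qed.

(** A tangent matrix maps the plane to its complement and conversely, and being self-adjoint it is
    determined by the block [U y *m Y]. That block is orthogonal to the plane, so [V_nondegenerate]
    applies to it. *)
Let theta_nondegenerate y Y : W y -> is_tangent (S y) (B y) Y ->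
  (forall c, \tr (Y *m theta c y) = 0) -> Y = 0.
Proof.
move=> Wy [Y1 Y2] Y3; have t0 := t_neq0 Wy.
have E : (2 * t y) *: Y = B y *m (U y)^T *m U y *m Y + Y *m B y *m (U y)^T *m U y.
  move: Y1; rewrite /S mulmxBl mulmxBr mul1mx mulmx1 -scalemxAl -scalemxAr => /eqP.
  rewrite -subr_eq0 opprK => /eqP Y1.
  have := congr1 (fun X : 'M[R]_N => t y *: X) Y1.
  rewrite /= scaler0 !scalerDr !scalerA mulfV // !scale1r !mulmxA => Y1'.
  apply/eqP; rewrite -subr_eq0 -[X in _ == X]oppr0 -Y1'; apply/eqP.
  mx_ring.
(* Compressing to the plane gives a quantity equal to twice itself: the diagonal block of a matrix
   anticommuting with [S] vanishes. *)
have Z0 : U y *m Y *m B y *m (U y)^T = 0.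
  have := congr1 (fun X => U y *m X *m B y *m (U y)^T) E.
  rewrite /= mulmxDr !mulmxDl -scalemxAr -!scalemxAl !mulmxA gramK // gram_U //.
  rewrite mul_scalar_mx -!scalemxAl => /eqP.
  rewrite -subr_eq0 opprD addrA subrr sub0r oppr_eq0 scaler_eq0 mulf_eq0 pnatr_eq0 /=.
  by rewrite (negbTE t0) => /eqP.
have BY : B y *m Y^T = Y *m B y by rewrite -{1}(sym_B Wy) -trmx_mul Y2.
have YE : (2 * t y) *: Y = B y *m (U y)^T *m (U y *m Y) + B y *m (U y *m Y)^T *m U y.
  rewrite {1}E mulmxA; congr (_ + _ *m _).
  by rewrite trmx_mul mulmxA BY.
have Z1 : U y *m Y = 0.
  apply: (V_nondegenerate Wy Z0) => c; have := Y3 c.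
  rewrite thetaE // -scalemxAr mxtraceZ mulmxDr mxtraceD !mulmxA => /eqP.
  rewrite mulf_eq0 invr_eq0 (negbTE t0) /= => /eqP.
  have -> : \tr (Y *m B y *m (V c y)^T *m U y) = \tr (U y *m Y *m B y *m (V c y)^T).
    by rewrite mxtrace_mulC !mulmxA.
  have -> : \tr (Y *m B y *m (U y)^T *m V c y) = \tr (U y *m Y *m B y *m (V c y)^T).
    rewrite -[RHS]mxtrace_tr BT // trmx_mul mulmxA -[V c y *m B y *m _]mulmxA BY.
    by rewrite [LHS]mxtrace_mulC !mulmxA.
  move=> H; lra.
have : (2 * t y) *: Y == 0 by rewrite YE Z1 trmx0 !mulmx0 mul0mx addr0.
by rewrite scaler_eq0 mulf_eq0 pnatr_eq0 /= (negbTE t0) => /eqP.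
Qed.

Lemma plane_locally_symmetric y s l k i j : W y -> nabla_curvature h s l k i j y = 0.
Proof.
exact: (fun Wy => flat_locally_symmetric oW smooth_Om flat_Om smooth_B smooth_S parallel_B sym_B SS sym_SB
  k0 smooth_h unit_h h_theta theta_nondegenerate s l k i j Wy).
Qed.

Lemma plane_einstein y j k : W y -> ricci h j k y = A * (N%:R / 2 - 1) * h y j k.
Proof.
move=> Wy.
rewrite (flat_einstein oW smooth_Om flat_Om smooth_B smooth_S parallel_B unit_B sym_B SS sym_SB
  k0 smooth_h unit_h h_theta theta_nondegenerate j k Wy).
by congr (_ * _); field.
Qed.

Variable J : 'rV[R]_m -> 'M[R]_m.
Hypothesis smooth_J : smooth_mx W J.
Hypothesis J_V : forall y a, W y -> \sum_b J y a b *: V b y = rot *m V a y.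

(** The bracket with [jj] acts on the plane side of each of the two summands of [theta a], by a
    quarter turn; moved across the product, it becomes [rot] applied to [V]. *)
Let J_theta y a : W y -> \sum_b J y a b *: theta b y = bracket (jj y) (theta a y).
Proof.
move=> Wy; have t0 := t_neq0 Wy.
transitivity ((t y)^-1 *: (B y *m (rot *m V a y)^T *m U y + B y *m (U y)^T *m (rot *m V a y))).
  rewrite -J_V // linear_sum /= mulmx_sumr mulmx_suml mulmx_sumr -big_split scaler_sumr.
  apply: eq_bigr => b _; rewrite thetaE // scalerA mulrC -scalerA; congr (_ *: _).
  by rewrite /= trmxZ -!scalemxAr -scalemxAl scalerDr.
rewrite thetaE // /bracket /jj -!scalemxAl -!scalemxAr mulmxDr mulmxDl !mulmxA.
rewrite !gramK // !UVK // VUK // trmx_mul tr_rot !mulmxA !mul0mx -!scalemxAl add0r addr0.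
rewrite !scalerA mulmxN mulNmx; mx_abstract; apply/matrixP => i j; rewrite !mxE.
by field.
Qed.

Lemma plane_integrable y k i j : W y -> nijenhuis J k i j y = 0.
Proof.
exact: (fun Wy => flat_integrable oW smooth_Om flat_Om smooth_B smooth_S parallel_B sym_B SS sym_SB
  k0 unit_h h_theta theta_nondegenerate smooth_J smooth_jj J_theta
  (fun y a Wy => jj_cov a Wy) k i j Wy).
Qed.

Lemma plane_fundamental_form_closed y a b k :
  (forall y, W y -> h y *m (J y)^T = - (h y *m (J y)^T)^T) -> W y ->
  d_form2 (fundamental_form h J) a b k y = 0.
Proof.
exact: (fun J_skew Wy => flat_fundamental_form_closed oW smooth_Om flat_Om smooth_B smooth_S
  parallel_B sym_B SS sym_SB
  k0 smooth_h unit_h h_theta theta_nondegenerate smooth_J smooth_jj J_theta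
  (fun y a Wy => jj_cov a Wy) a b k J_skew Wy).
Qed.

End PlaneBundle.

(** * The tube in a chart *)

Section TubeAlgebra.
Context {R : realType} {n : nat}.
Variables (g : 'M[R]_n) (p : 'rV[R]_n) (c A t : R).
Hypotheses (unit_g : g \in unitmx) (sym_g : g^T = g).
Hypotheses (c_gt0 : 0 < c) (A_gt0 : 0 < A) (t_gt0 : 0 < t) (tA : 0 < 2 * c - A ^+ 2 * t).

Definition dot (v w : 'rV[R]_n) : R := (v *m w^T) 0 0.

Lemma dotE v w : v *m w^T = (dot v w)%:M.
Proof. by rewrite -mx11_scalar. Qed.

Lemma dotC v w : dot v w = dot w v.
Proof. by rewrite /dot -[v in LHS]trmxK -trmx_mul mxE. Qed.

Lemma dotDl u v w : dot (u + v) w = dot u w + dot v w.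
Proof. by rewrite /dot mulmxDl mxE. Qed.

Lemma dotNl v w : dot (- v) w = - dot v w.
Proof. by rewrite /dot mulNmx mxE. Qed.

Lemma dotZl a v w : dot (a *: v) w = a * dot v w.
Proof. by rewrite /dot -scalemxAl mxE. Qed.

Lemma dotDr u v w : dot u (v + w) = dot u v + dot u w.
Proof. by rewrite dotC dotDl !(dotC u). Qed.

Lemma dotNr v w : dot v (- w) = - dot v w.
Proof. by rewrite dotC dotNl (dotC v). Qed.

Lemma dotZr a v w : dot v (a *: w) = a * dot v w.
Proof. by rewrite dotC dotZl (dotC v). Qed.

Lemma dot0l v : dot 0 v = 0.
Proof. by rewrite /dot mul0mx mxE. Qed.

Lemma dot0r v : dot v 0 = 0.
Proof. by rewrite dotC dot0l. Qed.

Lemma dot_mulmx v w (M : 'M[R]_n) : dot (v *m M) w = dot v (w *m M^T).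
Proof. by rewrite /dot trmx_mul trmxK mulmxA. Qed.

Lemma dot_delta v a : dot v (delta_mx 0 a) = v 0 a.
Proof. by rewrite /dot trmx_delta -colE mxE. Qed.

Lemma dot_eq0 v : (forall w, dot v w = 0) -> v = 0.
Proof. by move=> v0; apply/rowP => a; rewrite -dot_delta v0 mxE. Qed.

Let t0 : t != 0. Proof. by rewrite gt_eqF. Qed.
Let c0 : c != 0. Proof. by rewrite gt_eqF. Qed.
Let A0 : A != 0. Proof. by rewrite gt_eqF. Qed.
Let d0 : 2 * c - A ^+ 2 * t != 0. Proof. by rewrite gt_eqF. Qed.

Let gI := invmx g.
Let pu := p *m gI.

Hypothesis t_def : t = dot pu p / 2.

Let sym_gI : gI^T = gI.
Proof. by rewrite /gI trmx_inv sym_g. Qed.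

Let pu_p : dot pu p = 2 * t.
Proof. by rewrite t_def; field. Qed.

Let puG : pu *m g = p.
Proof. by rewrite /pu mulmxKV. Qed.

(* Vectors of TM + R + R, in the frame consisting of a coordinate frame of TM
   and one generator of each of the trivial summands. *)
Definition triple (v : 'rV[R]_n) (s r : R) : 'rV[R]_(n + 1 + 1) :=
  row_mx (row_mx v s%:M) r%:M.

Lemma tripleD v s r v' s' r' :
  triple v s r + triple v' s' r' = triple (v + v') (s + s') (r + r').
Proof. by rewrite /triple !add_row_mx -!raddfD. Qed.

Lemma tripleZ a v s r : a *: triple v s r = triple (a *: v) (a * s) (a * r).
Proof. by rewrite /triple !scale_row_mx !scale_scalar_mx. Qed.

Lemma tripleN v s r : - triple v s r = triple (- v) (- s) (- r).
Proof. by rewrite -scaleN1r tripleZ !mulN1r scaleN1r. Qed.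

Lemma triple_split (x : 'rV[R]_(n + 1 + 1)) : exists v s r, x = triple v s r.
Proof.
exists (lsubmx (lsubmx x)), (rsubmx (lsubmx x) 0 0), (rsubmx x 0 0).
by rewrite /triple -!mx11_scalar !hsubmxK.
Qed.

(** The solution of A^2 t^2 / c + psi = 2t, which gives the second frame vector the square length 2t
    of p^#. *)
Let psi := 2 * t - A ^+ 2 * t ^+ 2 / c.

Definition model_metric : 'M[R]_(n + 1 + 1) :=
  block_mx (block_mx g 0 0 c^-1%:M) 0 0 psi%:M.

Lemma triple_metric v s r v' s' r' :
  triple v s r *m model_metric *m (triple v' s' r')^T
  = (dot (v *m g) v' + s * s' / c + psi * r * r')%:M.
Proof.
rewrite /triple /model_metric !tr_row_mx !mul_row_block !mulmx0 !add0r !addr0.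
rewrite mul_row_col mul_row_col dotE !tr_scalar_mx -!scalar_mxM -!raddfD /=.
by congr (_%:M); field; rewrite gt_eqF.
Qed.

Lemma psiE : psi = t * (2 * c - A ^+ 2 * t) / c.
Proof. by rewrite /psi; field; rewrite gt_eqF. Qed.

Lemma psi_gt0 : 0 < psi.
Proof. by rewrite psiE divr_gt0 // mulr_gt0. Qed.

Definition plane : 'M[R]_(1 + 1, n + 1 + 1) :=
  col_mx (triple pu 0 0) (triple 0 (A * t) 1).

Lemma model_metric_sym : model_metric^T = model_metric.
Proof. by rewrite !tr_block_mx !trmx0 !tr_scalar_mx sym_g. Qed.

Lemma model_metric_unit : model_metric \in unitmx.
Proof.
rewrite unitmxE det_ublock det_ublock !det_scalar1 unitrM unitrM -unitmxE unit_g /=.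
by rewrite !unitfE invr_eq0 !gt_eqF // psi_gt0.
Qed.

Let dot_pug v : dot (pu *m g) v = dot v p.
Proof. by rewrite puG dotC. Qed.

Lemma col_metric (a b a' b' : 'rV[R]_(n + 1 + 1)) :
  col_mx a b *m model_metric *m (col_mx a' b')^T
  = block_mx (a *m model_metric *m a'^T) (a *m model_metric *m b'^T)
      (b *m model_metric *m a'^T) (b *m model_metric *m b'^T).
Proof. by rewrite tr_col_mx !mul_col_mx !mul_mx_row -block_mxEv. Qed.

Lemma plane_gram : plane *m model_metric *m plane^T = (2 * t)%:M.
Proof.
rewrite /plane col_metric !triple_metric !mul0mx dot0r !dot0l puG dotC pu_p.
rewrite !(mulr0, mul0r, add0r, addr0) [RHS]scalar_mx_block.
by congr block_mx; rewrite ?raddf0 //; congr (_%:M); rewrite /psi; field; rewrite gt_eqF.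
Qed.

(* The projection orthogonal to the plane of the derivative of its frame in the
   direction with components w in the adapted frame. *)
Definition plane_shift (w : 'rV[R]_(n + n)) : 'M[R]_(1 + 1, n + 1 + 1) :=
  let x := lsubmx w in let xi := rsubmx w in
  let al := dot x p in let be := dot xi pu in
  col_mx (triple (xi *m gI - (be / (2 * t)) *: pu)
            (- al * (2 * c - A ^+ 2 * t) / 2) (al * A / 2))
    (triple ((A * t) *: x - (A * al / 2) *: pu) (A * be / 2)
       (- A ^+ 2 * be / (2 * (2 * c - A ^+ 2 * t)))).

Lemma plane_shift_linear a u v : plane_shift (a *: u + v) = a *: plane_shift u + plane_shift v.
Proof.
rewrite /plane_shift !(linearP lsubmx, linearP rsubmx) !(dotDl, dotZl).
have e1 := dotDl; rewrite scale_col_mx add_col_mx !tripleZ !tripleD.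
rewrite mulmxDl -scalemxAl.
generalize (dot (lsubmx u) p) (dot (lsubmx v) p) (dot (rsubmx u) pu) (dot (rsubmx v) pu)
  (rsubmx u *m gI) (rsubmx v *m gI) (lsubmx u) (lsubmx v) pu => r1 r2 r3 r4 X1 X2 X3 X4 P.
congr col_mx; congr triple; try ring.
- by apply/rowP => j; rewrite !mxE; ring.
- by apply/rowP => j; rewrite !mxE; ring.
Qed.

(** The origin of the coefficients of [plane_shift]. The right side is the covariant derivative of
    the frame: p^# varies by xi^# and by the Gauss term -c al X, and A t X + e by A t x, by A be X
    since dt = be, and by half the logarithmic derivative of psi along e. The components subtracted
    along [plane] and [rot *m plane] are its tangential part. *)
Lemma plane_shift_add_frame (w : 'rV[R]_(n + n)) :
  let x := lsubmx w in let xi := rsubmx w in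
  let al := dot x p in let be := dot xi pu in
  plane_shift w + (be / (2 * t)) *: plane + (- (A * al / 2)) *: (rot *m plane)
  = col_mx (triple (xi *m gI) (- (c * al)) 0)
      (triple ((A * t) *: x) (A * be)
        (be * ((c - A ^+ 2 * t) / (t * (2 * c - A ^+ 2 * t))))).
Proof.
rewrite /plane_shift /plane /=; set x := lsubmx w; set xi := rsubmx w.
rewrite /rot mul_block_col !mul0mx add0r addr0 mul1mx mulNmx mul1mx.
rewrite !scale_col_mx !add_col_mx tripleN !tripleZ !tripleD.
congr col_mx; congr triple.
- by rewrite !scaler0 addr0 subrK.
- by field.
- by field.
- rewrite !scaler0 addr0 scaleNr scalerN opprK; exact: subrK.
- by field; rewrite t0.
- by field; rewrite t0 d0.
Qed.

Lemma plane_shift_orth w : plane_shift w *m model_metric *m plane^T = 0.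
Proof.
rewrite /plane_shift /plane /=; set x := lsubmx w; set xi := rsubmx w.
have dpu v : dot (v *m g) pu = dot v p.
  by rewrite dot_mulmx sym_g puG.
have dxi : dot (xi *m gI) p = dot xi pu by rewrite dot_mulmx sym_gI.
rewrite col_metric !triple_metric !dot0r !dpu.
rewrite !(dotDl, dotNl, dotZl) pu_p dxi psiE -[RHS]block_mx0.
have Z (k : R) : k = 0 -> k%:M = 0 :> 'M[R]_1 by move->; rewrite raddf0.
by congr block_mx; apply: Z; field; rewrite ?t0 ?c0 ?d0.
Qed.

Variables (Glow Hup : 'M[R]_n).
Hypothesis Glow_def : Glow = (A * t) *: g + ((c - A ^+ 2 * t) / (A * t)) *: (p^T *m p).
Hypothesis Hup_def : Hup = (A * t)^-1 *: gI
  - ((c - A ^+ 2 * t) / (A * t ^+ 2 * (2 * c - A ^+ 2 * t))) *: (pu^T *m pu).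

(** Inversion of a rank-one perturbation: p^# pairs with p to 2t, so the rank-one terms close up
    under multiplication. *)
Lemma Glow_Hup : Glow *m Hup = 1%:M.
Proof.
rewrite Glow_def Hup_def mulmxDl !mulmxBr -!scalemxAl -!scalemxAr mulmxV //.
have -> : g *m (pu^T *m pu) = p^T *m pu by rewrite mulmxA -{1}sym_g -trmx_mul puG.
have -> : p^T *m p *m gI = p^T *m pu by rewrite -mulmxA.
have -> : p^T *m p *m (pu^T *m pu) = (2 * t) *: (p^T *m pu).
  by rewrite mulmxA -[p^T *m p *m _]mulmxA dotE dotC pu_p mul_mx_scalar -scalemxAl.
move: (p^T *m pu) => X; apply/matrixP => a b; rewrite !mxE.
by field; rewrite t0 A0 d0.
Qed.

Lemma Glow_sym : Glow^T = Glow.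
Proof. by rewrite Glow_def trmxD !trmxZ sym_g trmx_mul trmxK. Qed.

Lemma Hup_sym : Hup^T = Hup.
Proof. by rewrite Hup_def trmxD trmxN !trmxZ sym_gI trmx_mul trmxK. Qed.

Let Gx x x' : dot (x *m Glow) x' = A * t * dot (x *m g) x'
   + (c - A ^+ 2 * t) / (A * t) * (dot x p * dot x' p).
Proof.
rewrite Glow_def mulmxDr -!scalemxAr dotDl !dotZl mulmxA dotE mul_scalar_mx dotZl.
by rewrite [dot p x']dotC.
Qed.

Let Hx x x' : dot (x *m Hup) x' = (A * t)^-1 * dot (x *m gI) x'
   - (c - A ^+ 2 * t) / (A * t ^+ 2 * (2 * c - A ^+ 2 * t)) * (dot x pu * dot x' pu).
Proof.
rewrite Hup_def mulmxBr -!scalemxAr dotDl dotNl !dotZl mulmxA dotE mul_scalar_mx dotZl.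
by rewrite [dot pu x']dotC.
Qed.

(** Vertical components enter the TM part of the first row and the trivial part of the second,
    horizontal ones the other way round, so no mixed term arises. The rank-one parts agree by the
    value of psi. *)
Lemma plane_shift_metric (w w' : 'rV[R]_(n + n)) :
  (w *m block_mx Glow 0 0 Hup *m w'^T) 0 0
  = (A * t)^-1 * \tr (plane_shift w *m model_metric *m (plane_shift w')^T).
Proof.
rewrite /plane_shift /=; set x := lsubmx w; set xi := rsubmx w.
set x' := lsubmx w'; set xi' := rsubmx w'.
rewrite -(hsubmxK w) -(hsubmxK w') -/x -/x' -/xi -/xi' mul_row_block tr_row_mx mul_row_col.
rewrite !mulmx0 addr0 add0r mxE -!/(dot _ _) Gx Hx.
rewrite col_metric mxtrace_block !triple_metric !mxtrace_scalar !mulr1n.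
have row1 b b' : dot ((xi *m gI - b *: pu) *m g) (xi' *m gI - b' *: pu)
    = dot (xi *m gI) xi' - b' * dot xi pu - b * dot xi' pu + b * b' * (2 * t).
  rewrite mulmxBl mulmxKV // -scalemxAl puG !(dotDl, dotDr, dotNl, dotNr, dotZl, dotZr).
  have -> : dot xi (xi' *m gI) = dot (xi *m gI) xi' by rewrite dot_mulmx sym_gI.
  have -> : dot p (xi' *m gI) = dot xi' pu by rewrite dotC dot_mulmx sym_gI.
  by rewrite (dotC p pu) pu_p; ring.
have row2 a b b' : dot ((a *: x - b *: pu) *m g) (a *: x' - b' *: pu)
    = a ^+ 2 * dot (x *m g) x' - a * b' * dot x p - a * b * dot x' p + b * b' * (2 * t).
  rewrite mulmxBl -!scalemxAl puG !(dotDl, dotDr, dotNl, dotNr, dotZl, dotZr).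
  have -> : dot (x *m g) pu = dot x p by rewrite dot_mulmx sym_g puG.
  by rewrite (dotC p pu) pu_p (dotC p x'); ring.
rewrite row1 row2 psiE.
by field; rewrite ?t0 ?c0 ?d0 ?A0.
Qed.

Lemma plane_shift_rot (w : 'rV[R]_(n + n)) :
  plane_shift (w *m block_mx 0 Glow (- Hup) 0) = rot *m plane_shift w.
Proof.
rewrite -{1}(hsubmxK w) mul_row_block !mulmx0 add0r addr0 /plane_shift row_mxKl row_mxKr.
set x := lsubmx w; set xi := rsubmx w.
rewrite /rot mul_block_col !mul0mx add0r addr0 mul1mx mulNmx mul1mx tripleN.
(* [p^#] and [p] are exchanged by [Glow] and [Hup] up to the inverse factors (2c - A^2 t)/A and
   A/(2c - A^2 t), which gives the action of J on the radial components. *)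
have al1 : dot (xi *m - Hup) p = - (A / (2 * c - A ^+ 2 * t)) * dot xi pu.
  rewrite mulmxN dotNl Hx (dotC p) pu_p dot_mulmx sym_gI.
  by field; rewrite ?t0 ?d0 ?A0.
have be1 : dot (x *m Glow) pu = (2 * c - A ^+ 2 * t) / A * dot x p.
  rewrite Gx pu_p dot_mulmx sym_g puG.
  by field; rewrite ?t0 ?d0 ?A0.
rewrite al1 be1.
have xG : x *m Glow *m gI = (A * t) *: x + ((c - A ^+ 2 * t) / (A * t) * dot x p) *: pu.
  rewrite Glow_def mulmxDr -!scalemxAr mulmxDl -!scalemxAl mulmxK //.
  by rewrite mulmxA dotE mul_scalar_mx -scalemxAl scalerA.
have xH : xi *m - Hup = - ((A * t)^-1 *: (xi *m gI)
   - ((c - A ^+ 2 * t) / (A * t ^+ 2 * (2 * c - A ^+ 2 * t)) * dot xi pu) *: pu).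
  rewrite Hup_def mulmxN mulmxBr -!scalemxAr mulmxA dotE mul_scalar_mx scalerA.
  by [].
rewrite xG xH.
generalize (dot x p) (dot xi pu) (xi *m gI) x pu => al be X x' P.
congr col_mx; congr triple.
- by apply/rowP => j; rewrite !mxE; field; rewrite ?t0 ?A0.
- by field; rewrite ?d0.
- by field; rewrite ?d0.
- by apply/rowP => j; rewrite !mxE; field; rewrite ?t0 ?d0 ?A0.
- by field; rewrite ?A0.
- by field; rewrite ?d0 ?A0.
Qed.

(** The shifts fill the orthogonal complement of the plane in the space of pairs of vectors. Testing
    against chosen directions annihilates the components of [Z] one after the other. *)
Lemma plane_shift_nondegenerate (Z : 'M[R]_(1 + 1, n + 1 + 1)) :
  Z *m model_metric *m plane^T = 0 ->
  (forall w, \tr (Z *m model_metric *m (plane_shift w)^T) = 0) -> Z = 0.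
Proof.
move=> Z1 Z2.
(* Orthogonality to the plane allows the tangential part to be restored, and the full derivative of
   the frame has simpler components. *)
have E w : \tr (Z *m model_metric *m (plane_shift w
     + (dot (rsubmx w) pu / (2 * t)) *: plane
     + (- (A * dot (lsubmx w) p / 2)) *: (rot *m plane))^T) = 0.
  rewrite !trmxD !trmxZ trmx_mul !mulmxDr !mxtraceD Z2 -!scalemxAr mulmxA Z1.
  by rewrite mul0mx !scaler0 mxtrace0 !addr0.
rewrite -(vsubmxK Z) in E Z1 *.
have [z1 [s1 [r1 E1]]] := triple_split (usubmx Z).
have [z2 [s2 [r2 E2]]] := triple_split (dsubmx Z).
rewrite E1 E2 in E Z1 *; rewrite /plane col_metric !triple_metric in Z1.
have dpu v : dot (v *m g) pu = dot v p by rewrite dot_mulmx sym_g puG.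
have sc (k : R) : k%:M = 0 :> 'M[R]_1 -> k = 0.
  by move=> /matrixP/(_ 0 0); rewrite !mxE eqxx mulr1n.
move: Z1; rewrite -[RHS]block_mx0 => /eq_block_mx[/sc e1 /sc e2 /sc e3 /sc e4].
move: e1 e2 e3 e4; rewrite !dpu !dot0r !(mulr0, mul0r, addr0, add0r, mulr1) => e1 e2 e3 e4.
have E' x xi : A * t * dot (z2 *m g) x + dot z1 xi - s1 * dot x p
    + dot xi pu * (A * s2 / c + psi * r2 * ((c - A ^+ 2 * t) / (t * (2 * c - A ^+ 2 * t)))) = 0.
  have := E (row_mx x xi); rewrite plane_shift_add_frame row_mxKl row_mxKr.
  rewrite col_metric mxtrace_block !triple_metric !mxtrace_scalar !mulr1n dotZr.
  have -> : dot (z1 *m g) (xi *m gI) = dot z1 xi.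
    by rewrite dot_mulmx sym_g mulmxKV.
  move=> <-; by field; rewrite ?t0 ?c0 ?d0.
have s10 : s1 = 0.
  have := E' pu 0; rewrite dpu e3 dot0r dot0l pu_p => H.
  have : s1 * (2 * t) == 0 by apply/eqP; lra.
  by rewrite !mulf_eq0 pnatr_eq0 (negbTE t0) !orbF => /eqP.
have z20 : z2 = 0.
  have : z2 *m g = 0.
    apply: dot_eq0 => x; have := E' x 0; rewrite s10 dot0r dot0l => H.
    have : A * t * dot (z2 *m g) x == 0 by apply/eqP; lra.
    by rewrite !mulf_eq0 (negbTE t0) (negbTE A0) => /eqP.
  by move=> /(congr1 (mulmx^~ gI)); rewrite mulmxK // mul0mx.
have k0 : A * s2 / c + psi * r2 * ((c - A ^+ 2 * t) / (t * (2 * c - A ^+ 2 * t))) = 0.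
  have := E' 0 p; rewrite !dot0r e1 dot0l (dotC p) pu_p => H.
  set k := (X in X = 0); rewrite -/k in H.
  have : 2 * t * k == 0 by apply/eqP; lra.
  by rewrite !mulf_eq0 pnatr_eq0 (negbTE t0) => /eqP.
have z10 : z1 = 0.
  by apply: dot_eq0 => xi; have := E' 0 xi; rewrite k0 !dot0r dot0l => H; lra.
(* The radial equation [k0] and orthogonality to the second frame vector form a linear system in
   [s2], [r2]; after rescaling, the difference of its equations is c r2 = 0. *)
have r20 : r2 = 0.
  have : c * r2 = 0.
    have := k0; rewrite psiE; have := e4; rewrite psiE => H1 H2.
    have h1 : A * s2 + (2 * c - A ^+ 2 * t) * r2 = 0.
      by rewrite -[RHS](mulr0 (c / t)) -H1; field; rewrite ?t0 ?c0.
    have h2 : A * s2 + (c - A ^+ 2 * t) * r2 = 0.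
      by rewrite -[RHS](mulr0 c) -H2; field; rewrite ?t0 ?c0 ?d0.
    have -> : c * r2 = A * s2 + (2 * c - A ^+ 2 * t) * r2 - (A * s2 + (c - A ^+ 2 * t) * r2) by ring.
    by rewrite h1 h2 subrr.
  by move/eqP; rewrite mulf_eq0 (negbTE c0) => /eqP.
have s20 : s2 = 0.
  move/eqP: k0; rewrite r20 mulr0 mul0r addr0 !mulf_eq0 invr_eq0 (negbTE A0) (negbTE c0) orbF.
  by move/eqP.
have r10 : r1 = 0.
  move/eqP: e2; rewrite s10 !mul0r add0r mulf_eq0 (gt_eqF psi_gt0).
  by move/eqP.
by rewrite z10 z20 s10 s20 r10 r20 /triple !raddf0 !row_mx0 col_mx0.
Qed.

End TubeAlgebra.

(** * Block-diagonal connections and pull-back from the base *)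

Lemma curvature_block_diag (R : pzRingType) p q (D1 D2 P Q : 'M[R]_p) (d1 d2 a b : 'M[R]_q) :
  block_mx D1 0 0 d1 - block_mx D2 0 0 d2 + block_mx P 0 0 a *m block_mx Q 0 0 b
    - block_mx Q 0 0 b *m block_mx P 0 0 a
  = block_mx (D1 - D2 + P *m Q - Q *m P) 0 0 (d1 - d2 + a *m b - b *m a).
Proof.
rewrite !mulmx_block !mulmx0 !mul0mx !addr0 !add0r !opp_block_mx !add_block_mx.
by rewrite !oppr0 !addr0.
Qed.

Lemma parallel_block_diag (R : comPzRingType) p q (P D : 'M[R]_p) (a d : 'M[R]_q) :
  block_mx P 0 0 a *m block_mx D 0 0 d + block_mx D 0 0 d *m (block_mx P 0 0 a)^T
  = block_mx (P *m D + D *m P^T) 0 0 (a *m d + d *m a^T).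
Proof.
by rewrite tr_block_mx !mulmx_block !trmx0 !mulmx0 !mul0mx !addr0 !add0r add_block_mx !addr0.
Qed.

Lemma smooth_mx_scalar1 (R : realType) m (W : set 'rV[R]_m) (f : 'rV[R]_m -> R) :
  smooth_on W f -> smooth_mx W (fun y => (f y)%:M : 'M[R]_1).
Proof.
move=> sf a b; rewrite (ord1 a) (ord1 b).
by under eq_fun do rewrite mxE eqxx mulr1n.
Qed.

Lemma dmx_scalar1 (R : realType) m k (f : 'rV[R]_m -> R) y :
  dmx k (fun y => (f y)%:M : 'M[R]_1) y = (partial k f y)%:M.
Proof.
apply/matrixP => a b; rewrite (ord1 a) (ord1 b) dmxE mxE eqxx mulr1n.
by congr (partial k _ y); apply/funext => z; rewrite mxE eqxx mulr1n.
Qed.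

Section PullBack.
Context {R : realType} {n : nat}.
Variables (W0 : set 'rV[R]_n) (W : set 'rV[R]_(n + n)).
Hypotheses (oW0 : open W0) (oW : open W) (WW0 : forall y, W y -> W0 (lsubmx y)).

Lemma smooth_on_lsub f : smooth_on W0 f -> smooth_on W (fun y => f (lsubmx y)).
Proof.
move=> sf; apply: (smooth_on_comp oW sf WW0) => l.
by under eq_fun do rewrite mxE; exact: smooth_on_coord.
Qed.

Lemma smooth_mx_lsub p q (F : 'rV[R]_n -> 'M[R]_(p, q)) :
  smooth_mx W0 F -> smooth_mx W (fun y => F (lsubmx y)).
Proof. by move=> sF a b; exact: (smooth_on_lsub (sF a b)). Qed.

Lemma partial_lsub f y k : smooth_on W0 f -> W y ->
  partial k (fun y => f (lsubmx y)) y
  = match fintype.split k with inl a => partial a f (lsubmx y) | inr _ => 0 end.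
Proof.
move=> sf Wy.
have E (l : 'I_n) : (fun y : 'rV[R]_(n + n) => lsubmx y 0 l) = fun y => y 0 (lshift n l).
  by apply/funext => z; rewrite mxE.
rewrite (partial_comp (phi := lsubmx)); last 2 first.
- by move=> l; rewrite E; exact: differentiable_coord.
- exact: (sf [::] _ (WW0 Wy)).
rewrite (eq_bigr (fun l => (k == lshift n l)%:R * partial l f (lsubmx y))); last first.
  by move=> l _; rewrite E partial_coord.
rewrite -(splitK k); case: (fintype.split k) => a; rewrite unsplitK /=.
  rewrite (bigD1 a) //= eqxx mul1r big1 ?addr0 // => l la.
  by rewrite (inj_eq (@lshift_inj _ _)) eq_sym (negbTE la) mul0r.
by rewrite big1 // => l _; rewrite eq_sym eq_lrshift mul0r.
Qed.

Lemma dmx_lsub p q (F : 'rV[R]_n -> 'M[R]_(p, q)) y k : smooth_mx W0 F -> W y ->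
  dmx k (fun y => F (lsubmx y)) y
  = match fintype.split k with inl a => dmx a F (lsubmx y) | inr _ => 0 end.
Proof.
move=> sF Wy; apply/matrixP => a b; rewrite dmxE (partial_lsub k (sF a b) Wy).
by case: (fintype.split k) => d; rewrite ?dmxE ?mxE.
Qed.

Lemma smooth_mx_rsub : smooth_mx W (fun y => rsubmx y : 'rV[R]_n).
Proof. by move=> a b; rewrite (ord1 a); under eq_fun do rewrite mxE; exact: smooth_on_coord. Qed.

Lemma dmx_rsub k y : dmx k (fun y : 'rV[R]_(n + n) => rsubmx y : 'rV[R]_n) y
  = match fintype.split k with inl _ => 0 | inr a => delta_mx 0 a end.
Proof.
apply/rowP => b; rewrite dmxE.
rewrite (_ : (fun y : 'rV[R]_(n + n) => rsubmx y 0 b) = fun y => y 0 (rshift n b)); last first.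
  by apply/funext => z; rewrite mxE.
rewrite partial_coord -(splitK k); case: (fintype.split k) => a; rewrite unsplitK /= !mxE.
  by rewrite eq_lrshift.
by rewrite (inj_eq (@rshift_inj _ _)) eq_sym.
Qed.

End PullBack.

(** * The geometry of the tube over one chart *)

Section TubeChart.
Context {R : realType} {n : nat} {M : atlas R n}.
Variables (g : field2 M) (c A : R) (i : idx M) (W0 : set 'rV[R]_n).
Hypotheses (oW0 : open W0) (smooth_g : smooth_mx W0 (g i)).
Hypothesis sym_g : forall q, W0 q -> (g i q)^T = g i q.
Hypothesis unit_g : forall q, W0 q -> g i q \in unitmx.
Hypotheses (c_gt0 : 0 < c) (A_gt0 : 0 < A).
Hypothesis curvature_g : forall q a b, W0 q -> curvature_mx (g i) a b q
  = \matrix_(k, l) (c * ((a == l)%:R * g i q b k - (b == l)%:R * g i q a k)).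

Definition tube_domain : set 'rV[R]_(n + n) :=
  [set y | W0 (lsubmx y) /\ 0 < norm_sq g i y < 4 * c / A ^+ 2].
Local Notation W := tube_domain.

(** Continuity of [norm_sq] is needed on an open set known beforehand, in order to show that its
    bounds cut out an open set. *)
Let W1 : set 'rV[R]_(n + n) := [set y | W0 (lsubmx y)].
Let oW1 : open W1.
Proof.
apply: (@open_comp _ _ (fun y : 'rV[R]_(n + n) => lsubmx y : 'rV[R]_n)) => // y _.
apply/differentiable_continuous/differentiable_lsubmx.
Qed.

Let smooth_gI1 : smooth_mx W1 (fun y => invmx (metric_at g i y)).
Proof.
apply: smooth_mx_inv => // [|y]; last exact: unit_g.
exact: (smooth_mx_lsub oW1 (fun y Wy => Wy) smooth_g).
Qed.

Let smooth_norm1 : smooth_on W1 (norm_sq g i).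
Proof.
have sp : smooth_mx W1 (fun y => momentum y : 'rV[R]_n) by exact: smooth_mx_rsub.
have s : smooth_mx W1 (fun y => momentum y *m invmx (metric_at g i y) *m (momentum y)^T).
  by apply: smooth_mxM => //; [exact: smooth_mxM | exact: smooth_mx_tr].
exact: (s 0 0).
Qed.

Lemma open_tube_domain : open W.
Proof.
rewrite openE => y [y1 yn].
have cn : {for y, continuous (norm_sq g i)}.
  by apply: differentiable_continuous; exact: smooth_on_diff smooth_norm1 y1.
apply: filterI; first exact: (open_nbhs_nbhs (conj oW1 y1)).
have : nbhs (norm_sq g i y) [set x | 0 < x < 4 * c / A ^+ 2].
  by move/andP: yn => [n1 n2]; near=> x; apply/andP; split; near: x;
    [exact: lt_nbhsr | exact: lt_nbhsl].
exact: cn.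
Unshelve. all: by end_near. Qed.

Let oW := open_tube_domain.
Let WW0 y : W y -> W0 (lsubmx y). Proof. by case. Qed.
Let sub_W1 : W `<=` W1. Proof. by move=> y []. Qed.

Let p := @momentum R n.
Let gq := metric_at g i.
Let gI y := invmx (gq y).
Let pu := momentum_up g i.
Let t := energy g i.

Lemma smooth_momentum : smooth_mx W p.
Proof. exact: smooth_mx_rsub. Qed.

Lemma smooth_gq : smooth_mx W gq.
Proof. exact: (smooth_mx_lsub oW WW0 smooth_g). Qed.

Lemma smooth_gI : smooth_mx W gI.
Proof. by apply: smooth_mx_inv => //; [exact: smooth_gq | move=> y /WW0; exact: unit_g]. Qed.

Lemma smooth_pu : smooth_mx W pu.
Proof. by apply: smooth_mxM => //; [exact: smooth_momentum | exact: smooth_gI]. Qed.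

Lemma smooth_energy : smooth_on W t.
Proof.
apply: smooth_onM => //; last exact: smooth_on_cst.
exact: smooth_on_subset smooth_norm1.
Qed.

Lemma energy_gt0 y : W y -> 0 < t y.
Proof. by case=> _ /andP[n0 _]; rewrite divr_gt0. Qed.

Lemma energy_bound y : W y -> 0 < 2 * c - A ^+ 2 * t y.
Proof.
case=> _ /andP[_ n1]; move: n1; rewrite ltr_pdivlMr ?exprn_gt0 // /t /energy => n1.
by rewrite subr_gt0; lra.
Qed.

Let Gam a (y : 'rV[R]_(n + n)) := christoffel_mx (g i) a (lsubmx y : 'rV[R]_n).

Lemma row_Gamma0 a y : row a (Gamma0 g i y) = p y *m (Gam a y)^T.
Proof. by apply/rowP => b; rewrite !mxE; apply: eq_bigr => k _; rewrite !mxE. Qed.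

Let smooth_Gam a : smooth_mx W (Gam a).
Proof. by apply: (smooth_mx_lsub oW WW0); exact: smooth_christoffel_mx. Qed.

Lemma smooth_Gamma0 : smooth_mx W (Gamma0 g i).
Proof.
move=> a b; under eq_fun do rewrite mxE.
apply: smooth_on_sum => // k; apply: smooth_onM => //; first exact: smooth_momentum.
by apply: (smooth_on_lsub oW WW0); exact: smooth_christoffel.
Qed.

Let frame_inv y : 'M[R]_(n + n) := block_mx 1%:M (- Gamma0 g i y) 0 1%:M.

Lemma adapted_frame_inv y : frame_inv y *m adapted_frame g i y = 1%:M.
Proof.
rewrite mulmx_block !(mulmx0, mul0mx, mulmx1, mul1mx, addr0, add0r) subrr.
by rewrite -scalar_mx_block.
Qed.

Lemma adapted_frame_unit y : adapted_frame g i y \in unitmx.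
Proof. by have /mulmx1_unit[] := adapted_frame_inv y. Qed.

Lemma invmx_adapted_frame y : invmx (adapted_frame g i y) = frame_inv y.
Proof.
have := adapted_frame_inv y => /(congr1 (mulmx^~ (invmx (adapted_frame g i y)))).
by rewrite mulmxK ?adapted_frame_unit // mul1mx.
Qed.

Let dgI k y : W y -> dmx k gI y = match fintype.split k with
  | inl a => - (gI y *m Gam a y + (Gam a y)^T *m gI y) | inr _ => 0 end.
Proof.
move=> Wy; have Wq := WW0 Wy; have ug := unit_g Wq.
rewrite (dmx_inv k oW Wy smooth_gq (fun y Wy => unit_g (WW0 Wy))).
rewrite (dmx_lsub WW0 k smooth_g Wy); case: (fintype.split k) => a; last first.
  by rewrite mulmx0 mul0mx oppr0.
rewrite (christoffel_metric oW0 sym_g unit_g a Wq) mulmxDr mulmxDl.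
by rewrite !mulmxA mulmxK // mulVmx // mul1mx.
Qed.

(** The k-th coordinate field in the adapted frame has horizontal components [al] and vertical
    components [xi]: d/dq^a is delta/delta q^a minus its Gamma0 term. *)
Let xi k y : 'rV[R]_n := rsubmx (row k (frame_inv y)).
Let al k y : 'rV[R]_n := lsubmx (row k (frame_inv y)).

Let xi_l a y : xi (lshift n a) y = - (p y *m (Gam a y)^T).
Proof. by rewrite /xi /frame_inv /block_mx rowKu row_row_mx row_mxKr raddfN /= row_Gamma0. Qed.
Let xi_r a y : xi (rshift n a) y = delta_mx 0 a.
Proof. by rewrite /xi /frame_inv /block_mx rowKd row_row_mx row_mxKr rowE mulmx1. Qed.
Let al_l a y : al (lshift n a) y = delta_mx 0 a.
Proof. by rewrite /al /frame_inv /block_mx rowKu row_row_mx row_mxKl rowE mulmx1. Qed.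
Let al_r a y : al (rshift n a) y = 0.
Proof. by rewrite /al /frame_inv /block_mx rowKd row_row_mx row_mxKl raddf0. Qed.

Let dp k y : dmx k p y = match fintype.split k with inl _ => 0 | inr a => delta_mx 0 a end.
Proof. exact: dmx_rsub. Qed.

(* The covariant derivative of the vector field p^# is xi^#. *)
Let dpu k y : W y -> dmx k pu y
   + match fintype.split k with inl a => pu y *m Gam a y | inr _ => 0 end = xi k y *m gI y.
Proof.
move=> Wy; rewrite (dmxM k (smooth_mx_diff smooth_momentum Wy)
  (smooth_mx_diff smooth_gI Wy)) dgI // dp.
rewrite -(splitK k); case: (fintype.split k) => a; rewrite unsplitK /=; last first.
  by rewrite xi_r mulmx0 !addr0.
rewrite xi_l mul0mx add0r mulmxN mulmxDr !mulmxA mulNmx /pu /momentum_up -/p -/(gq y) -/(gI y).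
by rewrite opprD addrAC addNr add0r.
Qed.

Let pu_def y : pu y = p y *m gI y. Proof. by []. Qed.

Let dot_gI y v w : W y -> dot (v *m gI y) w = dot v (w *m gI y).
Proof. by move=> Wy; rewrite dot_mulmx /gI trmx_inv sym_g //; exact: WW0. Qed.

(** Horizontal displacement is parallel transport for a metric connection and preserves the norm of
    p, so only the vertical component contributes. *)
Let dt k y : W y -> partial k t y = dot (xi k y) (pu y).
Proof.
move=> Wy.
have spt : smooth_mx W (fun y => pu y *m (p y)^T).
  by apply: smooth_mxM => //; [exact: smooth_pu | apply: smooth_mx_tr; exact: smooth_momentum].
have -> : t = fun y => 2^-1 * (pu y *m (p y)^T) 0 0.
  by apply/funext => z; rewrite mulrC.
rewrite partialZ; last exact: smooth_mx_diff spt Wy 0 0.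
rewrite -dmxE (dmxM k (smooth_mx_diff smooth_pu Wy)
  (smooth_mx_diff (smooth_mx_tr smooth_momentum) Wy)) dmx_tr dp mxE -!/(dot _ _).
have := dpu k Wy; move/(congr1 (fun v => dot v (p y))); rewrite dotDl dot_gI // -pu_def.
rewrite -(splitK k); case: (fintype.split k) => a; rewrite unsplitK /=.
  rewrite dot0r dot_mulmx xi_l dotNl [dot (pu y) _]dotC => H; lra.
by rewrite dot0l addr0 => ->; rewrite xi_r [dot (pu y) _]dotC; field.
Qed.

(** The rows read D_a d_k = Gamma^l_{ak} d_l - c g_{ak} X and D_a X = d_a, the Gauss formula and the
    derivative of the position vector of a sphere of radius c^(-1/2). *)
Let base_connection a q : 'M[R]_(n + 1) :=
  block_mx (christoffel_mx (g i) a q) (- c *: col a (g i q)) (delta_mx 0 a) 0.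

Let smooth_base_connection a : smooth_mx W0 (base_connection a).
Proof.
apply: smooth_mx_block => //; try exact: smooth_mx_cst.
  exact: smooth_christoffel_mx.
apply: smooth_mxZ => //; first exact: smooth_on_cst.
by move=> k l; under eq_fun do rewrite mxE; exact: smooth_g.
Qed.

(* Gauss equation: TM + R, with the structure of the restriction to the sphere of
   the tangent bundle of the ambient Euclidean space, is flat. *)
Let base_flat a b q : W0 q -> connection_curvature base_connection a b q = 0.
Proof.
move=> Wq; rewrite /connection_curvature.
have dB a' b' : dmx a' (base_connection b') q
    = block_mx (dmx a' (christoffel_mx (g i) b') q) (- c *: col b' (dmx a' (g i) q)) 0 0.
  rewrite dmx_block !dmx_cst; congr block_mx.
  apply/matrixP => k l; rewrite dmxE !mxE.
  rewrite -partialZ; last exact: smooth_mx_diff smooth_g Wq _ _.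
  by congr (partial a' _ q); apply/funext => z; rewrite !mxE.
rewrite !dB !mulmx_block !mulmx0 !addr0 !opp_block_mx !add_block_mx !oppr0 !addr0 !add0r.
have GC k l m : christoffel (g i) k l m q = christoffel (g i) k m l q.
  exact: christoffelC oW0 sym_g k l m q Wq.
have gC k l : g i q k l = g i q l k by rewrite -{1}(sym_g Wq) mxE.
have rowC : row b (christoffel_mx (g i) a q) = row a (christoffel_mx (g i) b q).
  by apply/rowP => k; rewrite !mxE GC.
rewrite -[RHS]block_mx0; congr block_mx.
- have := curvature_mxE (g i) a b q; rewrite curvature_g // /connection_curvature => E.
  have outer a' b' : - c *: col a' (g i q) *m delta_mx 0 b'
      = \matrix_(k, l) (- c * g i q k a' * (b' == l)%:R).
    apply/matrixP => k l; rewrite !mxE big_ord1 !mxE eqxx /= eq_sym.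
    by [].
  rewrite !outer; apply/matrixP => k l.
  have := congr1 (fun X : 'M[R]_n => X k l) E.
  move: (dmx a _ q) (dmx b _ q) (christoffel_mx _ b q *m _) (christoffel_mx _ a q *m _).
  move=> X1 X2 X3 X4; rewrite !mxE (gC b k) (gC a k) => E'.
  by rewrite -[0](subrr (X1 k l - X2 k l + X3 k l - X4 k l)) -{2}E'; ring.
- have d1 a' : dmx a' (g i) q = christoffel_mx (g i) a' q *m g i q
      + g i q *m (christoffel_mx (g i) a' q)^T.
    exact: (christoffel_metric oW0 sym_g unit_g a' Wq).
  have colE a' b' : col b' (dmx a' (g i) q) = christoffel_mx (g i) a' q *m col b' (g i q)
      + g i q *m (row b' (christoffel_mx (g i) a' q))^T.
    by rewrite d1 linearD /= !colE !mulmxA tr_row colE mulmxA.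
  rewrite !colE rowC -!scalemxAr; mx_ring.
- by rewrite -!rowE rowC !mul0mx !addr0 subrr.
- rewrite -!scalemxAr -!rowE -scalerBr.
  by apply/matrixP => k l; rewrite !mxE (gC a b); ring.
Qed.

Let psi y := 2 * t y - A ^+ 2 * t y ^+ 2 / c.

Let smooth_psi : smooth_on W psi.
Proof.
apply: smooth_onB => //; apply: smooth_onM => //; try exact: smooth_on_cst.
- exact: smooth_energy.
- apply: smooth_onM => //; first exact: smooth_on_cst.
  by apply: smooth_onM => //; exact: smooth_energy.
Qed.

Let psi_neq0 y : W y -> psi y != 0.
Proof.
move=> Wy; rewrite gt_eqF //; apply: psi_gt0 => //; first exact: energy_gt0.
exact: energy_bound.
Qed.

(** The connection form of the line spanned by e for which its square length psi is parallel. It is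
    half the differential of log psi, hence closed, and the line is flat. *)
Let lam k y := partial k psi y / (2 * psi y).

Let smooth_lam k : smooth_on W (lam k).
Proof.
apply: smooth_onM => //; first exact: smooth_on_partial.
apply: smooth_onV => // [|y Wy]; last by rewrite mulf_neq0 ?pnatr_eq0 ?psi_neq0.
by apply: smooth_onM => //; exact: smooth_on_cst.
Qed.

Let lam_closed k l y : W y -> partial k (lam l) y = partial l (lam k) y.
Proof.
move=> Wy; have p0 := psi_neq0 Wy.
have dpsi := smooth_on_diff smooth_psi Wy.
have d2 : differentiable (fun z => 2 * psi z) y.
  by apply: differentiableM => //; exact: differentiable_cst.
have E a b : partial a (lam b) y = partial a (partial b psi) y / (2 * psi y)
   - partial a psi y * partial b psi y / (2 * psi y ^+ 2).
  have db := smooth_on_diff (smooth_on_partial b smooth_psi) Wy.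
  rewrite /lam partialM //; last by apply: differentiableV => //; rewrite mulf_neq0 ?pnatr_eq0.
  rewrite partialV ?mulf_neq0 ?pnatr_eq0 // partialZ //.
  move: (partial a (partial b psi) y) (partial a psi y) (partial b psi y) => x1 x2 x3.
  by field.
rewrite !E (partialC k l oW smooth_psi Wy).
by move: (partial k psi y) (partial l psi y) => r1 r2; rewrite [r1 * r2]mulrC.
Qed.

Let base' (k : 'I_(n + n)) (y : 'rV[R]_(n + n)) : 'M[R]_(n + 1) := match fintype.split k with
  | inl a => base_connection a (lsubmx y) | inr _ => 0 end.

Let smooth_base' k : smooth_mx W (base' k).
Proof.
rewrite /base'; case: (fintype.split k) => a; last exact: smooth_mx_cst.
exact: (smooth_mx_lsub oW WW0 (smooth_base_connection a)).
Qed.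

Let bundle_connection k y : 'M[R]_(n + 1 + 1) := block_mx (base' k y) 0 0 (lam k y)%:M.

Let smooth_bundle_connection k : smooth_mx W (bundle_connection k).
Proof.
apply: smooth_mx_block => //; try exact: smooth_mx_cst.
exact: smooth_mx_scalar1.
Qed.

Let bundle_flat y k l : W y -> connection_curvature bundle_connection k l y = 0.
Proof.
move=> Wy; rewrite /connection_curvature.
have dB k' l' : dmx k' (bundle_connection l') y
    = block_mx (dmx k' (base' l') y) 0 0 (partial k' (lam l') y)%:M.
  by rewrite dmx_block !dmx_cst dmx_scalar1.
have Z : dmx k (base' l) y - dmx l (base' k) y + base' l y *m base' k y
    - base' k y *m base' l y = 0.
  rewrite /base'; case Ek: (fintype.split k) => [a|a]; case El: (fintype.split l) => [b|b].
  - rewrite (dmx_lsub WW0 k (smooth_base_connection b) Wy) Ek.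
    rewrite (dmx_lsub WW0 l (smooth_base_connection a) Wy) El.
    exact: base_flat (WW0 Wy).
  - rewrite dmx_cst (dmx_lsub WW0 l (smooth_base_connection a) Wy) El.
    by rewrite mul0mx mulmx0 !subr0 addr0.
  - rewrite dmx_cst (dmx_lsub WW0 k (smooth_base_connection b) Wy) Ek.
    by rewrite mul0mx mulmx0 !subr0 addr0.
  - by rewrite !dmx_cst mul0mx !subr0 addr0.
rewrite (dB k l) (dB l k) curvature_block_diag Z (lam_closed k l Wy) subrr add0r.
by move: (lam l y) (lam k y) => r1 r2; rewrite scalar_mxC subrr block_mx0.
Qed.

Let bundle_metric y := model_metric (gq y) c A (t y).

Let smooth_bundle_metric : smooth_mx W bundle_metric.
Proof.
apply: smooth_mx_block => //; try exact: smooth_mx_cst; last exact: smooth_mx_scalar1.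
by apply: smooth_mx_block => //; try exact: smooth_mx_cst; exact: smooth_gq.
Qed.

Let bundle_metric_parallel y k : W y -> dmx k bundle_metric y
  = bundle_connection k y *m bundle_metric y + bundle_metric y *m (bundle_connection k y)^T.
Proof.
move=> Wy; have p0 := psi_neq0 Wy; have Wq := WW0 Wy.
have dB : dmx k bundle_metric y
   = block_mx (block_mx (dmx k gq y) 0 0 0) 0 0 (partial k psi y)%:M.
  by rewrite !dmx_block !dmx_cst (dmx_scalar1 k psi y).
rewrite dB parallel_block_diag.
congr block_mx; last first.
  rewrite tr_scalar_mx -!scalar_mxM -raddfD /=; congr (_%:M).
  rewrite -/(psi y) /lam; move: (partial k psi y) => r; by field.
rewrite (dmx_lsub WW0 k smooth_g Wy) /base' -(splitK k).
case: (fintype.split k) => a; rewrite unsplitK /=; last first.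
  by rewrite trmx0 mul0mx mulmx0 addr0 block_mx0.
rewrite tr_block_mx !mulmx_block !trmx0 !mulmx0 !mul0mx !addr0 !add0r add_block_mx !addr0.
rewrite (christoffel_metric oW0 sym_g unit_g a Wq).
have gC k' l' : g i (lsubmx y) k' l' = g i (lsubmx y) l' k'.
  by rewrite -{1}(sym_g Wq) mxE.
have c0 : c != 0 by rewrite gt_eqF.
(* The coefficient -c in the Gauss formula meets the square length 1/c of X: this cancels the
   contribution of D_a X in the mixed blocks. *)
congr block_mx.
- rewrite mul_mx_scalar scalerA trmx_delta -colE mulrN mulVf // scaleN1r.
  by rewrite addNr.
- rewrite mul_scalar_mx trmxZ scalerA mulrN mulVf // scaleN1r -rowE.
  by rewrite tr_col sym_g // subrr.
Qed.

Let U y := plane (gq y) (p y) A (t y).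

Let smooth_triple (v : 'rV[R]_(n + n) -> 'rV[R]_n) (s r : 'rV[R]_(n + n) -> R) :
  smooth_mx W v -> smooth_on W s -> smooth_on W r ->
  smooth_mx W (fun y => triple (v y) (s y) (r y)).
Proof.
move=> sv ss sr; apply: smooth_mx_row; last exact: smooth_mx_scalar1.
by apply: smooth_mx_row => //; exact: smooth_mx_scalar1.
Qed.

Let smooth_At : smooth_on W (fun y => A * t y).
Proof. by apply: smooth_onM => //; [exact: smooth_on_cst | exact: smooth_energy]. Qed.

Let smooth_U : smooth_mx W U.
Proof.
apply: smooth_mx_col; apply: smooth_triple => //; try exact: smooth_on_cst.
- exact: smooth_pu.
- exact: smooth_mx_cst.
Qed.

Let V k y := plane_shift (gq y) (p y) c A (t y) (row k (frame_inv y)).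
Let rho k y := - (A * dot (al k y) (p y) / 2).

Let t_def y : t y = dot (p y *m gI y) (p y) / 2. Proof. by []. Qed.

(** [plane_shift_add_frame] at the adapted components of the k-th coordinate field reduces this to
    computing the covariant derivative of each frame vector, from [dpu], [dt] and the value of
    [lam]. *)
Let dU y k : W y -> dmx k U y + U y *m bundle_connection k y
  = V k y + (partial k t y / (2 * t y)) *: U y + rho k y *: (rot *m U y).
Proof.
move=> Wy; have Wq := WW0 Wy; have p0 := psi_neq0 Wy.
have t0 : t y != 0 by rewrite gt_eqF // energy_gt0.
have d0 : 2 * c - A ^+ 2 * t y != 0 by rewrite gt_eqF // energy_bound.
have c0 : c != 0 by rewrite gt_eqF.
rewrite dt // (plane_shift_add_frame (gq y) (p y) (energy_gt0 Wy) (energy_bound Wy)).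
have dpsi : partial k psi y = (2 - 2 * A ^+ 2 * t y / c) * partial k t y.
  have dt0 := smooth_on_diff smooth_energy Wy.
  have -> : psi = fun z => 2 * t z - A ^+ 2 / c * (t z * t z).
    by apply/funext => z; rewrite /psi expr2; ring.
  have d2 : differentiable (fun z => t z * t z) y by exact: differentiableM.
  have d1 : differentiable (fun z => 2 * t z) y by exact: differentiableZ.
  have d3 : differentiable (fun z => A ^+ 2 / c * (t z * t z)) y by exact: differentiableZ.
  rewrite (partialB k d1 d3) (partialZ k _ dt0) (partialZ k _ d2) (partialM k dt0 dt0).
  by move: (partial k t y) (t y) => r1 r2; ring.
have lamE : lam k y = partial k t y * ((c - A ^+ 2 * t y) / (t y * (2 * c - A ^+ 2 * t y))).
  rewrite /lam dpsi /psi (psiE A (t y) c_gt0).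
  move: (partial k t y) (t y) t0 d0 => r1 r2 t0 d0.
  by field; rewrite t0 d0 c0.
have dtriple (v : 'rV[R]_(n + n) -> 'rV[R]_n) (s r : 'rV[R]_(n + n) -> R) :
    dmx k (fun y => triple (v y) (s y) (r y)) y
    = triple (dmx k v y) (partial k s y) (partial k r y).
  by rewrite /triple !dmx_row !dmx_scalar1.
have dAt : partial k (fun y => A * t y) y = A * partial k t y.
  by rewrite partialZ //; exact: smooth_on_diff smooth_energy Wy.
have dUE : dmx k U y = col_mx (triple (dmx k pu y) 0 0) (triple 0 (A * partial k t y) 0).
  rewrite /U /plane dmx_col (dtriple pu (fun=> 0) (fun=> 0)) (dtriple (fun=> 0) _ (fun=> 1)).
  by rewrite dAt !partial_cst dmx_cst.
rewrite dUE /U /plane mul_col_mx add_col_mx -/(xi k y) -/(al k y) -/(gI y) -(pu_def y).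
rewrite -dt // in lamE *.
move: lamE (dpu k Wy); rewrite /bundle_connection /base'.
rewrite -(splitK k); case: (fintype.split k) => a; rewrite unsplitK /= => lamE dpuE.
  have conn v s r : triple v s r *m block_mx (base_connection a (lsubmx y)) 0 0 (lam (lshift n a) y)%:M
     = triple (v *m Gam a y + s *: delta_mx 0 a) (- c * dot v (row a (gq y)))
        (r * lam (lshift n a) y).
    rewrite /triple /base_connection mul_row_block !mulmx0 addr0 add0r mul_row_block !mulmx0 addr0.
    rewrite mul_scalar_mx -scalar_mxM -scalemxAr.
    have -> : v *m col a (g i (lsubmx y)) = (dot v (row a (gq y)))%:M.
      by rewrite -dotE tr_row sym_g.
    by rewrite scale_scalar_mx.
  have rowg : dot (pu y) (row a (gq y)) = dot (delta_mx 0 a) (p y).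
    by rewrite rowE dotC dot_mulmx sym_g // pu_def mulmxKV // unit_g.
  rewrite !conn !tripleD al_l rowg -dpuE lamE.
  congr col_mx; congr triple.
  - by rewrite scale0r addr0.
  - by rewrite add0r mulNr.
  - by rewrite mul0r addr0.
  - by rewrite mul0mx !add0r.
  - by rewrite dot0l (mulr0 (- c)); exact: addr0.
  - by rewrite add0r mul1r.
have conn v s r (l : R) : triple v s r *m block_mx 0 0 0 l%:M = triple (0 : 'rV[R]_n) 0 (r * l).
  by rewrite /triple mul_row_block !mulmx0 addr0 add0r -scalar_mxM raddf0 row_mx0.
rewrite !conn !tripleD al_r -dpuE lamE.
congr col_mx; congr triple.
- by rewrite addr0 dot0l (mulr0 c) oppr0.
- by rewrite mul0r addr0.
- by rewrite scaler0 addr0.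
- exact: addr0.
- by rewrite add0r mul1r.
Qed.

Let h := tube_metric g c A i : 'rV[R]_(n + n) -> 'M[R]_(n + n).
Let J := tube_J g c A i : 'rV[R]_(n + n) -> 'M[R]_(n + n).
Let Glow := G_low g c A i : 'rV[R]_(n + n) -> 'M[R]_n.
Let Hup := H_up g c A i : 'rV[R]_(n + n) -> 'M[R]_n.

Let hE y : h y = frame_inv y *m block_mx (Glow y) 0 0 (Hup y) *m (frame_inv y)^T.
Proof. by rewrite -!invmx_adapted_frame. Qed.

Let JE y : J y = frame_inv y *m block_mx 0 (Glow y) (- Hup y) 0 *m adapted_frame g i y.
Proof. by rewrite -invmx_adapted_frame. Qed.

Let smooth_frame_inv : smooth_mx W frame_inv.
Proof.
apply: smooth_mx_block => //; try exact: smooth_mx_cst.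
by apply: smooth_mxN => //; exact: smooth_Gamma0.
Qed.

Let smooth_frame : smooth_mx W (adapted_frame g i).
Proof. by apply: smooth_mx_block => //; try exact: smooth_mx_cst; exact: smooth_Gamma0. Qed.

Let smooth_A2t : smooth_on W (fun y => A ^+ 2 * t y).
Proof. by apply: smooth_onM => //; [exact: smooth_on_cst | exact: smooth_energy]. Qed.

Let At_neq0 y : W y -> A * t y != 0.
Proof. by move=> Wy; rewrite mulf_neq0 ?gt_eqF // energy_gt0. Qed.

Let smooth_Glow : smooth_mx W Glow.
Proof.
apply: smooth_mxD => //; apply: smooth_mxZ => //.
- exact: smooth_gq.
- apply: smooth_onM => //; last exact: smooth_onV.
  by apply: smooth_onB => //; exact: smooth_on_cst.
- apply: smooth_mxM => //; last exact: smooth_momentum.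
  by apply: smooth_mx_tr; exact: smooth_momentum.
Qed.

Let smooth_Hup : smooth_mx W Hup.
Proof.
apply: smooth_mxB => //; apply: smooth_mxZ => //.
- exact: smooth_onV.
- exact: smooth_gI.
- apply: smooth_onM => //; first by apply: smooth_onB => //; exact: smooth_on_cst.
  apply: smooth_onV => // [|y Wy].
    apply: smooth_onM => //; last by apply: smooth_onB => //; exact: smooth_on_cst.
    apply: smooth_onM => //; first exact: smooth_on_cst.
    by apply: smooth_onM => //; exact: smooth_energy.
  apply: mulf_neq0; last by rewrite gt_eqF // energy_bound.
  by apply: mulf_neq0; [rewrite gt_eqF | rewrite expf_neq0 // gt_eqF // energy_gt0].
- apply: smooth_mxM => //; last exact: smooth_pu.
  by apply: smooth_mx_tr; exact: smooth_pu.
Qed.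

Lemma smooth_tube_metric : smooth_mx W h.
Proof.
have -> : h = fun y => frame_inv y *m block_mx (Glow y) 0 0 (Hup y) *m (frame_inv y)^T.
  by apply/funext => y; rewrite hE.
apply: smooth_mxM => //; last exact: smooth_mx_tr.
by apply: smooth_mxM => //; apply: smooth_mx_block => //; exact: smooth_mx_cst.
Qed.

Lemma smooth_tube_J : smooth_mx W J.
Proof.
have -> : J = fun y => frame_inv y *m block_mx 0 (Glow y) (- Hup y) 0 *m adapted_frame g i y.
  by apply/funext => y; rewrite JE.
apply: smooth_mxM => //; apply: smooth_mxM => //.
by apply: smooth_mx_block => //; try exact: smooth_mx_cst; exact: smooth_mxN.
Qed.

Let GH y : W y -> Glow y *m Hup y = 1%:M.
Proof.
move=> Wy; apply: (@Glow_Hup _ _ (gq y) (p y) c A (t y)) => //.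
- exact/unit_g/WW0.
- exact/sym_g/WW0.
- exact: energy_gt0.
- exact: energy_bound.
Qed.

Let HG y : W y -> Hup y *m Glow y = 1%:M.
Proof. by move=> Wy; apply: mulmx1C; exact: GH. Qed.

Let Gsym y : W y -> (Glow y)^T = Glow y.
Proof. by move=> Wy; apply: (@Glow_sym _ _ (gq y) (p y) c A (t y)) => //; exact/sym_g/WW0. Qed.

Let Hsym y : W y -> (Hup y)^T = Hup y.
Proof. by move=> Wy; apply: (@Hup_sym _ _ (gq y) (p y) c A (t y)) => //; exact/sym_g/WW0. Qed.

Let frameK y : adapted_frame g i y *m frame_inv y = 1%:M.
Proof. by apply: mulmx1C; exact: adapted_frame_inv. Qed.

Lemma tube_metric_unit y : W y -> h y \in unitmx.
Proof.
move=> Wy; rewrite hE !unitmx_mul unitmx_tr.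
have -> : frame_inv y \in unitmx by have /mulmx1_unit[] := frameK y.
rewrite andbT /=; have /mulmx1_unit[] // : block_mx (Glow y) 0 0 (Hup y)
    *m block_mx (Hup y) 0 0 (Glow y) = 1%:M.
by rewrite mulmx_block !mulmx0 !mul0mx !addr0 !add0r GH // HG // -scalar_mx_block.
Qed.

Lemma tube_metric_sym y : W y -> (h y)^T = h y.
Proof.
move=> Wy; rewrite hE !trmx_mul trmxK tr_block_mx !trmx0 Gsym // Hsym //.
by rewrite mulmxA.
Qed.

Lemma tube_J_square y : W y -> J y *m J y = - 1%:M.
Proof.
move=> Wy; rewrite JE -!mulmxA [adapted_frame g i y *m _]mulmxA frameK mul1mx.
have E : block_mx 0 (Glow y) (- Hup y) 0 *m block_mx 0 (Glow y) (- Hup y) 0 = - 1%:M.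
  rewrite mulmx_block !mulmx0 !mul0mx addr0 !add0r addr0 mulmxN mulNmx GH // HG //.
  by rewrite [in RHS]scalar_mx_block opp_block_mx !oppr0.
rewrite (mulmxA (block_mx 0 _ _ 0) (block_mx 0 _ _ 0)) E.
by rewrite mulNmx mul1mx mulmxN adapted_frame_inv.
Qed.

Lemma tube_hermitian y : W y -> J y *m h y *m (J y)^T = h y.
Proof.
move=> Wy; rewrite JE hE !trmx_mul !mulmxA.
rewrite -[_ *m adapted_frame g i y *m frame_inv y]mulmxA frameK mulmx1.
rewrite -[_ *m (frame_inv y)^T *m (adapted_frame g i y)^T]mulmxA -trmx_mul frameK trmx1 mulmx1.
congr (_ *m _); rewrite -!mulmxA; congr (_ *m _).
have E : block_mx 0 (Glow y) (- Hup y) 0 *m block_mx (Glow y) 0 0 (Hup y)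
    = block_mx 0 1%:M (- 1%:M) 0.
  by rewrite mulmx_block !mulmx0 !mul0mx addr0 !add0r addr0 mulNmx GH // HG.
have E' : block_mx 0 1%:M (- 1%:M) 0 *m (block_mx 0 (Glow y) (- Hup y) 0)^T
    = block_mx (Glow y) 0 0 (Hup y).
  rewrite tr_block_mx !trmx0 trmxN Gsym // Hsym // mulmx_block.
  by rewrite !mulmx0 !mul0mx addr0 !add0r addr0 mulNmx !mul1mx opprK.
by rewrite (mulmxA (block_mx 0 _ _ 0) (block_mx _ 0 0 _)) E E'.
Qed.

(** In the adapted frame the fundamental form is the standard symplectic matrix, because [Glow] and
    [Hup] are inverse to each other. *)
Let J_skew y : W y -> h y *m (J y)^T = - (h y *m (J y)^T)^T.
Proof.
move=> Wy.
have -> : h y *m (J y)^T = frame_inv y *m block_mx 0 (- 1%:M) 1%:M 0 *m (frame_inv y)^T.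
  rewrite JE hE !trmx_mul !mulmxA.
  rewrite -[_ *m (frame_inv y)^T *m (adapted_frame g i y)^T]mulmxA -trmx_mul frameK trmx1 mulmx1.
  congr (_ *m _); rewrite -mulmxA; congr (_ *m _).
  rewrite tr_block_mx !trmx0 linearN /= Gsym // Hsym // mulmx_block.
  by rewrite !mulmx0 !mul0mx addr0 addr0 add0r mulmxN GH // HG.
have E : - (block_mx 0 (- 1%:M) 1%:M 0)^T = block_mx 0 (- 1%:M) 1%:M 0 :> 'M[R]_(n + n).
  by rewrite tr_block_mx !trmx0 trmxN !trmx1 opp_block_mx !oppr0 opprK.
by rewrite !trmx_mul trmxK mulmxA -mulNmx -mulmxN E.
Qed.

Let plane_shift_sum y (v : 'I_(n + n) -> R) (w : 'I_(n + n) -> 'rV[R]_(n + n)) :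
  \sum_b v b *: plane_shift (gq y) (p y) c A (t y) (w b)
  = plane_shift (gq y) (p y) c A (t y) (\sum_b v b *: w b).
Proof.
have L := plane_shift_linear (gq y) (p y) c A (t y).
have L0 : plane_shift (gq y) (p y) c A (t y) 0 = 0.
  by have := L (- 1) 0 0; rewrite scaler0 addr0 scaleN1r addNr.
elim: (index_enum _) => [|b r IH]; first by rewrite !big_nil L0.
by rewrite !big_cons L IH.
Qed.

Let entry_rows (P Q P' : 'M[R]_(n + n)) a b :
  (P *m Q *m P'^T) a b = (row a P *m Q *m (row b P')^T) 0 0.
Proof. by rewrite -row_mul [LHS]mxE [RHS]mxE; apply: eq_bigr => k _; rewrite !mxE. Qed.

Let h_V y a b : W y -> h y a b
  = (A * t y)^-1 * \tr (V a y *m bundle_metric y *m (V b y)^T).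
Proof.
move=> Wy; rewrite hE entry_rows; apply: plane_shift_metric => //.
- exact/unit_g/WW0.
- exact/sym_g/WW0.
- exact: energy_gt0.
- exact: energy_bound.
Qed.

Let J_V y a : W y -> \sum_b J y a b *: V b y = rot *m V a y.
Proof.
move=> Wy; rewrite plane_shift_sum.
rewrite -(@plane_shift_rot _ _ (gq y) (p y) c A (t y) _ _ _ _ _ _ (Glow y) (Hup y)) //; last 4 first.
- exact/unit_g/WW0.
- exact/sym_g/WW0.
- exact: energy_gt0.
- exact: energy_bound.
congr plane_shift.
have -> : \sum_b J y a b *: row b (frame_inv y) = row a (J y *m frame_inv y).
  by apply/rowP => k; rewrite summxE !mxE; apply: eq_bigr => b _; rewrite !mxE.
by rewrite JE -mulmxA frameK mulmx1 row_mul.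
Qed.

(** The coordinate fields span all directions, so by linearity orthogonality to the [V k] extends to
    the shift in any adapted direction [w]. *)
Let V_nondegenerate y (Z : 'M[R]_(1 + 1, n + 1 + 1)) : W y ->
  Z *m bundle_metric y *m (U y)^T = 0 ->
  (forall k, \tr (Z *m bundle_metric y *m (V k y)^T) = 0) -> Z = 0.
Proof.
move=> Wy Z1 Z2.
apply: (@plane_shift_nondegenerate _ _ (gq y) (p y) c A (t y)) => //.
- exact/unit_g/WW0.
- exact/sym_g/WW0.
- exact: energy_gt0.
- exact: energy_bound.
move=> w.
have -> : w = \sum_b (w *m adapted_frame g i y) 0 b *: row b (frame_inv y).
  rewrite -[LHS]mulmx1 -(frameK y) mulmxA; apply/rowP => k.
  by rewrite summxE mxE; apply: eq_bigr => b _; rewrite !mxE.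
rewrite -plane_shift_sum linear_sum /= mulmx_sumr raddf_sum big1 // => b _ /=.
by rewrite trmxZ -scalemxAr mxtraceZ Z2 mulr0.
Qed.

Let V_orth y k : W y -> V k y *m bundle_metric y *m (U y)^T = 0.
Proof.
move=> Wy; apply: plane_shift_orth => //.
- exact/unit_g/WW0.
- exact/sym_g/WW0.
- exact: energy_gt0.
- exact: energy_bound.
Qed.

Let gram_U y : W y -> U y *m bundle_metric y *m (U y)^T = (2 * t y)%:M.
Proof. by move=> Wy; apply: plane_gram => //; exact/unit_g/WW0. Qed.

Let bundle_metric_sym y : W y -> (bundle_metric y)^T = bundle_metric y.
Proof. by move=> Wy; apply: model_metric_sym; exact/sym_g/WW0. Qed.

Let bundle_metric_unit y : W y -> bundle_metric y \in unitmx.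
Proof.
move=> Wy; apply: model_metric_unit => //; first exact/unit_g/WW0.
  exact: energy_gt0.
exact: energy_bound.
Qed.

Let t_neq0 y : W y -> t y != 0.
Proof. by move=> Wy; rewrite gt_eqF // energy_gt0. Qed.

Let A_neq0 : A != 0. Proof. by rewrite gt_eqF. Qed.

Let par := fun y a Wy => @bundle_metric_parallel y a Wy.

Lemma tube_chart_locally_symmetric y s l k a b : W y -> nabla_curvature h s l k a b y = 0.
Proof.
exact: (fun Wy => plane_locally_symmetric oW smooth_bundle_connection bundle_flat
  smooth_bundle_metric smooth_U smooth_energy par bundle_metric_sym t_neq0 gram_U dU V_orth
  A_neq0 smooth_tube_metric tube_metric_unit h_V V_nondegenerate s l k a b Wy).
Qed.

(** The rank is N = n + 2, so the constant equals n A / 2. *)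
Lemma tube_chart_einstein y a b : W y -> ricci h a b y
  = A * ((n + 1 + 1)%:R / 2 - 1) * h y a b.
Proof.
exact: (fun Wy => plane_einstein oW smooth_bundle_connection bundle_flat
  smooth_bundle_metric smooth_U smooth_energy par bundle_metric_unit bundle_metric_sym
  t_neq0 gram_U dU V_orth
  A_neq0 smooth_tube_metric tube_metric_unit h_V V_nondegenerate a b Wy).
Qed.

Lemma tube_chart_integrable y k a b : W y -> nijenhuis J k a b y = 0.
Proof.
exact: (fun Wy => plane_integrable oW smooth_bundle_connection bundle_flat
  smooth_bundle_metric smooth_U smooth_energy par bundle_metric_sym t_neq0 gram_U dU V_orth
  A_neq0 tube_metric_unit h_V V_nondegenerate smooth_tube_J J_V k a b Wy).
Qed.

Lemma tube_chart_closed y a b k : W y -> d_form2 (fundamental_form h J) a b k y = 0.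
Proof.
exact: (fun Wy => plane_fundamental_form_closed oW smooth_bundle_connection bundle_flat
  smooth_bundle_metric smooth_U smooth_energy par bundle_metric_sym t_neq0 gram_U dU V_orth
  A_neq0 smooth_tube_metric tube_metric_unit h_V V_nondegenerate smooth_tube_J J_V a b k
  J_skew Wy).
Qed.

End TubeChart.

(** * Charts and changes of charts *)

Lemma second_countable_rV (R : realType) m : @second_countable 'rV[R]_m.
Proof.
pose f (u : 'rV[rat]_m * nat) : set 'rV[R]_m := ball (map_mx (@ratr R) u.1 : 'rV[R]_m) u.2.+1%:R^-1.
exists (range f); first exact: sub_countable (card_image_le f _) (countableP _).
split=> [_ [u _ <-]|x V /nbhs_ballP[e /= e0 xeV]]; first exact: ball_open.
have e20 : 0 < e / 2 by rewrite divr_gt0.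
have [N] := ltr_add_invr e20; rewrite add0r => Ne.
have aP l : exists a : rat, ball (x 0 l) N.+1%:R^-1 (ratr a : R).
  have := @dense_rat R (ball (x 0 l) N.+1%:R^-1); case.
  - by exists (x 0 l); exact: ballxx.
  - exact: ball_open.
  - by move=> z [xz [a _ za]]; exists a; rewrite za.
pose a : 'rV[rat]_m := \row_l projT1 (cid (aP l)).
have xa : ball x N.+1%:R^-1 (map_mx ratr a : 'rV[R]_m).
  split=> // i l; rewrite (ord1 i) !mxE; exact: projT2 (cid (aP l)).
exists (f (a, N)); first by split; [exists (a, N) | exact: ball_sym].
move=> y ay; apply: xeV; rewrite (splitr e).
by apply: (ball_triangle (le_ball (ltW Ne) xa)); apply: le_ball (ltW Ne) _ _.
Qed.

Section ManifoldTopology.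
Context {R : realType} {m : nat} (X : atlas R m).
Local Notation S := (manifold_space X).
Implicit Types (i j : idx X) (x : pt X).

Lemma open_chart_preimage i (O : set 'rV[R]_m) :
  open O -> open (dom i `&` chart i @^-1` O : set S).
Proof.
move=> oO; exists [set (dom i `&` chart i @^-1` O : set S)].
  by move=> _ ->; apply: (@finI_from1 _ _ _ id); exists i, O.
by rewrite bigcup_set1.
Qed.

Hypothesis chart_inj : forall i x y, dom i x -> dom i y -> chart i x = chart i y -> x = y.

Lemma transitionE i j x : dom i x -> dom j x -> transition i j (chart i x) = chart j x.
Proof.
move=> ix jx; rewrite /transition; case: xgetP => [z -> [x' [ix' jx' xx' <-]]|].
  by rewrite (chart_inj ix' ix xx').
by move=> /(_ (chart j x)); case; exists x.
Qed.

Hypothesis open_overlap : forall i j, open (chart i @` (dom i `&` dom j)).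
Hypothesis continuous_transition : forall i j y, (chart i @` (dom i `&` dom j)) y ->
  {for y, continuous (transition i j)}.

(** Charts are open maps onto their images: around [x], an open set contains a finite intersection
    of subbasic sets, and a subbasic set of another chart is seen in the chart [i] through the
    continuous transition map. Induction on the list of subbasic sets then intersects finitely many
    open sets. *)
Lemma open_manifold_space (V : set S) i x : open V -> V x -> dom i x ->
  exists O : set 'rV[R]_m, [/\ open O, O (chart i x) & dom i `&` chart i @^-1` O `<=` V].
Proof.
case=> D sD <- [b Db bx] ix.
have [F FD bE] := sD b Db.
have H : forall s : seq (set S), (forall v, v \in s -> v x /\
       exists j (O : set 'rV[R]_m), open O /\ v = dom j `&` chart j @^-1` O) ->
   exists O : set 'rV[R]_m, [/\ open O, O (chart i x)
     & forall v, v \in s -> dom i `&` chart i @^-1` O `<=` v].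
  elim=> [|v s IH] sF.
    by exists setT; split => //; exact: openT.
  have [|O [oO Ox Os]] := IH.
    by move=> w ws; apply: sF; rewrite inE ws orbT.
  have [vx [j [P [oP vE]]]] := sF v (mem_head _ _).
  pose W := chart i @` (dom i `&` dom j) `&` transition i j @^-1` P.
  move: vx; rewrite vE => -[jx Px].
  have oW : open W.
    rewrite openE => y [Wy Py]; apply: filterI.
      by apply: open_nbhs_nbhs; split=> //; exact: open_overlap.
    apply: (continuous_transition Wy).
    by apply: open_nbhs_nbhs.
  exists (O `&` W); split; first exact: openI.
    split=> //; split; first by exists x.
    by rewrite /= transitionE.
  move=> w; rewrite inE => /orP[/eqP ->|ws] z [iz [Oz [[z' [iz' jz'] zz'] Pz]]].
    have zE := chart_inj iz' iz zz'; rewrite zE in jz'.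
    by split=> //; rewrite /= -(transitionE iz jz').
  by apply: (Os w ws).
have [|O [oO Ox Os]] := H (finmap.enum_fset F).
  move=> v vF; split; first by move: bx; rewrite -bE; exact.
  by have := FD v vF; rewrite inE.
exists O; split=> // z Oz; exists b => //.
by apply: (eq_ind _ (fun V : set S => V z) _ _ bE) => v vF; exact: (Os v).
Qed.

Lemma second_countable_manifold_space (C : set (idx X)) : countable C ->
  (forall x, exists2 i, C i & dom i x) -> @second_countable S.
Proof.
move=> cC coverC.
have [B cB [oB bB]] := @second_countable_rV R m.
exists [set V | exists i O, [/\ C i, B O & V = (dom i `&` chart i @^-1` O : set S)]].
  apply: (@sub_countable _ _ _ (C `*` B)); last exact: countableX.
  apply: card_le_trans (card_image_le (fun u : idx X * set 'rV[R]_m =>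
    (dom u.1 `&` chart u.1 @^-1` u.2 : set S)) _).
  apply: subset_card_le => _ [i [P [Ci BP ->]]].
  by exists (i, P).
split=> [_ [i [P [Ci BP ->]]]|x V].
  by apply: open_chart_preimage; exact: oB.
rewrite nbhsE => -[V' [oV' V'x] sV].
have [i Ci ix] := coverC x.
have [P [oP Px PV]] := open_manifold_space oV' V'x ix.
have [P' [BP' P'x] P'P] : (filter_from [set U | B U /\ U (chart i x)] id) P.
  apply: bB; by apply: open_nbhs_nbhs.
exists (dom i `&` chart i @^-1` P' : set S).
  by split => //; exists i, P'.
by move=> z [iz P'z]; apply/sV/PV; split => //; exact: P'P.
Qed.

End ManifoldTopology.

(** A Lindelöf argument, since the index type of an atlas may be uncountable: one chart is chosen
    for each basic open set that fits into a chart domain. *)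
Lemma countable_chart_cover (R : realType) m (X : atlas R m) :
  (forall x : pt X, exists i, dom i x) -> @second_countable (manifold_space X) ->
  exists2 C : set (idx X), countable C & forall x, exists2 i, C i & dom i x.
Proof.
move=> cover [B cB [oB bB]].
have open_dom (i : idx X) : open (dom i : set (manifold_space X)).
  by have := @open_chart_preimage _ _ X i setT openT; rewrite preimage_setT setIT.
have [x0|] := pselect (exists x : pt X, True); last first.
  by move=> nx; exists set0 => // x; case: nx; exists x.
have [x1 _] := x0; have [i0 _] := cover x1.
(* The chart [i0] is a default value for basic sets contained in no chart domain; its existence is
   why the empty manifold is treated apart. *)
pose F (V : set (manifold_space X)) : idx X :=
  if pselect (exists i, V `<=` dom i) is left P then projT1 (cid P) else i0.
exists (F @` B); first exact: sub_countable (card_image_le F _) cB.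
move=> x; have [i ix] := cover x.
have [V [BV Vx] Vi] : (filter_from [set U | B U /\ U x] id) (dom i : set (manifold_space X)).
  by apply: bB; apply: open_nbhs_nbhs.
exists (F V); first by exists V.
rewrite /F; case: pselect => [P|[]]; last by exists i.
by apply: (projT2 (cid P)).
Qed.

Section Transition.
Context {R : realType} {m : nat} (X : atlas R m).
Hypothesis manifold_X : smooth_manifold X.
Implicit Types (i j k : idx X) (x : pt X).
Local Notation overlap i j := (chart i @` (dom i `&` dom j)).

Lemma open_chart_image i : open (chart_image i).
Proof. by have := @sm_open _ _ _ manifold_X i i; rewrite setIid. Qed.

Lemma smooth_transition i j : smooth_mx (overlap i j) (transition i j).
Proof. by move=> a b; rewrite (ord1 a); exact: sm_smooth. Qed.

Lemma differentiable_transition i j y : overlap i j y -> differentiable (transition i j) y.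
Proof.
by move=> Wy; apply: differentiable_rV => l; exact: (smooth_mx_diff (@smooth_transition i j) Wy).
Qed.

Lemma continuous_transition i j y : overlap i j y -> {for y, continuous (transition i j)}.
Proof. by move=> /differentiable_transition; exact: differentiable_continuous. Qed.

Lemma smooth_jacobian i j : smooth_mx (overlap i j) (jacobian (transition i j)).
Proof.
have oW := @sm_open _ _ _ manifold_X i j.
have sD : smooth_mx (overlap i j)
    (fun y => \matrix_(a, b) partial a (fun y => transition i j y 0 b) y).
  move=> a b; under eq_fun do rewrite mxE.
  by apply: smooth_on_partial; exact: sm_smooth.
apply: (eq_smooth_mx oW) sD => y; rewrite inE => Wy; apply/matrixP => a b.
by rewrite mxE jacobianE //; exact: differentiable_transition.
Qed.

Lemma overlap_chart i j x : dom i x -> dom j x -> overlap i j (chart i x).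
Proof. by move=> ix jx; exists x. Qed.

Lemma transition_jacobian_def i j x :
  transition_jacobian i j x = jacobian (transition i j) (chart i x).
Proof. by []. Qed.

Lemma transition_jacobianE i j x a b : dom i x -> dom j x ->
  transition_jacobian i j x a b = partial a (fun y => transition i j y 0 b) (chart i x).
Proof.
by move=> ix jx; apply: jacobianE; apply: differentiable_transition; exact: overlap_chart.
Qed.

Opaque transition_jacobian.

Let trE := transitionE (sm_chart_inj manifold_X).

Lemma transition_jacobian_id i x : dom i x -> transition_jacobian i i x = 1%:M.
Proof.
move=> ix; have Wx := overlap_chart ix ix.
apply/matrixP => a b; rewrite transition_jacobianE //.
rewrite (@eq_partial _ _ (overlap i i) _ (fun y => y 0 b)) //.
- by rewrite partial_coord mxE.
- exact: sm_open.
- by move=> y; rewrite inE => -[z [iz _] <-]; rewrite trE.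
Qed.

Lemma transition_jacobian_mul i j k x : dom i x -> dom j x -> dom k x ->
  transition_jacobian i k x = transition_jacobian i j x *m transition_jacobian j k x.
Proof.
move=> ix jx kx; have Wij := overlap_chart ix jx; have Wik := overlap_chart ix kx.
have Wjk := overlap_chart jx kx.
(* [transition] has the default value 0 off the overlaps, so the cocycle identity is available only
   on this neighbourhood. *)
pose W := overlap i k `&` overlap i j.
have oW : open W by apply: openI; exact: sm_open.
apply/matrixP => a b; rewrite transition_jacobianE //.
rewrite (@eq_partial _ _ W _ (fun y => transition j k (transition i j y) 0 b)) //; last first.
  move=> y; rewrite inE => -[[z [iz kz] zy] [z' [iz' jz'] z'y]].
  have zz' : z' = z by apply: (sm_chart_inj manifold_X iz' iz); rewrite zy.
  by rewrite zz' in jz'; rewrite -zy (trE iz kz) (trE iz jz') (trE jz' kz).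
rewrite (partial_comp (h := fun z => transition j k z 0 b) (phi := transition i j)).
- rewrite mxE; apply: eq_bigr => l _.
  rewrite (trE ix jx).
  exact: (f_equal2 (fun u v : R => u * v) (esym (transition_jacobianE a l ix jx))
    (esym (transition_jacobianE l b jx kx))).
- by move=> l; exact: (smooth_mx_diff (@smooth_transition i j) Wij).
- by rewrite (trE ix jx); exact: (smooth_mx_diff (@smooth_transition j k) Wjk).
Qed.

Lemma transition_jacobianK i j x : dom i x -> dom j x ->
  transition_jacobian i j x *m transition_jacobian j i x = 1%:M.
Proof. by move=> ix jx; rewrite -transition_jacobian_mul // transition_jacobian_id. Qed.

Lemma transition_jacobian_unit i j x : dom i x -> dom j x ->
  transition_jacobian i j x \in unitmx.
Proof. by move=> ix jx; have [u _] := mulmx1_unit (transition_jacobianK ix jx); exact: u. Qed.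

Lemma invmx_transition_jacobian i j x : dom i x -> dom j x ->
  invmx (transition_jacobian i j x) = transition_jacobian j i x.
Proof.
move=> ix jx; rewrite -[RHS]mul1mx -(mulVmx (transition_jacobian_unit ix jx)) -mulmxA.
by rewrite transition_jacobianK // mulmx1.
Qed.

End Transition.

Lemma posdef_unit (R : realType) m (B : 'M[R]_m) :
  (forall v : 'rV[R]_m, v != 0 -> 0 < bilin B v v) -> B \in unitmx.
Proof.
move=> pB; rewrite -row_free_unit; apply: inj_row_free => v vB.
by apply: contraTeq isT => /pB; rewrite /bilin vB mul0mx mxE ltxx.
Qed.

Lemma dmx_comp (R : realType) m n p q (phi : 'rV[R]_m -> 'rV[R]_n)
    (F : 'rV[R]_n -> 'M[R]_(p, q)) k x :
  differentiable_mx phi x -> differentiable_mx F (phi x) ->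
  dmx k (fun y => F (phi y)) x
  = \sum_(l < n) partial k (fun y => phi y 0 l) x *: dmx l F (phi x).
Proof.
move=> dphi dF; apply/matrixP => a b; rewrite dmxE summxE.
rewrite (partial_comp (phi := phi) (h := fun z => F z a b)) => [|l|].
- by apply: eq_bigr => l _; rewrite [RHS]mxE dmxE.
- exact: dphi.
- exact: dF.
Qed.

(** * Transformation law of the Christoffel symbols *)

Section ChristoffelTransformation.
Context {R : realType} {m : nat}.
Variables (W W' : set 'rV[R]_m) (phi : 'rV[R]_m -> 'rV[R]_m).
Variables (T h h' : 'rV[R]_m -> 'M[R]_m).
Hypotheses (oW : open W) (oW' : open W') (phiW : forall y, W y -> W' (phi y)).
Hypotheses (smooth_phi : smooth_mx W phi) (smooth_T : smooth_mx W T).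
Hypotheses (smooth_h' : smooth_mx W' h').
Hypothesis TE : forall y a b, W y -> T y a b = partial a (fun y => phi y 0 b) y.
Hypothesis hT : forall y, W y -> h y = T y *m h' (phi y) *m (T y)^T.
Hypothesis sym_h : forall y, W y -> (h y)^T = h y.
Hypothesis unit_h : forall y, W y -> h y \in unitmx.
Hypothesis sym_h' : forall y, W' y -> (h' y)^T = h' y.
Hypothesis unit_h' : forall y, W' y -> h' y \in unitmx.

Lemma metric_transition_unit y : W y -> T y \in unitmx.
Proof.
move=> Wy; have := unit_h Wy; rewrite hT // !unitmx_mul => /andP[/andP[uT _] _].
exact: uT.
Qed.

(** By uniqueness again: the coefficients [C] prescribed by the transformation law are symmetric,
    because second derivatives of [phi] commute, and compatible with [h], by differentiating
    [hT]. *)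
Lemma christoffel_transition a y : W y ->
  christoffel_mx h a y *m T y
  = dmx a T y + T y *m \sum_b T y a b *: christoffel_mx h' b (phi y).
Proof.
move=> Wy; have uT := metric_transition_unit Wy; have W'y := phiW Wy.
pose G' a : 'M[R]_m := \sum_b T y a b *: christoffel_mx h' b (phi y).
pose C a := (dmx a T y + T y *m G' a) *m invmx (T y).
suff CE : C a = christoffel_mx h a y by rewrite -CE /C mulmxKV.
have symC b k l : C b k l = C k b l.
  have E : row k (dmx b T y + T y *m G' b) = row b (dmx k T y + T y *m G' k).
    have P (u v : 'I_m) w : partial u (fun z => T z v w) y
        = partial u (partial v (fun z => phi z 0 w)) y.
      by apply: (eq_partial u oW Wy) => z; rewrite inE => Wz; exact: TE.
    have G (u v : 'I_m) w : (T y *m G' u) v w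
        = \sum_e \sum_d T y v d * (T y u e * christoffel h' w e d (phi y)).
      rewrite exchange_big mxE; apply: eq_bigr => d _.
      by rewrite summxE mulr_sumr; apply: eq_bigr => e _; rewrite !mxE.
    apply/rowP => w; rewrite [LHS]mxE [RHS]mxE [LHS]mxE [RHS]mxE !dmxE !G !P.
    apply: (f_equal2 (fun u v : R => u + v)).
      exact: (partialC b k oW (smooth_phi 0 w) Wy).
    rewrite exchange_big; apply: eq_bigr => d _; apply: eq_bigr => e _.
    rewrite (christoffelC oW' sym_h' w e d W'y).
    by rewrite mulrCA.
  have := congr1 (fun r => (r *m invmx (T y)) 0 l) E.
  by rewrite -!row_mul [LHS]mxE [RHS]mxE.
have dh b : dmx b h y = C b *m h y + h y *m (C b)^T.
  rewrite (@eq_dmx _ _ W _ _ _ h (fun z => T z *m h' (phi z) *m (T z)^T)) //; last first.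
    by move=> z; rewrite inE => /hT.
  have dT := smooth_mx_diff smooth_T Wy.
  have dT' := smooth_mx_diff (smooth_mx_tr smooth_T) Wy.
  have sh : smooth_mx W (fun z => h' (phi z)).
    move=> u v; apply: (smooth_on_comp oW (smooth_h' u v) phiW) => w.
    exact: smooth_phi.
  have dh := smooth_mx_diff sh Wy.
  rewrite (dmxM b (differentiable_mxM dT dh) dT') (dmxM b dT dh) dmx_tr.
  have -> : dmx b (fun z => h' (phi z)) y = G' b *m h' (phi y) + h' (phi y) *m (G' b)^T.
    rewrite (dmx_comp b (smooth_mx_diff smooth_phi Wy)
      (smooth_mx_diff smooth_h' W'y)).
    rewrite /G' mulmx_suml raddf_sum mulmx_sumr -big_split; apply: eq_bigr => l _.
    rewrite -TE // (christoffel_metric oW' sym_h' unit_h' l W'y) /= trmxZ.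
    by rewrite -scalemxAl -scalemxAr -scalerDr.
  rewrite hT // /C; move: (dmx b T y) (G' b) => D Gb.
  rewrite !trmx_mul !trmxD !trmx_mul !mulmxA.
  rewrite -[(D + T y *m Gb) *m invmx (T y) *m T y]mulmxA mulVmx // mulmx1.
  have -> : T y *m h' (phi y) *m (T y)^T *m (invmx (T y))^T = T y *m h' (phi y).
    by rewrite -[LHS]mulmxA -trmx_mul mulVmx // trmx1 mulmx1.
  move: (h' (phi y)) (T y) => H S; mx_expand; mx_ring.
apply/matrixP => k l; rewrite [RHS]mxE.
exact: (christoffel_koszul sym_h unit_h (C := C) Wy symC dh).
Qed.

End ChristoffelTransformation.

(** * Changes of charts of the cotangent bundle *)

Section CotangentTransition.
Context {R : realType} {n : nat} (M : atlas R n) (g : field2 M).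
Hypotheses (manifold_M : smooth_manifold M) (metric_g : riemannian_metric g).
Implicit Types (i j : idx M) (x : pt M) (y : 'rV[R]_(n + n)).
Local Notation overlap i j := (chart i @` (dom i `&` dom j)).

Lemma metric_sym i q : chart_image i q -> (g i q)^T = g i q.
Proof. exact: rm_sym. Qed.

Lemma metric_unit i q : chart_image i q -> g i q \in unitmx.
Proof. by move=> iq; apply: posdef_unit => v; exact: rm_pos. Qed.

Lemma metric_smooth i : smooth_mx (chart_image i) (g i).
Proof. by move=> a b; exact: rm_smooth. Qed.

Lemma overlap_image i j q : overlap i j q -> chart_image i q.
Proof. by case=> x [ix _] <-; exists x. Qed.

Lemma transition_image i j q : overlap i j q -> chart_image j (transition i j q).
Proof.
case=> x [ix jx] <-; rewrite (transitionE (sm_chart_inj manifold_M)) //.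
by exists x.
Qed.

Lemma jacobian_transition i j q : overlap i j q -> jacobian (transition i j) q \in unitmx.
Proof.
case=> x [ix jx] <-; rewrite -transition_jacobian_def.
exact: (transition_jacobian_unit manifold_M).
Qed.

Lemma metric_transition i j q : overlap i j q ->
  g i q = jacobian (transition i j) q *m g j (transition i j q)
          *m (jacobian (transition i j) q)^T.
Proof.
case=> x [ix jx] <-; rewrite -transition_jacobian_def.
by rewrite (transitionE (sm_chart_inj manifold_M)) // (rm_tensor metric_g ix jx).
Qed.

Definition cotangent_transition i j y : 'rV[R]_(n + n) :=
  row_mx (transition i j (lsubmx y))
    (rsubmx y *m (invmx (jacobian (transition i j) (lsubmx y)))^T).

Let W i j : set 'rV[R]_(n + n) := [set y | overlap i j (lsubmx y)].

Let oW i j : open (W i j).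
Proof.
apply: (@open_comp _ _ (fun y : 'rV[R]_(n + n) => lsubmx y : 'rV[R]_n)) => [y _|].
  exact/differentiable_continuous/differentiable_lsubmx.
exact: sm_open.
Qed.

Lemma smooth_inv_jacobian i j :
  smooth_mx (overlap i j) (fun q => invmx (jacobian (transition i j) q)).
Proof.
apply: smooth_mx_inv.
- exact: sm_open.
- exact: smooth_jacobian.
- exact: jacobian_transition.
Qed.

Let WW i j y : W i j y -> overlap i j (lsubmx y). Proof. by []. Qed.

Lemma smooth_cotangent_transition i j : smooth_mx (W i j) (cotangent_transition i j).
Proof.
apply: smooth_mx_row.
  exact: (smooth_mx_lsub (@oW i j) (@WW i j) (@smooth_transition _ _ _ manifold_M i j)).
apply: (smooth_mxM (@oW i j)); first exact: (smooth_mx_rsub (@oW i j)).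
apply: smooth_mx_tr.
exact: (smooth_mx_lsub (@oW i j) (@WW i j) (@smooth_inv_jacobian i j)).
Qed.

Section Point.
Variables (i j : idx M) (y : 'rV[R]_(n + n)).
Hypothesis Wy : overlap i j (lsubmx y).
Let q := lsubmx y : 'rV[R]_n.
Let p := rsubmx y : 'rV[R]_n.
Let y' := cotangent_transition i j y.
Let T := jacobian (transition i j) q.
Let S : 'M[R]_n := invmx T.
Let uT : T \in unitmx. Proof. exact: jacobian_transition. Qed.

Let momentum' : momentum y' = p *m S^T.
Proof. exact: row_mxKr. Qed.

Let metric' : metric_at g j y' = g j (transition i j q).
Proof. by rewrite /metric_at /y' /cotangent_transition row_mxKl. Qed.

Let metricE : metric_at g i y = T *m metric_at g j y' *m T^T.
Proof. by rewrite metric' /T -metric_transition. Qed.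

Let unit' : metric_at g j y' \in unitmx.
Proof. by rewrite metric'; apply: metric_unit; exact: transition_image. Qed.

Let inv_metric : invmx (metric_at g i y) = S^T *m invmx (metric_at g j y') *m S.
Proof.
apply: (can_inj (mulmxK (_ : metric_at g i y \in unitmx))).
  by rewrite metricE !unitmx_mul unitmx_tr uT unit'.
rewrite mulVmx; last by rewrite metricE !unitmx_mul unitmx_tr uT unit'.
rewrite metricE !mulmxA mulmxKV // mulmxKV // -trmx_mul /S.
by rewrite mulmxV // trmx1.
Qed.

Lemma momentum_up_transition : momentum_up g i y = momentum_up g j y' *m S.
Proof. by rewrite /momentum_up inv_metric momentum' !mulmxA. Qed.

Lemma norm_sq_transition : norm_sq g i y = norm_sq g j y'.
Proof.
by rewrite /norm_sq /bilin inv_metric momentum' trmx_mul trmxK !mulmxA.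
Qed.

Lemma energy_transition : energy g i y = energy g j y'.
Proof. by rewrite /energy norm_sq_transition. Qed.

Lemma G_low_transition c A : G_low g c A i y = T *m G_low g c A j y' *m T^T.
Proof.
rewrite /G_low energy_transition metricE momentum' mulmxDr mulmxDl -!scalemxAr -!scalemxAl.
congr (_ + _ *: _); rewrite trmx_mul trmxK /S -/p /momentum.
have K : (invmx T)^T *m T^T = 1%:M by rewrite -trmx_mul mulmxV // trmx1.
by rewrite !mulmxA mulmxV // mul1mx -[RHS]mulmxA K mulmx1.
Qed.

Lemma H_up_transition c A : H_up g c A i y = S^T *m H_up g c A j y' *m S.
Proof.
rewrite /H_up energy_transition inv_metric momentum_up_transition mulmxBr mulmxBl.
rewrite -!scalemxAr -!scalemxAl trmx_mul.
by rewrite !mulmxA.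
Qed.

Let Wq : overlap i j q := Wy.
Let oV := @sm_open _ _ _ manifold_M i j.

Let christoffel' a :
  christoffel_mx (g i) a q *m T = dmx a (jacobian (transition i j)) q
    + T *m \sum_b T a b *: christoffel_mx (g j) b (transition i j q).
Proof.
apply: (christoffel_transition oV (@open_chart_image _ _ _ manifold_M j) (@transition_image i j)
  (@smooth_transition _ _ _ manifold_M i j) (@smooth_jacobian _ _ _ manifold_M i j)
  (@metric_smooth j) _ (@metric_transition i j) _ _ (@metric_sym j) (@metric_unit j) a Wq).
- by move=> z a' b' Wz; exact: (jacobianE a' b' (differentiable_transition manifold_M Wz)).
- by move=> z Wz; exact/metric_sym/overlap_image/Wz.
- by move=> z Wz; exact/metric_unit/overlap_image/Wz.
Qed.

(** The transformation law solved for the derivative of the inverse Jacobian, which is what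
    differentiating the new momenta produces. *)
Let inv_jacobian' a : dmx a (fun z => invmx (jacobian (transition i j) z)) q
    + S *m christoffel_mx (g i) a q
  = (\sum_b T a b *: christoffel_mx (g j) b (transition i j q)) *m S.
Proof.
rewrite (dmx_inv a oV Wq (@smooth_jacobian _ _ _ manifold_M i j) (@jacobian_transition i j)) -/T -/S.
have := christoffel' a.
move: (dmx a _ q) (christoffel_mx _ a q) (\sum_b _) => D Ga G E.
have -> : Ga = (D + T *m G) *m S by rewrite -E /S mulmxK.
by rewrite mulmxDl mulmxDr !mulmxA /S mulVmx // mul1mx addKr.
Qed.

Let jacobian_cotangent : jacobian (cotangent_transition i j) y
  = block_mx T (\matrix_(a, b) (p *m (dmx a (fun z => invmx (jacobian (transition i j) z)) q)^T) 0 b)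
      0 S^T.
Proof.
have dF := smooth_mx_diff (@smooth_cotangent_transition i j) (Wy : W i j y).
have rowJ k : row k (jacobian (cotangent_transition i j) y) = dmx k (cotangent_transition i j) y.
  apply/rowP => l; rewrite mxE dmxE; apply: jacobianE.
  by apply: differentiable_rV => l'; exact: dF.
have sS := smooth_mx_lsub (@oW i j) (@WW i j) (@smooth_inv_jacobian i j).
have dS := smooth_mx_diff (smooth_mx_tr sS) (Wy : W i j y).
have dr := smooth_mx_diff (smooth_mx_rsub (@oW i j)) (Wy : W i j y).
apply/row_matrixP => k; rewrite rowJ dmx_row (dmxM k dr dS) dmx_tr dmx_rsub.
rewrite (dmx_lsub (@WW i j) k (@smooth_transition _ _ _ manifold_M i j) (Wy : W i j y)).
rewrite (dmx_lsub (@WW i j) k (@smooth_inv_jacobian i j) (Wy : W i j y)).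
rewrite -(splitK k); case: (fintype.split k) => a; rewrite unsplitK /= /block_mx.
  rewrite rowKu row_row_mx mul0mx add0r; congr row_mx; apply/rowP => b.
    rewrite dmxE mxE; apply/esym/jacobianE.
    exact: (differentiable_transition manifold_M Wq).
  by rewrite [RHS]mxE [RHS]mxE.
by rewrite rowKd row_row_mx trmx0 mulmx0 addr0 row0 -rowE.
Qed.

(** The inhomogeneous term in the law of the Christoffel symbols compensates the derivative of the
    inverse Jacobian applied to p. Horizontal and vertical vectors therefore transform separately,
    which is what makes the metric and J globally defined. *)
Lemma adapted_frame_transition :
  adapted_frame g i y *m jacobian (cotangent_transition i j) y
  = block_mx T 0 0 S^T *m adapted_frame g j y'.
Proof.
rewrite jacobian_cotangent /adapted_frame !mulmx_block.
rewrite !mulmx0 !mul0mx !mul1mx !mulmx1 !addr0 !add0r; congr block_mx.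
apply/row_matrixP => a; rewrite linearD /= row_mul row_Gamma0 row_mul.
have -> : row a T *m Gamma0 g j y' = \sum_b T a b *: row b (Gamma0 g j y').
  by rewrite mulmx_sum_row; apply: eq_bigr => b _; rewrite mxE.
have := congr1 (fun X : 'M[R]_n => p *m X^T) (inv_jacobian' a).
rewrite trmxD trmx_mul mulmxDr trmx_mul raddf_sum mulmxA /= => E.
have -> : row a (\matrix_(a, b) (p *m (dmx a (fun z => invmx (jacobian (transition i j) z)) q)^T) 0 b)
    = p *m (dmx a (fun z => invmx (jacobian (transition i j) z)) q)^T.
  by apply/rowP => b; rewrite [LHS]mxE [LHS]mxE.
apply: etrans E _; rewrite mulmxA mulmx_sumr; apply: eq_bigr => b _.
rewrite trmxZ -scalemxAr row_Gamma0 momentum'; congr (_ *: (_ *m (christoffel_mx _ _ _)^T)).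
by rewrite /y' /cotangent_transition row_mxKl.
Qed.

End Point.
End CotangentTransition.

Lemma cotangent_eq (R : realType) n (M : atlas R n) (P Q : cotangent M) :
  base P = base Q -> Defs.comp P = Defs.comp Q -> P = Q.
Proof.
case: P Q => b k r o [b' k' r' o'] /= eb ek; case: _ / eb in r' o' *; case: _ / ek in r' o' *.
by rewrite (Prop_irrelevance r r') (Prop_irrelevance o o').
Qed.

Section CotangentOfComponents.
Context {R : realType} {n : nat} (M : atlas R n).
Hypothesis manifold_M : smooth_manifold M.
Variables (i : idx M) (x : pt M) (p : 'rV[R]_n).
Hypothesis ix : dom i x.

(** The covector rule and the normalisation off the chart domains leave no other choice once the
    components in the chart [i] are given. *)
Let comps k : 'rV[R]_n :=
  if pselect (dom k x) then p *m (transition_jacobian k i x)^T else 0.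

Let compsE k : dom k x -> comps k = p *m (transition_jacobian k i x)^T.
Proof. by rewrite /comps; case: pselect. Qed.

Let comps_rule k l : dom k x -> dom l x -> comps k = comps l *m (transition_jacobian k l x)^T.
Proof.
move=> kx lx; rewrite (compsE kx) (compsE lx).
by rewrite (transition_jacobian_mul manifold_M kx lx ix) trmx_mul mulmxA.
Qed.

Let comps_out k : ~ dom k x -> comps k = 0.
Proof. by rewrite /comps; case: pselect. Qed.

Definition cotangent_of : cotangent M := Cotangent comps_rule comps_out.

Lemma comp_cotangent_of : Defs.comp cotangent_of i = p.
Proof.
by rewrite [LHS](compsE ix) (transition_jacobian_id manifold_M ix) trmx1 mulmx1.
Qed.

End CotangentOfComponents.

(** * The tube as a manifold *)

Section TubeManifold.
Context {R : realType} {n : nat} (M : atlas R n) (g : field2 M) (c A : R).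
Hypotheses (manifold_M : smooth_manifold M) (metric_g : riemannian_metric g).
Hypotheses (c_gt0 : 0 < c) (A_gt0 : 0 < A).
Local Notation X := (tube g c A).
Implicit Types (i j : idx M) (x : pt X) (y : 'rV[R]_(n + n)).
Local Notation overlap i j := (chart i @` (dom i `&` dom j)).
Local Notation tube_dom i := (@dom R (n + n) X i).
Local Notation tube_chart i := (@chart R (n + n) X i).
Local Notation tube_overlap i j := (tube_chart i @` (tube_dom i `&` tube_dom j)).

Lemma tube_chart_transition i j x : tube_dom i x -> tube_dom j x ->
  tube_chart j x = cotangent_transition i j (tube_chart i x).
Proof.
move=> ix jx; rewrite /cotangent_transition /= row_mxKl row_mxKr; congr row_mx.
  by rewrite (transitionE (sm_chart_inj manifold_M)).
rewrite -transition_jacobian_def (invmx_transition_jacobian manifold_M ix jx).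
exact: (comp_rule jx ix).
Qed.

Lemma tube_chart_inj i x x' : tube_dom i x -> tube_dom i x' ->
  tube_chart i x = tube_chart i x' -> x = x'.
Proof.
case: x x' => [P tP] [Q tQ] iP iQ /eq_row_mx[/= bPQ kPQ].
have eb : base P = base Q by exact: (sm_chart_inj manifold_M iP iQ).
apply: eq_exist; apply: (cotangent_eq eb); apply/funext => k.
have [kP|kP] := pselect (dom k (base P)).
  have kQ : dom k (base Q) by rewrite -eb.
  by rewrite (comp_rule kP iP) (comp_rule kQ iQ) kPQ eb.
by rewrite !comp_out // -eb.
Qed.

(** The nontrivial inclusion builds a covector from its components in one chart. The norm bounds,
    known in that chart, pass to all others because the norm does not depend on the chart. *)
Lemma tube_overlapE i j : tube_overlap i j = tube_domain g c A i (overlap i j).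
Proof.
rewrite eqEsubset; split=> [_ [[P tP] [iP jP] <-]|y [[x [ix jx] xy] ny]].
  split; first by rewrite /= row_mxKl; exists (base P).
  exact: (tP i iP).
pose P := cotangent_of manifold_M (rsubmx y) ix.
have Pi : row_mx (chart i (base P)) (Defs.comp P i) = y.
  by rewrite comp_cotangent_of /= xy hsubmxK.
have tP : tube_set g c A P.
  suff H (k : idx M) : dom k (base P) ->
      0 < norm_sq g k (row_mx (chart k (base P)) (Defs.comp P k)) < 4 * c / A ^+ 2.
    exact: H.
  move=> kP.
  have yk : row_mx (chart k (base P)) (Defs.comp P k) = cotangent_transition i k y.
    rewrite -[in RHS]Pi /cotangent_transition row_mxKl row_mxKr; congr row_mx.
      by rewrite (transitionE (sm_chart_inj manifold_M)).
    rewrite -transition_jacobian_def (invmx_transition_jacobian manifold_M ix kP).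
    exact: (comp_rule kP ix).
  rewrite yk -(norm_sq_transition manifold_M metric_g) //.
  by exists x => //; rewrite -xy.
by exists (exist _ P tP).
Qed.

Lemma tube_chart_image i : @chart_image R (n + n) X i = tube_domain g c A i (chart_image i).
Proof. by have := tube_overlapE i i; rewrite !setIid. Qed.

Let tube_domain_open i j : open (tube_domain g c A i (overlap i j)).
Proof.
apply: open_tube_domain.
- exact: (@sm_open _ _ _ manifold_M).
- move=> a b; apply: (smooth_on_subset _ (metric_smooth metric_g a b)).
  exact: overlap_image.
- by move=> q /overlap_image/(metric_unit metric_g).
Qed.

Let tube_open i j : open (tube_overlap i j).
Proof. by rewrite tube_overlapE. Qed.

Let tube_transitionE i j : {in tube_overlap i j,
  cotangent_transition i j =1 @transition R (n + n) X i j}.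
Proof.
move=> y; rewrite inE => -[x [ix jx] <-].
by rewrite (@transitionE R (n + n) X (@tube_chart_inj) i j x ix jx) (tube_chart_transition ix jx).
Qed.

Let tube_smooth_transition i j :
  smooth_mx (tube_overlap i j) (@transition R (n + n) X i j).
Proof.
apply: (eq_smooth_mx (@tube_open i j) (@tube_transitionE i j)) => a b.
apply: (smooth_on_subset _ (smooth_cotangent_transition manifold_M a b)).
by rewrite tube_overlapE => y [].
Qed.

Let tube_continuous_transition i j y : tube_overlap i j y ->
  {for y, continuous (@transition R (n + n) X i j)}.
Proof.
move=> Wy; apply: differentiable_continuous; apply: differentiable_rV => l.
exact: (smooth_mx_diff (@tube_smooth_transition i j) Wy).
Qed.

Let tube_cover x : exists i, tube_dom i x.
Proof. exact: (sm_cover manifold_M (base (sval x))). Qed.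

(** Covectors over the same point lie in a common chart and are separated there; over distinct
    points, separating open sets of M are pulled back along the projection, read in charts. *)
Let tube_hausdorff : hausdorff_space (manifold_space X).
Proof.
rewrite open_hausdorff => x x' xx'.
have [i ix] := tube_cover x; have [j jx] := tube_cover x'.
have [bE|bN] := pselect (base (sval x) = base (sval x')).
  have ix' : tube_dom i x' by move: ix; rewrite /= bE.
  have cN : tube_chart i x != tube_chart i x'.
    by apply: contra_neq xx' => /(tube_chart_inj ix ix').
  have := @norm_hausdorff R 'rV[R]_(n + n); rewrite open_hausdorff => /(_ _ _ cN).
  case=> -[P1 P2] /= [P1x P2x] [w1 w2 /eqP P12].
  exists (tube_dom i `&` tube_chart i @^-1` P1, tube_dom i `&` tube_chart i @^-1` P2).
    by split; apply/mem_set; split=> //; exact: set_mem.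
  split; try exact: open_chart_preimage.
  apply/eqP; rewrite -subset0 => z [[_ z1] [_ z2]].
  by have : (P1 `&` P2) (tube_chart i z) by []; rewrite P12.
have bN' : (base (sval x) : manifold_space M) != base (sval x') by apply/eqP.
have := sm_hausdorff manifold_M; rewrite open_hausdorff => /(_ _ _ bN').
case=> -[V1 V2] /= [V1x V2x] [w1 w2 /eqP V12]; rewrite inE in V1x; rewrite inE in V2x.
have H k z (V : set (manifold_space M)) : open V -> V (base (sval z)) -> tube_dom k z ->
    exists O : set 'rV[R]_(n + n), [/\ open O, O (tube_chart k z) &
      forall w, tube_dom k w -> O (tube_chart k w) -> V (base (sval w))].
  move=> oV Vz kz.
  have [P [oP Pz PV]] := open_manifold_space (sm_chart_inj manifold_M)
    (@sm_open _ _ _ manifold_M) (@continuous_transition _ _ _ manifold_M) oV Vz kz.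
  exists (lsubmx @^-1` P); split.
  - apply: (@open_comp _ _ (fun y : 'rV[R]_(n + n) => lsubmx y : 'rV[R]_n)) => // y _.
    exact/differentiable_continuous/differentiable_lsubmx.
  - by rewrite /= row_mxKl.
  - by move=> w kw; rewrite /= row_mxKl => Pw; apply: PV; split.
have [P1 [oP1 P1x P1V]] := H i x V1 w1 V1x ix.
have [P2 [oP2 P2x P2V]] := H j x' V2 w2 V2x jx.
exists (tube_dom i `&` tube_chart i @^-1` P1, tube_dom j `&` tube_chart j @^-1` P2).
  by split; apply/mem_set.
split; try exact: open_chart_preimage.
apply/eqP; rewrite -subset0 => z [[iz z1] [jz z2]].
have : (V1 `&` V2) (base (sval z)) by split; [exact: P1V z1 | exact: P2V z2].
by rewrite V12.
Qed.

Lemma tube_manifold : smooth_manifold X.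
Proof.
split.
- exact: tube_cover.
- exact: tube_chart_inj.
- exact: tube_open.
- by move=> i j k; exact: tube_smooth_transition.
- exact: tube_hausdorff.
- have [C cC coverC] := countable_chart_cover (sm_cover manifold_M)
    (sm_second_countable manifold_M).
  apply: (@second_countable_manifold_space R (n + n) X (@tube_chart_inj) (@tube_open)
    (@tube_continuous_transition) C cC) => x.
  exact: coverC.
Qed.

End TubeManifold.

(** * Tensoriality and positivity on the tube *)

Lemma bilin_gram (R : realType) m (P B : 'M[R]_m) (u v : 'rV[R]_m) :
  bilin (P *m B *m P^T) u v = bilin B (u *m P) (v *m P).
Proof. by rewrite /bilin trmx_mul !mulmxA. Qed.

Section FrameChange.
Context {R : comUnitRingType} {m : nat}.
Variables F F' J D : 'M[R]_m.
Hypotheses (uF : F \in unitmx) (uF' : F' \in unitmx) (FJ : F *m J = D *m F').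

Let JE : J *m invmx F' = invmx F *m D.
Proof. by rewrite -[in LHS](mulKmx uF J) FJ !mulmxA mulmxK. Qed.

Lemma form_frame_change B B' : B = D *m B' *m D^T ->
  invmx F *m B *m (invmx F)^T = J *m (invmx F' *m B' *m (invmx F')^T) *m J^T.
Proof.
move=> ->; rewrite !mulmxA JE.
have -> : invmx F *m D *m B' *m (invmx F')^T *m J^T = invmx F *m D *m B' *m (J *m invmx F')^T.
  by rewrite trmx_mul mulmxA.
by rewrite JE trmx_mul !mulmxA.
Qed.

Lemma endo_frame_change E E' : E *m D = D *m E' ->
  invmx F *m E *m F *m J = J *m (invmx F' *m E' *m F').
Proof.
move=> ED; rewrite !mulmxA JE.
have -> : invmx F *m E *m F *m J = invmx F *m E *m (F *m J) by rewrite mulmxA.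
rewrite FJ.
have -> : invmx F *m E *m (D *m F') = invmx F *m (E *m D) *m F' by rewrite !mulmxA.
by rewrite ED !mulmxA.
Qed.

End FrameChange.

Section TubeTensors.
Context {R : realType} {n : nat} (M : atlas R n) (g : field2 M) (c A : R).
Hypotheses (manifold_M : smooth_manifold M) (metric_g : riemannian_metric g).
Hypotheses (c_gt0 : 0 < c) (A_gt0 : 0 < A).
Local Notation X := (tube g c A).
Implicit Types (i j : idx M) (x : pt X) (y : 'rV[R]_(n + n)).
Local Notation overlap i j := (chart i @` (dom i `&` dom j)).
Local Notation tube_dom i := (@dom R (n + n) X i).
Local Notation tube_chart i := (@chart R (n + n) X i).
Local Notation tube_overlap i j := (tube_chart i @` (tube_dom i `&` tube_dom j)).
Local Notation Wt i := (tube_domain g c A i (chart_image i)).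

Let manifold_X : smooth_manifold X.
Proof. exact: tube_manifold. Qed.

Let tube_jacobian i j x : tube_dom i x -> tube_dom j x ->
  @transition_jacobian R (n + n) X i j x = jacobian (cotangent_transition i j) (tube_chart i x).
Proof.
move=> ix jx; have oW := @sm_open _ _ _ manifold_X i j.
have Wx : tube_overlap i j (tube_chart i x) by exists x.
have Wx' : overlap i j (lsubmx (tube_chart i x)).
  by move: Wx; rewrite tube_overlapE // => -[].
have dF := smooth_mx_diff (@smooth_cotangent_transition _ _ _ manifold_M i j) Wx'.
apply/matrixP => a b.
apply: etrans (transition_jacobianE manifold_X a b ix jx) _.
apply: etrans _ (esym (jacobianE a b (differentiable_rV (dF 0)))).
apply: (eq_partial a oW Wx) => y; rewrite inE => -[z [iz jz] <-].
rewrite (@transitionE R (n + n) X (tube_chart_inj manifold_M) i j z iz jz).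
by rewrite (tube_chart_transition manifold_M iz jz).
Qed.

Let overlap_base i j x : tube_dom i x -> tube_dom j x -> overlap i j (lsubmx (tube_chart i x)).
Proof. by move=> ix jx; rewrite /= row_mxKl; exists (base (sval x)). Qed.

Let frame_transition i j x (T := jacobian (transition i j) (lsubmx (tube_chart i x)))
    (J := @transition_jacobian R (n + n) X i j x) :
  tube_dom i x -> tube_dom j x ->
  adapted_frame g i (tube_chart i x) *m J
  = block_mx T 0 0 (invmx T)^T *m adapted_frame g j (tube_chart j x).
Proof.
move=> ix jx; rewrite /J tube_jacobian // (tube_chart_transition manifold_M ix jx).
exact: (adapted_frame_transition manifold_M metric_g (overlap_base ix jx)).
Qed.

Lemma tube_metric_transition i j x (J := @transition_jacobian R (n + n) X i j x) :
  tube_dom i x -> tube_dom j x ->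
  tube_metric g c A i (tube_chart i x) = J *m tube_metric g c A j (tube_chart j x) *m J^T.
Proof.
move=> ix jx; have W := overlap_base ix jx.
set T := jacobian (transition i j) (lsubmx (tube_chart i x)).
have uT : T \in unitmx by exact: jacobian_transition W.
apply: (form_frame_change _ _ (frame_transition ix jx)).
- exact: adapted_frame_unit.
- exact: adapted_frame_unit.
rewrite tr_block_mx !trmx0 trmxK -/T.
rewrite (G_low_transition manifold_M metric_g W c A) (H_up_transition manifold_M metric_g W c A).
rewrite -(tube_chart_transition manifold_M ix jx) -/T !mulmx_block.
by rewrite !(mulmx0, mul0mx, addr0, add0r).
Qed.

Lemma tube_J_transition i j x (J := @transition_jacobian R (n + n) X i j x) :
  tube_dom i x -> tube_dom j x ->
  tube_J g c A i (tube_chart i x) *m J = J *m tube_J g c A j (tube_chart j x).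
Proof.
move=> ix jx; have W := overlap_base ix jx.
set T := jacobian (transition i j) (lsubmx (tube_chart i x)).
have uT : T \in unitmx by exact: jacobian_transition W.
apply: (endo_frame_change _ _ (frame_transition ix jx)).
- exact: adapted_frame_unit.
- exact: adapted_frame_unit.
rewrite -/T.
rewrite (G_low_transition manifold_M metric_g W c A) (H_up_transition manifold_M metric_g W c A).
rewrite -(tube_chart_transition manifold_M ix jx) -/T !mulmx_block.
have K : T^T *m (invmx T)^T = 1%:M by rewrite -trmx_mul mulVmx // trmx1.
rewrite !(mulmx0, mul0mx, addr0, add0r); congr block_mx.
  by rewrite -[LHS]mulmxA K mulmx1.
by rewrite mulNmx mulmxN mulmxKV.
Qed.

Let Wt_sym i q : chart_image i q -> (g i q)^T = g i q.
Proof. exact: metric_sym. Qed.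

Let Wt_unit i q : chart_image i q -> g i q \in unitmx.
Proof. exact: metric_unit. Qed.

(** The rank-one term is harmless as long as its coefficient is nonnegative. Otherwise the
    Cauchy-Schwarz inequality bounds it, leaving the factor (2c - A^2 t)/A: here the upper bound of
    the tube enters. *)
Let tube_adapted_pos i y (u : 'rV[R]_n) : Wt i y -> u != 0 -> 0 < bilin (G_low g c A i y) u u.
Proof.
move=> Wy u0; have Wq : chart_image i (lsubmx y) by case: Wy.
have t0 := energy_gt0 Wy; have tb := energy_bound A_gt0 Wy.
have [gs gu] := (Wt_sym Wq, Wt_unit Wq).
set t := energy g i y in t0 tb; set p := momentum y.
pose pu := momentum_up g i y.
pose a := bilin (metric_at g i y) u u; pose b := dot p u.
have a0 : 0 < a by exact: rm_pos.
have puG : pu *m metric_at g i y = p by rewrite /pu /momentum_up mulmxKV.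
have GE : bilin (G_low g c A i y) u u = A * t * a + (c - A ^+ 2 * t) / (A * t) * b ^+ 2.
  rewrite /G_low -/t -/p /bilin mulmxDr -!scalemxAr mulmxDl -!scalemxAl.
  rewrite [LHS]mxE; congr (_ + _); rewrite mxE; congr (_ * _).
  have -> : u *m (p^T *m p) *m u^T = (b ^+ 2)%:M.
    by rewrite mulmxA -[LHS]mulmxA (dotE u p) (dotE p u) -scalar_mxM (dotC u) expr2.
  by rewrite mxE eqxx mulr1n.
(* Cauchy-Schwarz, from g(u - s p#, u - s p#) >= 0 with s = (p u) / 2t *)
have CS : b ^+ 2 <= 2 * t * a.
  pose s := b / (2 * t); pose v := u - s *: pu.
  have v0 : 0 <= bilin (metric_at g i y) v v.
    have [->|v0] := eqVneq v 0; first by rewrite /bilin mul0mx mul0mx mxE.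
    by apply/ltW; exact: rm_pos.
  have bE w z : bilin (metric_at g i y) w z = dot (w *m metric_at g i y) z by [].
  have gD w z : dot (w *m metric_at g i y) z = dot w (z *m metric_at g i y).
    by rewrite dot_mulmx gs.
  have pp : dot p pu = 2 * t.
    by rewrite dotC /t /energy /norm_sq /bilin mulrC divfK.
  have vE : bilin (metric_at g i y) v v = a - 2 * s * b + s ^+ 2 * (2 * t).
    rewrite bE /v mulmxBl -scalemxAl puG dotDl dotNl dotZl !dotDr !dotNr !dotZr.
    rewrite pp -/b (gD u pu) puG (dotC u p) -/b -bE -/a.
    by ring.
  move: v0; rewrite vE /s.
  have -> : a - 2 * (b / (2 * t)) * b + (b / (2 * t)) ^+ 2 * (2 * t) = (2 * t * a - b ^+ 2) / (2 * t).
    by field; rewrite gt_eqF.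
  have t20 : 0 < (2 * t)^-1 by rewrite invr_gt0 mulr_gt0.
  by rewrite (pmulr_lge0 _ t20) subr_ge0.
have At : 0 < A * t by rewrite mulr_gt0.
rewrite GE; have [k0|k0] := leP 0 (c - A ^+ 2 * t).
  apply: ltr_wpDr; last exact: mulr_gt0.
  by apply: mulr_ge0; [exact: divr_ge0 k0 (ltW At) | exact: sqr_ge0].
have -> : A * t * a + (c - A ^+ 2 * t) / (A * t) * b ^+ 2
    = a * ((2 * c - A ^+ 2 * t) / A) + (A ^+ 2 * t - c) / (A * t) * (2 * t * a - b ^+ 2).
  by field; rewrite !gt_eqF.
apply: ltr_wpDr; last exact: mulr_gt0 a0 (divr_gt0 tb A_gt0).
apply: mulr_ge0; last by rewrite subr_ge0.
by apply: divr_ge0 _ (ltW At); rewrite subr_ge0 -subr_le0 ltW.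
Qed.


(** [H_up] is congruent to its inverse [G_low], through H = H G H^T. *)
Let tube_adapted_dual_pos i y (u : 'rV[R]_n) : Wt i y -> u != 0 -> 0 < bilin (H_up g c A i y) u u.
Proof.
move=> Wy u0; have Wq : chart_image i (lsubmx y) by case: Wy.
have GH : G_low g c A i y *m H_up g c A i y = 1%:M.
  by apply: (@Glow_Hup _ _ (metric_at g i y) (momentum y) c A (energy g i y)) => //;
    [exact: Wt_unit | exact: Wt_sym | exact: (energy_gt0 Wy) | exact: (energy_bound A_gt0 Wy)].
have HG := mulmx1C GH.
have Hs : (H_up g c A i y)^T = H_up g c A i y.
  by apply: (@Hup_sym _ _ (metric_at g i y) (momentum y) c A (energy g i y)) => //; exact: Wt_sym.
have HE : H_up g c A i y = H_up g c A i y *m G_low g c A i y *m (H_up g c A i y)^T.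
  by rewrite Hs HG mul1mx.
rewrite HE bilin_gram; apply: tube_adapted_pos Wy _.
by apply: contra_neq u0 => uH; rewrite -[u]mulmx1 -HG mulmxA uH mul0mx.
Qed.

Lemma tube_metric_pos i y (v : 'rV[R]_(n + n)) : Wt i y -> v != 0 ->
  0 < bilin (tube_metric g c A i y) v v.
Proof.
move=> Wy v0; rewrite /tube_metric bilin_gram.
set w := v *m _.
have w0 : w != 0.
  apply: contra_neq v0 => w0.
  by rewrite -[v](mulmxKV (adapted_frame_unit g i y)) -/w w0 mul0mx.
have -> (B C : 'M[R]_n) : bilin (block_mx B 0 0 C) w w
    = bilin B (lsubmx w) (lsubmx w) + bilin C (rsubmx w) (rsubmx w).
  rewrite /bilin -[w in LHS]hsubmxK tr_row_mx mul_row_block !mulmx0 addr0 add0r.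
  by rewrite mul_row_col mxE.
have [l0|l0] := eqVneq (lsubmx w) 0; last first.
  apply: ltr_pwDl; first exact: tube_adapted_pos.
  have [->|r0] := eqVneq (rsubmx w) 0; first by rewrite /bilin mul0mx mul0mx mxE.
  by apply: ltW; exact: tube_adapted_dual_pos.
rewrite l0 {1}/bilin mul0mx mul0mx mxE add0r; apply: tube_adapted_dual_pos => //.
by apply: contra_neq w0 => r0; rewrite -(hsubmxK w) l0 r0 row_mx0.
Qed.

End TubeTensors.

Theorem theorem5 (R : realType) (n : nat) (M : atlas R n) (g : field2 M)
    (c A : R) :
  (2 <= n)%N ->
  smooth_manifold M ->
  riemannian_metric g ->
  0 < c ->
  constant_sectional_curvature g c ->
  0 < A ->
  locally_symmetric_kahler_einstein (tube_metric g c A) (tube_J g c A).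
Proof.
move=> _ manifold_M metric_g c_gt0 sec_g A_gt0.
have oW i := @open_chart_image _ _ M manifold_M i.
have sm i := @metric_smooth _ _ M g metric_g i.
have sy i q := @metric_sym _ _ M g metric_g i q.
have un i q := @metric_unit _ _ M g metric_g i q.
(* The sectional curvature hypothesis enters through this matrix form, which is what flatness of the
   Gauss connection requires. *)
have cu i q a b := fun Wq : chart_image i q => constant_curvature_mx (oW i) (sm i) (sy i) (un i)
  c_gt0 (sec_g i) Wq a b.
have im i := tube_chart_image c A manifold_M metric_g i.
split.
- exact: tube_manifold.
- split.
  + split.
    * by move=> i a b; rewrite im; exact: (smooth_tube_metric (oW i) (sm i) (un i) A_gt0 a b).
    * by move=> i j x; exact: tube_metric_transition.
    * by move=> i y; rewrite im; exact: (tube_metric_sym (sy i)).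
    * by move=> i y v; rewrite im; exact: tube_metric_pos.
  + split.
    * by move=> i a b; rewrite im; exact: (smooth_tube_J (oW i) (sm i) (un i) A_gt0 a b).
    * by move=> i j x; exact: tube_J_transition.
    * by move=> i y; rewrite im; exact: (tube_J_square (sy i) (un i) A_gt0).
  + move=> i y u v; rewrite im => Wy.
    by rewrite -[in RHS](tube_hermitian (sy i) (un i) A_gt0 Wy) bilin_gram.
  + move=> i y; rewrite im => Wy k a b.
    exact: (tube_chart_integrable (oW i) (sm i) (sy i) (un i) c_gt0 A_gt0 (cu i) k a b Wy).
  + move=> i y; rewrite im => Wy a b k.
    exact: (tube_chart_closed (oW i) (sm i) (sy i) (un i) c_gt0 A_gt0 (cu i) a b k Wy).
- move=> i y; rewrite im => Wy s l k a b.
  exact: (tube_chart_locally_symmetric (oW i) (sm i) (sy i) (un i) c_gt0 A_gt0 (cu i) s l k a b Wy).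
- exists (A * ((n + 1 + 1)%:R / 2 - 1)) => i y; rewrite im => Wy a b.
  exact: (tube_chart_einstein (oW i) (sm i) (sy i) (un i) c_gt0 A_gt0 (cu i) a b Wy).
Qed.
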